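(* (a) Let $b$ be a one-component bounded function. Then there exists a constant $C=C(b)>0$ such that for every $a\in\mathbb{D}$, $$\sup_{z\in\mathbb{D}}\left|\frac{1-\overline{b(a)}b(z)}{1-\overline{a}z}\right|\le C\,\frac{1-|b(a)|^2}{1-|a|^2}.$$ (b) Let $b\in H^\infty(\mathbb{D})$ with $\|b\|_\infty=1$, and assume there is a constant $0<C<1$ such that $\mathrm{spec}(b)\subseteq\overline{\{z\in\mathbb{D}:|b(z)|\le C\}}$. If $$\sup_{z\in\mathbb{D}}\left|\frac{1-\overline{b(a)}b(z)}{1-\overline{a}z}\right|=o\!\left(\frac{1}{1-|a|^2}\right)\quad\text{as } |b(a)|\to1,$$ (that is, for every $\varepsilon>0$ there is $\delta>0$ such that the left side is at most $\varepsilon/(1-|a|^2)$ whenever $a\in\mathbb{D}$ and $|b(a)|>1-\delta$), then $b$ is one-component.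
   Context: $\mathbb{D}$ is the open unit disc and $H^\infty(\mathbb{D})$ the bounded analytic functions on $\mathbb{D}$, $\|b\|_\infty=\sup_{\mathbb{D}}|b|$. For $b\in H^\infty(\mathbb{D})$ with $\|b\|_\infty=1$, the spectrum of $b$ is $\mathrm{spec}(b)=\{\xi\in\partial\mathbb{D}: \liminf_{z\to\xi, z\in\mathbb{D}}|b(z)|<1\}$. Such a $b$ is called one-component (a one-component bounded function) if there is a constant $0<C<1$ such that (a) $\mathrm{spec}(b)\subseteq\overline{\{z\in\mathbb{D}:|b(z)|\le C\}}$ and (b) the set $\{z\in\mathbb{D}:|b(z)|<C\}$ is connected. *)

(* Defs.v *)
From Stdlib Require Import Reals.
From Coquelicot Require Import Coquelicot.
Open Scope R_scope.

Definition in_disc (z : C) : Prop := Cmod z < 1.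

(* b is holomorphic on the disc: complex-differentiable at every point of D
   (only the values of b on D matter). *)
Definition holo_disc (b : C -> C) : Prop :=
  forall z : C, in_disc z -> @ex_derive C_AbsRing C_NormedModule b z.

Definition sup_disc (b : C -> C) : Rbar :=
  Lub_Rbar (fun r => exists z, in_disc z /\ r = Cmod (b z)).

Definition Hinf_norm1 (b : C -> C) : Prop :=
  holo_disc b /\ sup_disc b = Finite 1.

Definition liminf_disc (b : C -> C) (xi : C) : Rbar :=
  Lub_Rbar (fun l => exists delta : R, 0 < delta /\
    l = real (Glb_Rbar (fun y => exists z, in_disc z /\
            0 < Cmod (z - xi) < delta /\ y = Cmod (b z)))).

Definition spec (b : C -> C) (xi : C) : Prop :=
  Cmod xi = 1 /\ Rbar_lt (liminf_disc b xi) (Finite 1).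

Definition closure_C (A : C -> Prop) (x : C) : Prop :=
  forall P : C -> Prop, locally x P -> exists z, A z /\ P z.

Definition connected_C (S : C -> Prop) : Prop :=
  forall U V : C -> Prop, open U -> open V ->
    (forall z, S z -> U z \/ V z) ->
    (forall z, S z -> U z -> V z -> False) ->
    (exists z, S z /\ U z) -> (exists z, S z /\ V z) -> False.

Definition one_component (b : C -> C) : Prop :=
  Hinf_norm1 b /\
  exists c : R, 0 < c < 1 /\
    (forall xi, spec b xi ->
       closure_C (fun z => in_disc z /\ Cmod (b z) <= c) xi) /\
    connected_C (fun z => in_disc z /\ Cmod (b z) < c).

Definition kernel_sup (b : C -> C) (a : C) : Rbar :=
  Lub_Rbar (fun r => exists z, in_disc z /\
    r = Cmod ((1 - Cconj (b a) * b z) / (1 - Cconj a * z))%C).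

(* Main.v *)
Require Import Defs.
From Stdlib Require Import Reals Lra Lia Psatz Classical ClassicalEpsilon List.
From Coquelicot Require Import Coquelicot.
Open Scope R_scope.

(** Everything rests on the maximum modulus principle for functions that are merely complex
    differentiable at each point of an open subset of the disc.

    (b) Let [|b a|] be close to 1, with [a > 0] and [b a > 0] after rotations.  The kernel bound keeps
    the spectrum out of an arc around [1] of length a multiple of [1 - a].  On [D \ {a}] consider
    [N = ((z^2 - 2 g z + 1) P - sg (1 - z^2)) / ((a - z) (1 - a z))] with [P = (1 - b) / (1 + b)], where
    [sg] cancels the pole at [a].  On the unit circle [Re N] is [Re P >= 0] times a factor which is
    nonnegative when [Re z <= g], and [Re P] vanishes where [Re z >= g]; hence [Re N >= 0].  Its limit
    at [a] says that [|b|] strictly increases along the radius through [a].  So a level set [{|b| < c'}]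
    with [c'] close to 1 is star-shaped about [0].

    (a) If every circle [|z - a| = rho], [r <= rho <= 2 r], meets [{|b| < c}], then comparing a power of
    [b] with a finite Blaschke product whose zeros are chosen on these circles gives
    [1 - |b a| >= kappa (1 - |a|) / r].  Hence for [r] of order [(1 - |a|) / (1 - |b a|)] some circle
    misses the connected set [{|b| < c}], which therefore stays out of the disc of centre [a] and
    radius [r].  There [|b|] tends to 1 at the unit circle, a barrier gives
    [1 - |b z| = O((1 - |z|) / r)], and Schwarz-Pick turns this into [|b'| = O(1 / r)], i.e.
    [|b z - b a| = O(|z - a| / r)], which is the kernel estimate. *)

(** * Complex differentiability *)

(** No boundary values of [b] are at hand, so every boundary condition is a local estimate near the
    points outside the domain. In (b) the obstacle is that away from the arc nothing is known of [b]
    near the circle, and [P] may be unbounded there. Only [Re P >= 0] is available, so the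
    multiplier must be real on the circle with the right sign. When [|z| = 1] one has
    [z^2 - 2 g z + 1 = 2 z (Re z - g)] and [(a - z) (1 - a z) = - z |1 - a z|^2], so the quadratic
    whose roots are the end points of the arc does this. The limit at [a] gives a strict sign only
    if [g < 2 a / (1 + a^2)], that is [1 - g > (1 - a)^2 / (1 + a^2)]; this is why the arc has
    length comparable to [1 - a]. In (a) the level set may be arbitrarily irregular, so its harmonic
    measure is replaced by the effect of discs around finitely many of its points. Their number is
    not controlled; the estimates survive because the potentials of the points are bounded by
    arctangent differences that telescope. *)

Definition cder (f : C -> C) (z l : C) : Prop :=
  forall eps, 0 < eps -> exists d, 0 < d /\ forall w, Cmod (w - z) < d ->
    Cmod (f w - f z - l * (w - z)) <= eps * Cmod (w - z).

Definition holo_at (f : C -> C) (z : C) : Prop := exists l, cder f z l.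

(** Bridge to the derivative in the statement of the theorem. The factors are exchanged because
    [scal] puts the increment first. *)
Lemma cder_is_derive (f : C -> C) (z l : C) :
  cder f z l <-> @is_derive C_AbsRing C_NormedModule f z l.
Proof.
  split.
  - intros H. split; [apply is_linear_scal_l|].
    intros x Hx. apply (@is_filter_lim_locally_unique _ (AbsRing_NormedModule C_AbsRing)) in Hx.
    subst x. intros eps.
    destruct (H eps (cond_pos eps)) as [d [Hd Hw]].
    exists (mkposreal d Hd). intros w Hwb.
    specialize (Hw w Hwb).
    change (Cmod (f w - f z - (w - z) * l)%C <= eps * Cmod (w - z)%C).
    rewrite (Cmult_comm _ l). exact Hw.
  - intros [_ H] eps Heps.
    destruct (H z (fun P HP => HP) (mkposreal eps Heps)) as [d Hd].
    exists d. split; [apply cond_pos|]. intros w Hw. specialize (Hd w Hw).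
    change (Cmod (f w - f z - (w - z) * l)%C <= eps * Cmod (w - z)%C) in Hd.
    rewrite (Cmult_comm _ l) in Hd. exact Hd.
Qed.

Lemma cder_const (c z : C) : cder (fun _ => c) z 0.
Proof. apply cder_is_derive. apply @is_derive_const. Qed.

Lemma cder_id (z : C) : cder (fun w => w) z 1.
Proof.
  intros eps He. exists 1. split; [lra|]. intros w _.
  replace (w - z - 1 * (w - z))%C with (0 : C) by ring.
  rewrite Cmod_0. apply Rmult_le_pos; [lra|apply Cmod_ge_0].
Qed.

Lemma cder_plus f g z l m : cder f z l -> cder g z m ->
  cder (fun w => f w + g w)%C z (l + m)%C.
Proof.
  rewrite !cder_is_derive. intros Hf Hg. exact (is_derive_plus f g z l m Hf Hg).
Qed.

Lemma cder_opp f z l : cder f z l -> cder (fun w => - f w)%C z (- l)%C.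
Proof. rewrite !cder_is_derive. intros Hf. exact (is_derive_opp f z l Hf). Qed.

Lemma cder_minus f g z l m : cder f z l -> cder g z m ->
  cder (fun w => f w - g w)%C z (l - m)%C.
Proof. intros Hf Hg. apply cder_plus; [exact Hf|]. now apply cder_opp. Qed.

Lemma cder_small f z l : cder f z l -> forall eps, 0 < eps ->
  exists d, 0 < d /\ forall w, Cmod (w - z) < d -> Cmod (f w - f z) < eps.
Proof.
  intros H eps He. destruct (H 1 Rlt_0_1) as [d [Hd Hw]].
  pose proof (Cmod_ge_0 l) as Hl.
  assert (Hq : 0 < eps / (2 + Cmod l)) by (apply Rdiv_lt_0_compat; lra).
  exists (Rmin d (eps / (2 + Cmod l))). split; [apply Rmin_glb_lt; lra|].
  intros w Hwd. pose proof (Rmin_l d (eps / (2 + Cmod l))). pose proof (Rmin_r d (eps / (2 + Cmod l))).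
  assert (Hz1 : Cmod (w - z) < d) by lra. specialize (Hw w Hz1).
  replace (f w - f z)%C with ((f w - f z - l * (w - z)) + l * (w - z))%C by ring.
  eapply Rle_lt_trans; [apply Cmod_triangle|]. rewrite Cmod_mult.
  assert (Hz2 : Cmod (w - z) * (2 + Cmod l) < eps).
  { apply Rlt_le_trans with (eps / (2 + Cmod l) * (2 + Cmod l)).
    apply Rmult_lt_compat_r; lra. right; field; lra. }
  pose proof (Cmod_ge_0 (w - z)). nra.
Qed.

Lemma cder_mult f g z l m : cder f z l -> cder g z m ->
  cder (fun w => f w * g w)%C z (l * g z + f z * m)%C.
Proof.
  intros Hf Hg eps He.
  pose proof (Cmod_ge_0 l) as Hl. pose proof (Cmod_ge_0 m) as Hm.
  pose proof (Cmod_ge_0 (f z)) as Hfz. pose proof (Cmod_ge_0 (g z)) as Hgz.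
  set (K := 1 + Cmod (f z) + Cmod (g z) + Cmod l).
  assert (HK : 0 < eps / (2 * K)) by (apply Rdiv_lt_0_compat; unfold K; lra).
  destruct (Hf _ HK) as [d1 [Hd1 H1]]. destruct (Hg _ HK) as [d2 [Hd2 H2]].
  (* The bound 1 keeps [g w] within [Cmod (g z) + 1]; the bound [eps / (2 * K)] controls the cross
     term [l * (w - z) * (g w - g z)]. *)
  destruct (cder_small g z m Hg (Rmin 1 (eps / (2 * K)))) as [d3 [Hd3 H3]].
  { apply Rmin_glb_lt; lra. }
  exists (Rmin d1 (Rmin d2 d3)). split; [repeat apply Rmin_glb_lt; assumption|].
  intros w Hw.
  assert (Cmod (w - z) < d1 /\ Cmod (w - z) < d2 /\ Cmod (w - z) < d3) as [A1 [A2 A3]].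
  { pose proof (Rmin_l d1 (Rmin d2 d3)). pose proof (Rmin_r d1 (Rmin d2 d3)).
    pose proof (Rmin_l d2 d3). pose proof (Rmin_r d2 d3). lra. }
  specialize (H1 w A1). specialize (H2 w A2). specialize (H3 w A3).
  replace (f w * g w - f z * g z - (l * g z + f z * m) * (w - z))%C with
    ((f w - f z - l * (w - z)) * (g z + (g w - g z)) + l * (w - z) * (g w - g z)
      + f z * (g w - g z - m * (w - z)))%C by ring.
  eapply Rle_trans; [apply Cmod_triangle|].
  eapply Rle_trans; [apply Rplus_le_compat_r, Cmod_triangle|].
  rewrite !Cmod_mult.
  pose proof (Cmod_triangle (g z) (g w - g z)) as HT.
  pose proof (Rmin_l 1 (eps / (2 * K))). pose proof (Rmin_r 1 (eps / (2 * K))).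
  pose proof (Cmod_ge_0 (w - z)) as Hwz. pose proof (Cmod_ge_0 (g w - g z)) as Hgw.
  pose proof (Cmod_ge_0 (f w - f z - l * (w - z))) as Hfw.
  set (e := eps / (2 * K)) in *.
  assert (Hek : e * K = eps / 2) by (unfold e; field; unfold K; lra).
  assert (B1 : Cmod (f w - f z - l * (w - z)) * Cmod (g z + (g w - g z)) <= (e * Cmod (w - z)) * (Cmod (g z) + 1)).
  { apply Rmult_le_compat; try assumption. apply Cmod_ge_0. lra. }
  assert (B2 : Cmod l * Cmod (w - z) * Cmod (g w - g z) <= Cmod l * Cmod (w - z) * e).
  { apply Rmult_le_compat_l. apply Rmult_le_pos; lra. lra. }
  assert (B3 : Cmod (f z) * Cmod (g w - g z - m * (w - z)) <= Cmod (f z) * (e * Cmod (w - z))).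
  { apply Rmult_le_compat_l; lra. }
  assert (B4 : e * Cmod (w - z) * (Cmod (g z) + 1) + Cmod l * Cmod (w - z) * e + Cmod (f z) * (e * Cmod (w - z))
     = (e * K) * Cmod (w - z)) by (unfold K; ring).
  rewrite Hek in B4. nra.
Qed.

Lemma cder_comp f g z l m : cder g z m -> cder f (g z) l ->
  cder (fun w => f (g w)) z (l * m)%C.
Proof.
  intros Hg Hf eps He.
  pose proof (Cmod_ge_0 l) as Hl. pose proof (Cmod_ge_0 m) as Hm.
  set (K := 2 + Cmod l + Cmod m).
  set (e := Rmin 1 (eps / K)).
  assert (HK : 0 < K) by (unfold K; lra).
  assert (Hq : 0 < eps / K) by (apply Rdiv_lt_0_compat; lra).
  assert (He0 : 0 < e) by (apply Rmin_glb_lt; lra).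
  pose proof (Rmin_l 1 (eps / K)) as E1. pose proof (Rmin_r 1 (eps / K)) as E2. fold e in E1, E2.
  destruct (Hf e He0) as [d1 [Hd1 H1]]. destruct (Hg e He0) as [d2 [Hd2 H2]].
  destruct (cder_small g z m Hg d1 Hd1) as [d3 [Hd3 H3]].
  exists (Rmin d2 d3). split; [now apply Rmin_glb_lt|]. intros w Hw.
  pose proof (Rmin_l d2 d3) as A2. pose proof (Rmin_r d2 d3) as A3.
  specialize (H2 w ltac:(lra)). specialize (H3 w ltac:(lra)). specialize (H1 (g w) H3).
  replace (f (g w) - f (g z) - l * m * (w - z))%C with
    ((f (g w) - f (g z) - l * (g w - g z)) + l * (g w - g z - m * (w - z)))%C by ring.
  eapply Rle_trans; [apply Cmod_triangle|]. rewrite Cmod_mult.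
  pose proof (Cmod_triangle (g w - g z - m * (w - z)) (m * (w - z))) as HT.
  replace (g w - g z - m * (w - z) + m * (w - z))%C with (g w - g z)%C in HT by ring.
  rewrite Cmod_mult in HT. pose proof (Cmod_ge_0 (w - z)) as Hx.
  set (x := Cmod (w - z)) in *. set (y := Cmod (g w - g z)) in *.
  apply Rle_trans with (e * ((1 + Cmod m) * x) + Cmod l * (e * x)).
  - apply Rplus_le_compat.
    + eapply Rle_trans; [exact H1|]. apply Rmult_le_compat_l; nra.
    + apply Rmult_le_compat_l; lra.
  - apply Rle_trans with (eps / K * K * x).
    + replace (e * ((1 + Cmod m) * x) + Cmod l * (e * x)) with (e * (1 + Cmod m + Cmod l) * x) by ring.
      apply Rmult_le_compat_r; [lra|]. apply Rmult_le_compat; [lra|lra|lra|unfold K; lra].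
    + right. field. lra.
Qed.

Lemma cder_inv_id (z : C) : z <> 0 -> cder (fun w => / w)%C z (- / (z * z))%C.
Proof.
  intros Hz eps He. assert (Hz0 : 0 < Cmod z) by now apply Cmod_gt_0.
  set (q := Cmod z) in *.
  assert (Hd : 0 < eps * q ^ 3 / 2).
  { apply Rdiv_lt_0_compat; [|lra]. apply Rmult_lt_0_compat; [lra|]. now apply pow_lt. }
  exists (Rmin (q / 2) (eps * q ^ 3 / 2)). split; [apply Rmin_glb_lt; lra|].
  intros w Hw. pose proof (Rmin_l (q / 2) (eps * q ^ 3 / 2)). pose proof (Rmin_r (q / 2) (eps * q ^ 3 / 2)).
  assert (Hwq : q / 2 < Cmod w).
  { pose proof (Cmod_triangle w (z - w)) as HT. replace (w + (z - w))%C with z in HT by ring.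
    replace (z - w)%C with (- (w - z))%C in HT by ring. rewrite Cmod_opp in HT. fold q in HT. lra. }
  assert (Hw0 : w <> 0) by (apply Cmod_gt_0; lra).
  replace (/ w - / z - - / (z * z) * (w - z))%C with ((w - z) * (w - z) / (w * (z * z)))%C.
  2:{ field. now split. }
  rewrite Cmod_div. 2:{ apply Cmod_gt_0. rewrite !Cmod_mult. fold q. apply Rmult_lt_0_compat; nra. }
  rewrite !Cmod_mult. fold q.
  apply Rle_trans with (Cmod (w - z) * Cmod (w - z) / (q / 2 * (q * q))).
  - unfold Rdiv. apply Rmult_le_compat_l. apply Rle_0_sqr. apply Rinv_le_contravar; nra.
  - pose proof (Cmod_ge_0 (w - z)).
    replace (Cmod (w - z) * Cmod (w - z) / (q / 2 * (q * q))) with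
      (Cmod (w - z) / (q ^ 3 / 2) * Cmod (w - z)) by (field; lra).
    apply Rmult_le_compat_r; [lra|].
    apply Rle_trans with (eps * q ^ 3 / 2 / (q ^ 3 / 2)).
    + unfold Rdiv at 1 3. apply Rmult_le_compat_r; [|lra].
      left; apply Rinv_0_lt_compat. pose proof (pow_lt q 3 Hz0). lra.
    + right. field. lra.
Qed.

Lemma cder_inv (f : C -> C) (z l : C) : f z <> 0 -> cder f z l -> cder (fun w => / f w)%C z (- / (f z * f z) * l)%C.
Proof. intros Hz Hf. apply (cder_comp (fun w => / w)%C f); [exact Hf|]. now apply cder_inv_id. Qed.

Lemma cder_ext_loc f g z l r : 0 < r -> (forall w, Cmod (w - z) < r -> f w = g w) ->
  cder f z l -> cder g z l.
Proof.
  intros Hr He H eps Heps. destruct (H eps Heps) as [d [Hd Hw]].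
  exists (Rmin r d). split; [now apply Rmin_glb_lt|]. intros w Hwd.
  pose proof (Rmin_l r d). pose proof (Rmin_r r d).
  rewrite <- !He; [apply Hw; lra| |lra].
  replace (z - z)%C with (0:C) by ring. rewrite Cmod_0. lra.
Qed.

Lemma holo_const c z : holo_at (fun _ => c) z. Proof. eexists; apply cder_const. Qed.
Lemma holo_id z : holo_at (fun w => w) z. Proof. eexists; apply cder_id. Qed.
Lemma holo_plus f g z : holo_at f z -> holo_at g z -> holo_at (fun w => f w + g w)%C z.
Proof. intros [l Hl] [m Hm]. eexists. now apply cder_plus; eauto. Qed.
Lemma holo_opp f z : holo_at f z -> holo_at (fun w => - f w)%C z.
Proof. intros [l Hl]. eexists. now apply cder_opp; eauto. Qed.
Lemma holo_minus f g z : holo_at f z -> holo_at g z -> holo_at (fun w => f w - g w)%C z.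
Proof. intros [l Hl] [m Hm]. eexists. now apply cder_minus; eauto. Qed.
Lemma holo_mult f g z : holo_at f z -> holo_at g z -> holo_at (fun w => f w * g w)%C z.
Proof. intros [l Hl] [m Hm]. eexists. now apply cder_mult; eauto. Qed.
Lemma holo_inv (f : C -> C) (z : C) : f z <> 0 -> holo_at f z -> holo_at (fun w => / f w)%C z.
Proof. intros Hz [l Hl]. eexists. now apply cder_inv; eauto. Qed.
Lemma holo_div (f g : C -> C) (z : C) : g z <> 0 -> holo_at f z -> holo_at g z -> holo_at (fun w => f w / g w)%C z.
Proof. intros Hz Hf Hg. apply holo_mult; [exact Hf|]. now apply holo_inv. Qed.
Lemma holo_comp f g z : holo_at g z -> holo_at f (g z) -> holo_at (fun w => f (g w)) z.
Proof. intros [m Hm] [l Hl]. eexists. apply cder_comp; eauto. Qed.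
Lemma holo_pow f z n : holo_at f z -> holo_at (fun w => f w ^ n)%C z.
Proof.
  intros Hf. induction n as [|n IH]; [exact (holo_const 1 z)|].
  exact (holo_mult f (fun w => f w ^ n)%C z Hf IH).
Qed.

Lemma holo_continuous f z : holo_at f z -> forall eps, 0 < eps ->
  exists d, 0 < d /\ forall w, Cmod (w - z) < d -> Cmod (f w - f z) < eps.
Proof. intros [l Hl]. now apply cder_small with l. Qed.

(** * The complex exponential and its derivative *)

Definition cexp (z : C) : C := (exp (Re z) * cos (Im z), exp (Re z) * sin (Im z)).

Lemma cexp_plus (z w : C) : cexp (z + w)%C = (cexp z * cexp w)%C.
Proof.
  unfold cexp, Cmult, Cplus, Re, Im; simpl. rewrite exp_plus, cos_plus, sin_plus.
  f_equal; ring.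
Qed.

Lemma Cmod_cexp z : Cmod (cexp z) = exp (Re z).
Proof.
  unfold Cmod, cexp; simpl.
  replace (_ + _) with (exp (Re z) * exp (Re z) * (Rsqr (sin (Im z)) + Rsqr (cos (Im z)))) by (unfold Rsqr; ring).
  rewrite sin2_cos2, Rmult_1_r. apply sqrt_square. left; apply exp_pos.
Qed.

Lemma cexp_0 : cexp 0 = 1.
Proof. unfold cexp, Re, Im; simpl. rewrite exp_0, cos_0, sin_0. unfold RtoC. f_equal; ring. Qed.

Lemma derive_eps (f : R -> R) (x l : R) : is_derive f x l -> forall eps, 0 < eps ->
  exists d, 0 < d /\ forall h, Rabs h < d -> Rabs (f (x + h) - f x - l * h) <= eps * Rabs h.
Proof.
  intros H eps He. apply is_derive_Reals in H. destruct (H eps He) as [d Hd].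
  exists d. split; [apply cond_pos|]. intros h Hh.
  destruct (Req_dec h 0) as [->|Hn].
  - rewrite Rplus_0_r. replace (f x - f x - l * 0) with 0 by ring. rewrite Rabs_R0. lra.
  - specialize (Hd h Hn Hh).
    replace (f (x + h) - f x - l * h) with (((f (x + h) - f x) / h - l) * h) by (field; exact Hn).
    rewrite Rabs_mult. apply Rmult_le_compat_r; [apply Rabs_pos|lra].
Qed.

Lemma Cmod_le_abs (z : C) : Cmod z <= Rabs (Re z) + Rabs (Im z).
Proof.
  pose proof (Rabs_pos (Re z)). pose proof (Rabs_pos (Im z)).
  apply Rsqr_incr_0_var; [|lra]. rewrite !Rsqr_pow2, Cmod2_alt.
  rewrite <- (pow2_abs (Re z)), <- (pow2_abs (Im z)). nra.
Qed.

Lemma im_le_Cmod (z : C) : Rabs (Im z) <= Cmod z.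
Proof. eapply Rle_trans; [|apply Rmax_Cmod]. apply Rmax_r. Qed.

Lemma cder_cexp_0 : cder cexp 0 1.
Proof.
  intros eps He.
  assert (Hexp : is_derive exp 0 1) by (auto_derive; [trivial|rewrite exp_0; ring]).
  assert (Hcos : is_derive cos 0 0) by (auto_derive; [trivial|rewrite sin_0; ring]).
  assert (Hsin : is_derive sin 0 1) by (auto_derive; [trivial|rewrite cos_0; ring]).
  set (e := Rmin 1 (eps / 12)).
  assert (He0 : 0 < e) by (apply Rmin_glb_lt; lra).
  pose proof (Rmin_l 1 (eps / 12)) as E1. pose proof (Rmin_r 1 (eps / 12)) as E2. fold e in E1, E2.
  destruct (derive_eps _ _ _ Hexp e He0) as [d1 [Hd1 H1]].
  destruct (derive_eps _ _ _ Hcos e He0) as [d2 [Hd2 H2]].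
  destruct (derive_eps _ _ _ Hsin e He0) as [d3 [Hd3 H3]].
  exists (Rmin e (Rmin d1 (Rmin d2 d3))). split; [repeat apply Rmin_glb_lt; lra|].
  intros w Hw. replace (w - 0)%C with w in * by ring. rewrite cexp_0.
  assert (Cmod w < e /\ Cmod w < d1 /\ Cmod w < d2 /\ Cmod w < d3) as [A0 [A1 [A2 A3]]].
  { pose proof (Rmin_l e (Rmin d1 (Rmin d2 d3))). pose proof (Rmin_r e (Rmin d1 (Rmin d2 d3))).
    pose proof (Rmin_l d1 (Rmin d2 d3)). pose proof (Rmin_r d1 (Rmin d2 d3)).
    pose proof (Rmin_l d2 d3). pose proof (Rmin_r d2 d3). lra. }
  pose proof (re_le_Cmod w) as Hre. pose proof (im_le_Cmod w) as Him.
  set (m := Cmod w) in *.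
  specialize (H1 (Re w) ltac:(lra)). specialize (H2 (Im w) ltac:(lra)). specialize (H3 (Im w) ltac:(lra)).
  rewrite Rplus_0_l, exp_0 in H1. rewrite Rplus_0_l, cos_0 in H2. rewrite Rplus_0_l, sin_0 in H3.
  destruct w as [x y]. simpl in *.
  eapply Rle_trans; [apply Cmod_le_abs|].
  unfold cexp; simpl.
  (* Both coordinates of the error are written through the first-order errors of [exp], [cos] and
     [sin]. Each resulting term is at most [2 * e * m]; for the products of two increments this uses
     [m < e]. *)
  replace (exp x * cos y + - (1) + - (1 * x - 0 * y)) with
    ((exp x - 1 - 1 * x) + (exp x - 1 - 1 * x) * (cos y - 1 - 0 * y)
       + (1 + x) * (cos y - 1 - 0 * y)) by ring.
  replace (exp x * sin y + - 0 + - (1 * y + 0 * x)) with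
    ((exp x - 1 - 1 * x) * (sin y - 0 - 1 * y) + (exp x - 1 - 1 * x) * y + (1 + x) * (sin y - 0 - 1 * y) + x * y) by ring.
  set (X := exp x - 1 - 1 * x) in *. set (Y := cos y - 1 - 0 * y) in *. set (Z := sin y - 0 - 1 * y) in *.
  assert (m0 : 0 <= m) by apply Cmod_ge_0.
  assert (M1 : Rabs X <= e * m) by nra. assert (M2 : Rabs Y <= e * m) by nra. assert (M3 : Rabs Z <= e * m) by nra.
  assert (M4 : Rabs x <= m) by lra. assert (M5 : Rabs y <= m) by lra.
  assert (M6 : Rabs (1 + x) <= 2). { eapply Rle_trans; [apply Rabs_triang|]. rewrite Rabs_R1. lra. }
  assert (Q : forall a b A B, Rabs a <= A -> Rabs b <= B -> Rabs (a * b) <= A * B).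
  { intros. rewrite Rabs_mult. apply Rmult_le_compat; try assumption; apply Rabs_pos. }
  assert (T : forall a b A B, Rabs a <= A -> Rabs b <= B -> Rabs (a + b) <= A + B).
  { intros. eapply Rle_trans; [apply Rabs_triang|]. lra. }
  apply Rle_trans with ((e * m + (e * m) * (e * m) + 2 * (e * m)) + ((e * m) * (e * m) + (e * m) * m + 2 * (e * m) + m * m)).
  { apply Rplus_le_compat.
    - apply T; [apply T; [assumption|apply Q; assumption]|apply Q; assumption].
    - apply T; [apply T; [apply T; apply Q; assumption|apply Q; assumption]|apply Q; assumption]. }

  clear - A0 E1 E2 He0 m0 He. clearbody e m.
  assert (Hm1 : m <= 1) by lra. assert (Hem : 0 <= e * m) by (apply Rmult_le_pos; lra).
  assert (e * m <= e) by (rewrite <- (Rmult_1_r e) at 2; apply Rmult_le_compat_l; lra).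
  assert ((e * m) * (e * m) <= e * m) by (rewrite <- (Rmult_1_r (e * m)) at 3; apply Rmult_le_compat_l; lra).
  assert (e * m * m <= e * m) by (rewrite <- (Rmult_1_r (e * m)) at 2; apply Rmult_le_compat_l; lra).
  assert (m * m <= e * m) by (apply Rmult_le_compat_r; lra).
  assert (e * m * 12 <= eps * m) by (replace (e * m * 12) with (12 * e * m) by ring; apply Rmult_le_compat_r; lra).
  lra.
Qed.

Lemma cder_cexp z : cder cexp z (cexp z).
Proof.
  assert (H : cder (fun w => cexp z * cexp (w - z))%C z (0 * cexp (z - z) + cexp z * (1 * (1 - 0)))%C).
  { apply (cder_mult (fun _ => cexp z) (fun w => cexp (w - z))); [apply cder_const|].
    apply (cder_comp cexp (fun w => w - z)%C).
    - apply cder_minus; [apply cder_id|apply cder_const].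
    - replace (z - z)%C with (0:C) by ring. apply cder_cexp_0. }
  replace (0 * cexp (z - z) + cexp z * (1 * (1 - 0)))%C with (cexp z) in H by ring.
  apply (cder_ext_loc (fun w => cexp z * cexp (w - z))%C cexp z (cexp z) 1); [lra| |exact H].
  intros w _. rewrite <- cexp_plus. f_equal. ring.
Qed.

Lemma holo_cexp f z : holo_at f z -> holo_at (fun w => cexp (f w)) z.
Proof. intros Hf. apply (holo_comp cexp); [exact Hf|]. eexists. apply cder_cexp. Qed.

(** * Goursat on rectangles and circle means *)

(** Compactness by nested rectangles: if [P] failed somewhere, it would fail on a sequence of
    quarters shrinking to a point [(x0, y0)], against the local hypothesis there. [P x y t] speaks
    of the rectangle with corner [(x, y)] and sides [w * t], [h * t]. It serves for Goursat, for the
    existence of a maximum, and, with [h = 0], for intervals of radii. *)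
Lemma bisection_induction (w h : R) (P : R -> R -> R -> Prop) :
  0 <= w -> 0 <= h ->
  (forall x y t, 0 < t -> P x y (t / 2) -> P (x + w * (t / 2)) y (t / 2) ->
     P x (y + h * (t / 2)) (t / 2) -> P (x + w * (t / 2)) (y + h * (t / 2)) (t / 2) -> P x y t) ->
  (forall x0 y0, exists d, 0 < d /\ forall x y t, 0 < t < d ->
     x <= x0 <= x + w * t -> y <= y0 <= y + h * t -> P x y t) ->
  forall x y t, 0 < t -> P x y t.
Proof.
  intros Hw Hh Hsplit Hloc x y t Ht. apply NNPP. intros Hn.
  (* The alternatives [s <= 0] make the statement total in [s], so that a choice function can be
     extracted without side conditions. *)
  assert (Hstep : forall (u : R * R) (s : R), exists v : R * R,
    (fst u <= fst v <= fst u + w * (s / 2) \/ s <= 0) /\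
    (snd u <= snd v <= snd u + h * (s / 2) \/ s <= 0) /\
    (0 < s -> ~ P (fst u) (snd u) s -> ~ P (fst v) (snd v) (s / 2))).
  { intros [a b] s. simpl. destruct (Rle_or_lt s 0) as [Hs|Hs].
    - exists (a, b). repeat split; try (now right). intros; lra.
    - assert (0 <= w * (s / 2)) by (apply Rmult_le_pos; lra).
      assert (0 <= h * (s / 2)) by (apply Rmult_le_pos; lra).
      destruct (classic (P a b (s / 2))) as [H1|H1].
      2:{ exists (a, b). simpl. repeat split; try (left; lra). now intros. }
      destruct (classic (P (a + w * (s / 2)) b (s / 2))) as [H2|H2].
      2:{ exists (a + w * (s / 2), b). simpl. repeat split; try (left; lra). now intros. }
      destruct (classic (P a (b + h * (s / 2)) (s / 2))) as [H3|H3].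
      2:{ exists (a, b + h * (s / 2)). simpl. repeat split; try (left; lra). now intros. }
      exists (a + w * (s / 2), b + h * (s / 2)). simpl. repeat split; try (left; lra).
      intros _ Hf H4. apply Hf. now apply Hsplit. }
  set (next := fun u s => proj1_sig (constructive_indefinite_description _ (Hstep u s))).
  assert (Hnext : forall u s, 0 < s ->
     fst u <= fst (next u s) <= fst u + w * (s / 2) /\
     snd u <= snd (next u s) <= snd u + h * (s / 2) /\
     (~ P (fst u) (snd u) s -> ~ P (fst (next u s)) (snd (next u s)) (s / 2))).
  { intros u s Hs. unfold next.
    destruct (constructive_indefinite_description _ (Hstep u s)) as [v [H1 [H2 H3]]]. simpl.
    split; [destruct H1; [assumption|lra]|]. split; [destruct H2; [assumption|lra]|]. now apply H3. }
  set (T := fun n : nat => t / 2 ^ n).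
  assert (HT : forall n, 0 < T n).
  { intros n. apply Rdiv_lt_0_compat; [lra|]. apply pow_lt; lra. }
  assert (HTS : forall n, T (S n) = T n / 2).
  { intros n. unfold T. simpl. field. apply pow_nonzero; lra. }
  set (u := fix u n := match n with O => (x, y) | S n => next (u n) (T n) end).
  assert (Hu : forall n, ~ P (fst (u n)) (snd (u n)) (T n)).
  { induction n as [|n IH].
    - simpl. unfold T. simpl. replace (t / 1) with t by field. exact Hn.
    - rewrite HTS. simpl. now apply Hnext. }
  assert (Hnest : forall n k, fst (u n) <= fst (u (n + k)%nat) /\
     fst (u (n + k)%nat) + w * T (n + k)%nat <= fst (u n) + w * T n /\
     snd (u n) <= snd (u (n + k)%nat) /\
     snd (u (n + k)%nat) + h * T (n + k)%nat <= snd (u n) + h * T n).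
  { intros n k. induction k as [|k IH].
    - rewrite Nat.add_0_r. lra.
    - rewrite Nat.add_succ_r, HTS. simpl.
      destruct (Hnext (u (n + k)%nat) (T (n + k)%nat) (HT _)) as [A [B _]]. lra. }
  assert (Hpos : forall n, 0 <= w * T n /\ 0 <= h * T n).
  { intros n. specialize (HT n). split; apply Rmult_le_pos; lra. }
  assert (Hbelow : forall m n, fst (u m) <= fst (u n) + w * T n /\ snd (u m) <= snd (u n) + h * T n).
  { intros m n. destruct (Nat.le_ge_cases m n) as [H|H].
    - destruct (Hnest m (n - m)%nat) as [A [_ [B _]]]. replace (m + (n - m))%nat with n in * by lia.
      specialize (Hpos n). lra.
    - destruct (Hnest n (m - n)%nat) as [_ [A [_ B]]]. replace (n + (m - n))%nat with m in * by lia.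
      specialize (Hpos m). lra. }
  destruct (completeness (fun v => exists n, v = fst (u n))) as [x0 [Hx1 Hx2]].
  { exists (fst (u O) + w * T O). intros v [n ->]. apply Hbelow. }
  { exists (fst (u O)). now exists O. }
  destruct (completeness (fun v => exists n, v = snd (u n))) as [y0 [Hy1 Hy2]].
  { exists (snd (u O) + h * T O). intros v [n ->]. apply Hbelow. }
  { exists (snd (u O)). now exists O. }
  destruct (Hloc x0 y0) as [d [Hd HP]].
  assert (exists n, T n < d) as [n Hnd].
  { destruct (pow_lt_1_zero (1 / 2)) with (y := d / t) as [N HN].
    - rewrite Rabs_pos_eq; lra.
    - apply Rdiv_lt_0_compat; lra.
    - exists N. specialize (HN N (Nat.le_refl N)).
      rewrite Rabs_pos_eq in HN by (apply pow_le; lra).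
      unfold T. apply Rlt_le_trans with (t * (d / t)); [|right; field; lra].
      replace (t / 2 ^ N) with (t * (1 / 2) ^ N).
      + apply Rmult_lt_compat_l; lra.
      + unfold Rdiv. rewrite Rmult_1_l, pow_inv. reflexivity. }
  apply (Hu n). apply HP.
  - split; [apply HT|exact Hnd].
  - split; [apply Hx1; now exists n|]. apply Hx2. intros v [m ->]. apply Hbelow.
  - split; [apply Hy1; now exists n|]. apply Hy2. intros v [m ->]. apply Hbelow.
Qed.

Definition diff2 (p : R -> R -> R) (x y A B : R) : Prop :=
  forall eps, 0 < eps -> exists d, 0 < d /\ forall x' y', Rabs (x' - x) < d -> Rabs (y' - y) < d ->
    Rabs (p x' y' - p x y - (A * (x' - x) + B * (y' - y))) <= eps * (Rabs (x' - x) + Rabs (y' - y)).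

Lemma continuous_R_eps (f : R -> R) x :
  (forall eps, 0 < eps -> exists d, 0 < d /\ forall x', Rabs (x' - x) < d -> Rabs (f x' - f x) < eps) ->
  continuous f x.
Proof.
  intros H. apply filterlim_locally. intros eps.
  destruct (H eps (cond_pos eps)) as [d [Hd Hx]]. exists (mkposreal d Hd).
  intros x' Hx'. apply Hx. exact Hx'.
Qed.

Lemma diff2_continuous_aux (p : R -> R -> R) x y A B : diff2 p x y A B ->
  forall eps, 0 < eps -> exists d, 0 < d /\ forall x' y', Rabs (x' - x) < d -> Rabs (y' - y) < d ->
    Rabs (p x' y' - p x y) < eps.
Proof.
  intros H eps He. destruct (H 1 Rlt_0_1) as [d [Hd Hp]].
  set (K := 2 + Rabs A + Rabs B). pose proof (Rabs_pos A). pose proof (Rabs_pos B).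
  assert (HK : 0 < eps / (2 * K)) by (apply Rdiv_lt_0_compat; unfold K; lra).
  exists (Rmin d (eps / (2 * K))). split; [now apply Rmin_glb_lt|].
  intros x' y' Hx Hy. pose proof (Rmin_l d (eps / (2 * K))). pose proof (Rmin_r d (eps / (2 * K))).
  specialize (Hp x' y' ltac:(lra) ltac:(lra)).
  replace (p x' y' - p x y) with ((p x' y' - p x y - (A * (x' - x) + B * (y' - y)))
     + (A * (x' - x) + B * (y' - y))) by ring.
  eapply Rle_lt_trans; [apply Rabs_triang|].
  eapply Rle_lt_trans; [apply Rplus_le_compat_l, Rabs_triang|]. rewrite !Rabs_mult.
  pose proof (Rabs_pos (x' - x)). pose proof (Rabs_pos (y' - y)).
  set (e := eps / (2 * K)) in *. assert (Ek : e * K = eps / 2) by (unfold e; field; unfold K; lra).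
  set (X := Rabs (x' - x)) in *. set (Y := Rabs (y' - y)) in *.
  assert (Rabs A * X <= Rabs A * e) by (apply Rmult_le_compat_l; lra).
  assert (Rabs B * Y <= Rabs B * e) by (apply Rmult_le_compat_l; lra).
  unfold K in Ek. lra.
Qed.

Lemma diff2_continuous_l p x y A B : diff2 p x y A B -> continuous (fun s => p s y) x.
Proof.
  intros H. apply continuous_R_eps. intros eps He.
  destruct (diff2_continuous_aux p x y A B H eps He) as [d [Hd Hp]].
  exists d. split; [exact Hd|]. intros x' Hx. apply Hp; [exact Hx|].
  unfold Rminus. rewrite Rplus_opp_r, Rabs_R0. exact Hd.
Qed.

Lemma diff2_continuous_r p x y A B : diff2 p x y A B -> continuous (fun s => p x s) y.
Proof.
  intros H. apply continuous_R_eps. intros eps He.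
  destruct (diff2_continuous_aux p x y A B H eps He) as [d [Hd Hp]].
  exists d. split; [exact Hd|]. intros y' Hy. apply Hp; [|exact Hy].
  unfold Rminus. rewrite Rplus_opp_r, Rabs_R0. exact Hd.
Qed.

Lemma RInt_Chasles_R (f : R -> R) a b c : ex_RInt f a b -> ex_RInt f b c ->
  RInt f a b + RInt f b c = RInt f a c.
Proof. exact (RInt_Chasles f a b c). Qed.

Lemma RInt_plus_R (f g : R -> R) a b : ex_RInt f a b -> ex_RInt g a b ->
  RInt (fun x => f x + g x) a b = RInt f a b + RInt g a b.
Proof. exact (RInt_plus f g a b). Qed.

Lemma RInt_near_const (f : R -> R) a b c e : a <= b -> ex_RInt f a b ->
  (forall s, a <= s <= b -> Rabs (f s - c) <= e) -> Rabs (RInt f a b - c * (b - a)) <= e * (b - a).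
Proof.
  intros Hab Hf Hs.
  assert (Hc : ex_RInt (fun _ : R => c) a b) by apply ex_RInt_const.
  replace (RInt f a b - c * (b - a)) with (RInt (fun s => f s - c) a b).
  - rewrite (Rmult_comm e). apply abs_RInt_le_const; [exact Hab| |exact Hs].
    exact (ex_RInt_minus f (fun _ => c) a b Hf Hc).
  - assert (E := RInt_minus f (fun _ => c) a b Hf Hc). rewrite RInt_const in E.
    rewrite (Rmult_comm c). exact E.
Qed.

(* Goursat's bisection: the partial derivatives need not be continuous. *)
Lemma goursat_rectangle (p q : R -> R -> R) (X : R) :
  (forall x y, x < X -> exists A B D, diff2 p x y A B /\ diff2 q x y B D) ->
  forall x y a b, x < a < X -> y < b ->
    RInt (fun s => p s y - p s b) x a + RInt (fun s => q a s - q x s) y b = 0.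
Proof.
  intros Hd x y a b [Hxa HaX] Hyb.
  assert (Hp : forall x1 a1 y1 y2, x1 <= a1 < X -> ex_RInt (fun s => p s y1 - p s y2) x1 a1).
  { intros x1 a1 y1 y2 H1. apply (ex_RInt_continuous (V := R_CompleteNormedModule)). intros s Hs.
    rewrite Rmax_right in Hs by lra.
    destruct (Hd s y1) as (A1 & B1 & D1 & E1 & _); [lra|].
    destruct (Hd s y2) as (A2 & B2 & D2 & E2 & _); [lra|].
    apply (continuous_minus (fun s => p s y1) (fun s => p s y2));
      eapply diff2_continuous_l; eassumption. }
  assert (Hq : forall x1 x2 y1 y2, x1 < X -> x2 < X -> ex_RInt (fun s => q x1 s - q x2 s) y1 y2).
  { intros x1 x2 y1 y2 H1 H2. apply (ex_RInt_continuous (V := R_CompleteNormedModule)). intros s Hs.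
    destruct (Hd x1 s) as (A1 & B1 & D1 & _ & E1); [lra|].
    destruct (Hd x2 s) as (A2 & B2 & D2 & _ & E2); [lra|].
    apply (continuous_minus (fun s => q x1 s) (fun s => q x2 s));
      eapply diff2_continuous_r; eassumption. }
  set (circ := fun x y a b => RInt (fun s => p s y - p s b) x a + RInt (fun s => q a s - q x s) y b).
  change (circ x y a b = 0).
  (* Circulation is additive under a cut at [(m, n)]: each inner side is traversed twice in opposite
     directions. *)
  assert (Hadd : forall x y a b m n, x <= m -> m <= a -> a < X ->
    circ x y a b = circ x y m n + circ m y a n + circ x n m b + circ m n a b).
  { clear x y a b Hxa HaX Hyb. intros x y a b m n H1 H2 H3. unfold circ.
    rewrite <- (RInt_Chasles_R (fun s => p s y - p s b) x m a) by (apply Hp; lra).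
    rewrite <- (RInt_Chasles_R (fun s => q a s - q x s) y n b) by (apply Hq; lra).
    rewrite (RInt_ext (fun s => p s y - p s b) (fun s => (p s y - p s n) + (p s n - p s b)) x m) by (intros; simpl; ring).
    rewrite (RInt_ext (fun s => p s y - p s b) (fun s => (p s y - p s n) + (p s n - p s b)) m a) by (intros; simpl; ring).
    rewrite (RInt_ext (fun s => q a s - q x s) (fun s => (q a s - q m s) + (q m s - q x s)) y n) by (intros; simpl; ring).
    rewrite (RInt_ext (fun s => q a s - q x s) (fun s => (q a s - q m s) + (q m s - q x s)) n b) by (intros; simpl; ring).
    rewrite (RInt_plus_R (fun s => p s y - p s n) (fun s => p s n - p s b) x m) by (apply Hp; lra).
    rewrite (RInt_plus_R (fun s => p s y - p s n) (fun s => p s n - p s b) m a) by (apply Hp; lra).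
    rewrite (RInt_plus_R (fun s => q a s - q m s) (fun s => q m s - q x s) y n) by (apply Hq; lra).
    rewrite (RInt_plus_R (fun s => q a s - q m s) (fun s => q m s - q x s) n b) by (apply Hq; lra).
    ring. }
  set (w := a - x). set (h := b - y).
  assert (Hsmall : forall eps, 0 < eps -> Rabs (circ x y a b) <= eps).
  { intros eps He. set (K := 4 * (w + h) * (w + h)).
    assert (HK : 0 < K) by (unfold K, w, h; nra).
    set (e := eps / K). assert (He0 : 0 < e) by (apply Rdiv_lt_0_compat; assumption).
    assert (HeK : e * K = eps) by (unfold e; field; lra).
    assert (HP : x + w * 1 < X -> Rabs (circ x y (x + w * 1) (y + h * 1)) <= eps * 1 ^ 2).
    2:{ replace (x + w * 1) with a in HP by (unfold w; ring).
        replace (y + h * 1) with b in HP by (unfold h; ring). specialize (HP HaX). lra. }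
    apply (bisection_induction w h
      (fun x y t => x + w * t < X -> Rabs (circ x y (x + w * t) (y + h * t)) <= eps * t ^ 2));
      [unfold w; lra|unfold h; lra| | |lra].
    - clear - Hadd Hxa. intros u v t Ht H1 H2 H3 H4 HX.
      assert (Hwt : 0 <= w * (t / 2)) by (apply Rmult_le_pos; unfold w; lra).
      rewrite (Hadd u v _ _ (u + w * (t / 2)) (v + h * (t / 2))) by lra.
      replace (u + w * (t / 2) + w * (t / 2)) with (u + w * t) in H2, H4 by field.
      replace (v + h * (t / 2) + h * (t / 2)) with (v + h * t) in H3, H4 by field.
      specialize (H1 ltac:(lra)). specialize (H2 ltac:(lra)). specialize (H3 ltac:(lra)). specialize (H4 ltac:(lra)).
      eapply Rle_trans; [apply Rabs_triang|].
      eapply Rle_trans; [apply Rplus_le_compat_r, Rabs_triang|].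
      eapply Rle_trans; [apply Rplus_le_compat_r, Rplus_le_compat_r, Rabs_triang|].
      replace (eps * t ^ 2) with (eps * (t / 2) ^ 2 + eps * (t / 2) ^ 2 + eps * (t / 2) ^ 2 + eps * (t / 2) ^ 2) by field.
      lra.
    - intros x0 y0. destruct (Rlt_or_le x0 X) as [Hx0|Hx0].
      2:{ exists 1. split; [lra|]. intros; lra. }
      destruct (Hd x0 y0 Hx0) as (A & B & D & E1 & E2).
      destruct (E1 e He0) as [d1 [Hd1 F1]]. destruct (E2 e He0) as [d2 [Hd2 F2]].
      set (d := Rmin d1 d2). assert (Hd0 : 0 < d) by now apply Rmin_glb_lt.
      pose proof (Rmin_l d1 d2) as L1. pose proof (Rmin_r d1 d2) as L2. fold d in L1, L2.
      assert (Hwh : 0 < w + h) by (unfold w, h; lra).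
      exists (d / (w + h)). split; [now apply Rdiv_lt_0_compat|].
      intros u v t [Ht Htd] Hu Hv HX.
      assert (Htw : t * (w + h) < d).
      { apply Rlt_le_trans with (d / (w + h) * (w + h)); [apply Rmult_lt_compat_r; lra|right; field; lra]. }
      assert (Hw0 : 0 < w * t) by (apply Rmult_lt_0_compat; unfold w; lra).
      assert (Hh0 : 0 < h * t) by (apply Rmult_lt_0_compat; unfold h; lra).
      assert (Hball : forall s r, u <= s <= u + w * t -> v <= r <= v + h * t ->
         Rabs (s - x0) < d /\ Rabs (r - y0) < d /\ Rabs (s - x0) + Rabs (r - y0) <= t * (w + h)).
      { intros s r Hs Hr.
        assert (Rabs (s - x0) <= w * t) by (apply Rabs_le; lra).
        assert (Rabs (r - y0) <= h * t) by (apply Rabs_le; lra). lra. }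
      (* The affine part of [p] contributes [- B * (h * t)] over a length [w * t], that of [q]
         contributes [B * (w * t)] over a length [h * t]. The shared entry [B] of the two gradients
         makes them cancel. *)
      assert (G1 : forall s, u <= s <= u + w * t ->
        Rabs (p s v - p s (v + h * t) - (- B * (h * t))) <= 2 * (e * (t * (w + h)))).
      { intros s Hs.
        destruct (Hball s v Hs ltac:(lra)) as [a1 [a2 a3]].
        destruct (Hball s (v + h * t) Hs ltac:(lra)) as [b1 [b2 b3]].
        assert (I1 := F1 s v ltac:(lra) ltac:(lra)). assert (I2 := F1 s (v + h * t) ltac:(lra) ltac:(lra)).
        replace (p s v - p s (v + h * t) - (- B * (h * t))) with
          ((p s v - p x0 y0 - (A * (s - x0) + B * (v - y0)))
            - (p s (v + h * t) - p x0 y0 - (A * (s - x0) + B * (v + h * t - y0)))) by ring.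
        eapply Rle_trans; [apply Rabs_triang|]. rewrite Rabs_Ropp.
        apply Rmult_le_compat_l with (r := e) in a3; [|lra].
        apply Rmult_le_compat_l with (r := e) in b3; [|lra]. lra. }
      assert (G2 : forall s, v <= s <= v + h * t ->
        Rabs (q (u + w * t) s - q u s - B * (w * t)) <= 2 * (e * (t * (w + h)))).
      { intros s Hs.
        destruct (Hball u s ltac:(lra) Hs) as [a1 [a2 a3]].
        destruct (Hball (u + w * t) s ltac:(lra) Hs) as [b1 [b2 b3]].
        assert (I1 := F2 u s ltac:(lra) ltac:(lra)). assert (I2 := F2 (u + w * t) s ltac:(lra) ltac:(lra)).
        replace (q (u + w * t) s - q u s - B * (w * t)) with
          ((q (u + w * t) s - q x0 y0 - (B * (u + w * t - x0) + D * (s - y0)))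
            - (q u s - q x0 y0 - (B * (u - x0) + D * (s - y0)))) by ring.
        eapply Rle_trans; [apply Rabs_triang|]. rewrite Rabs_Ropp.
        apply Rmult_le_compat_l with (r := e) in a3; [|lra].
        apply Rmult_le_compat_l with (r := e) in b3; [|lra]. lra. }
      assert (J1 := RInt_near_const _ u (u + w * t) _ _ ltac:(lra) (Hp u (u + w * t) v (v + h * t) ltac:(lra)) G1).
      assert (J2 := RInt_near_const _ v (v + h * t) _ _ ltac:(lra) (Hq (u + w * t) u v (v + h * t) ltac:(lra) ltac:(lra)) G2).
      unfold circ. set (I1 := RInt _ u _) in *. set (I2 := RInt _ v _) in *.
      replace (I1 + I2) with ((I1 - - B * (h * t) * (u + w * t - u)) + (I2 - B * (w * t) * (v + h * t - v))) by ring.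
      eapply Rle_trans; [apply Rabs_triang|].
      eapply Rle_trans; [apply Rplus_le_compat; [exact J1|exact J2]|].
      assert (Eq : 2 * (e * (t * (w + h))) * (u + w * t - u) + 2 * (e * (t * (w + h))) * (v + h * t - v)
        = e * K * t ^ 2 / 2) by (unfold K; field).
      rewrite Eq, HeK. pose proof (pow2_ge_0 t). nra. }
  destruct (Req_dec (circ x y a b) 0) as [|Hn]; [assumption|].
  assert (H0 := Rabs_pos_lt _ Hn). specialize (Hsmall (Rabs (circ x y a b) / 2) ltac:(lra)). lra.
Qed.

(** The Cauchy-Riemann equations: the common entry [- Im l] is what [goursat_rectangle] asks of the
    form [Re G dx - Im G dy], the real part of [G dz]. *)
Lemma cder_diff2 (G : C -> C) (x y : R) (l : C) : cder G (x, y) l ->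
  diff2 (fun s t => Re (G (s, t))) x y (Re l) (- Im l) /\
  diff2 (fun s t => - Im (G (s, t))) x y (- Im l) (- Re l).
Proof.
  intros H.
  assert (K : forall eps, 0 < eps -> exists d, 0 < d /\ forall x' y', Rabs (x' - x) < d -> Rabs (y' - y) < d ->
    Cmod (G (x', y') - G (x, y) - l * ((x', y') - (x, y))) <= eps * (Rabs (x' - x) + Rabs (y' - y))).
  { intros eps He. destruct (H eps He) as [d [Hd HG]]. exists (d / 2). split; [lra|].
    intros x' y' Hx Hy.
    assert (Hm := Cmod_le_abs ((x', y') - (x, y))%C). simpl in Hm.
    change (x' + - x) with (x' - x) in Hm. change (y' + - y) with (y' - y) in Hm.
    eapply Rle_trans; [apply HG; lra|]. apply Rmult_le_compat_l; lra. }
  split; intros eps He; destruct (K eps He) as [d [Hd HG]]; exists d; (split; [exact Hd|]);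
    intros x' y' Hx Hy; (eapply Rle_trans; [|apply HG; assumption]).
  - eapply Rle_trans; [|apply re_le_Cmod]. right. f_equal.
    destruct l as [l1 l2]. unfold Re, Im; simpl. ring.
  - eapply Rle_trans; [|apply im_le_Cmod]. right. rewrite <- Rabs_Ropp. f_equal.
    destruct l as [l1 l2]. unfold Re, Im; simpl. ring.
Qed.

(* In the coordinate [z = z0 + exp (s + i t)] circles become vertical segments, and the two
   horizontal sides of the rectangle [s1 <= s <= s2, 0 <= t <= 2 pi] cancel by periodicity. *)
Lemma circle_mean_im (f : C -> C) (z0 : C) (rho r A : R) : 0 < r < rho ->
  (forall z, Cmod (z - z0) < rho -> holo_at f z) ->
  (forall z, Cmod (z - z0) = r -> Im (f z) <= A) -> Im (f z0) <= A.
Proof.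
  intros [Hr Hrho] Hf HA. apply Rnot_lt_le. intros Hlt.
  set (eta := (Im (f z0) - A) / 2).
  assert (Heta : 0 < eta) by (unfold eta; lra).
  assert (H0 : Cmod (z0 - z0) < rho).
  { replace (z0 - z0)%C with (0 : C) by ring. rewrite Cmod_0. lra. }
  destruct (holo_continuous f z0 (Hf z0 H0) eta Heta) as [d [Hd Hc]].
  (* The inner circle is so small that [Im f > A + eta] on it, while [Im f <= A] on the circle of
     radius [r]. The difference of the two vertical integrands is then at least [eta], although its
     integral is 0. *)
  set (s2 := ln r). set (r1 := Rmin (r / 2) (d / 2)).
  assert (Hr1 : 0 < r1) by (apply Rmin_glb_lt; lra).
  pose proof (Rmin_l (r / 2) (d / 2)) as M1. pose proof (Rmin_r (r / 2) (d / 2)) as M2. fold r1 in M1, M2.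
  set (s1 := ln r1).
  set (G := fun zeta : C => f (z0 + cexp zeta)%C).
  assert (Hmod : forall s t, Cmod (z0 + cexp (s, t) - z0) = exp s).
  { intros s t. replace (z0 + cexp (s, t) - z0)%C with (cexp (s, t)) by ring. apply Cmod_cexp. }
  assert (HG : forall x y, x < ln rho -> exists A B D,
     diff2 (fun s t => Re (G (s, t))) x y A B /\ diff2 (fun s t => - Im (G (s, t))) x y B D).
  { intros x y Hx.
    assert (holo_at G (x, y)) as [l Hl].
    { apply (holo_comp f (fun zeta => z0 + cexp zeta)%C).
      - apply holo_plus; [apply holo_const|]. apply (holo_cexp (fun w => w)), holo_id.
      - apply Hf. rewrite Hmod. rewrite <- (exp_ln rho) by lra. now apply exp_increasing. }
    destruct (cder_diff2 G x y l Hl) as [D1 D2]. exists (Re l), (- Im l), (- Re l). now split. }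
  assert (HPI := PI_RGT_0).
  assert (Hs : s1 < s2 < ln rho) by (split; apply ln_increasing; lra).
  assert (E := goursat_rectangle _ _ (ln rho) HG s1 0 s2 (2 * PI) Hs ltac:(lra)).
  simpl in E.
  rewrite (RInt_ext (fun s => Re (G (s, 0)) - Re (G (s, 2 * PI))) (fun _ => 0)) in E.
  2:{ intros s _. unfold G, cexp, Re, Im; simpl. rewrite cos_0, sin_0, cos_2PI, sin_2PI. ring. }
  rewrite RInt_const in E.
  assert (E2 : RInt (fun t => - Im (G (s2, t)) - - Im (G (s1, t))) 0 (2 * PI) = 0).
  { assert (E3 : (s2 - s1) * 0 + RInt (fun t => - Im (G (s2, t)) - - Im (G (s1, t))) 0 (2 * PI) = 0) by exact E.
    rewrite Rmult_0_r, Rplus_0_l in E3. exact E3. }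
  clear E. rename E2 into E.
  assert (Hex : forall s, s < ln rho -> ex_RInt (fun t => - Im (G (s, t))) 0 (2 * PI)).
  { intros s Hsl. apply (ex_RInt_continuous (V := R_CompleteNormedModule)). intros t _.
    destruct (HG s t Hsl) as (A1 & B1 & D1 & _ & E1).
    exact (diff2_continuous_r (fun s t => - Im (G (s, t))) s t B1 D1 E1). }
  assert (Hle : RInt (fun _ => eta) 0 (2 * PI) <= RInt (fun t => - Im (G (s2, t)) - - Im (G (s1, t))) 0 (2 * PI)).
  { apply RInt_le; [lra|apply ex_RInt_const| |].
    - apply (ex_RInt_minus (fun t => - Im (G (s2, t))) (fun t => - Im (G (s1, t)))); apply Hex; lra.
    - intros t _.
      assert (B2 : Im (G (s2, t)) <= A).
      { apply HA. rewrite Hmod. unfold s2. now apply exp_ln. }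
      assert (B1 : Cmod (G (s1, t) - f z0) < eta).
      { apply Hc. rewrite Hmod. unfold s1. rewrite exp_ln; lra. }
      assert (B3 := im_le_Cmod (G (s1, t) - f z0)).
      unfold Im at 1 in B3. simpl in B3. fold (Im (G (s1, t))) in B3. fold (Im (f z0)) in B3.
      apply Rabs_le_between in B3. unfold eta in *. lra. }
  rewrite E, RInt_const in Hle.
  change (scal (2 * PI - 0) eta) with ((2 * PI - 0) * eta) in Hle. nra.
Qed.

Lemma circle_mean_re (f : C -> C) (z0 : C) (rho r A : R) : 0 < r < rho ->
  (forall z, Cmod (z - z0) < rho -> holo_at f z) ->
  (forall z, Cmod (z - z0) = r -> Re (f z) <= A) -> Re (f z0) <= A.
Proof.
  intros Hr Hf HA.
  assert (E : forall z, Im (Ci * f z)%C = Re (f z)) by (intros z; unfold Im, Re; simpl; ring).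
  rewrite <- E. apply (circle_mean_im (fun z => Ci * f z)%C z0 rho r A Hr).
  - intros z Hz. apply holo_mult; [apply holo_const|now apply Hf].
  - intros z Hz. rewrite E. now apply HA.
Qed.

(** * Maximum principle and Schwarz-Pick *)

Lemma Cmod_minus_sym (z w : C) : Cmod (z - w) = Cmod (w - z).
Proof. rewrite <- Cmod_opp. f_equal. ring. Qed.

Lemma Cmod_sub_le (z w : C) : Cmod z - Cmod w <= Cmod (z - w).
Proof.
  pose proof (Cmod_triangle (z - w) w) as H. replace (z - w + w)%C with z in H by ring. lra.
Qed.

Lemma Cmod_self (z : C) : Cmod (z - z) = 0.
Proof. replace (z - z)%C with (0 : C) by ring. apply Cmod_0. Qed.

Definition openC (G : C -> Prop) : Prop :=
  forall z, G z -> exists r, 0 < r /\ forall w, Cmod (w - z) < r -> G w.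

(** Without a maximum every point of the plane has a neighbourhood on which the function stays below
    its value at some point of [G]: near a point outside [G] this is [z1]. Bisection of the square
    around the disc yields one [w] in [G] that dominates all of [G], itself included. *)
Lemma max_exists (G : C -> Prop) (f : C -> C) (eta : R) (z1 : C) : 0 < eta ->
  (forall z, G z -> Cmod z < 1) -> openC G -> (forall z, G z -> holo_at f z) -> G z1 ->
  (forall xi, ~ G xi -> exists d, 0 < d /\ forall z, G z -> Cmod (z - xi) < d ->
     Cmod (f z) ^ 2 + eta * Cmod z ^ 2 < Cmod (f z1) ^ 2 + eta * Cmod z1 ^ 2) ->
  exists z0, G z0 /\ forall z, G z ->
    Cmod (f z) ^ 2 + eta * Cmod z ^ 2 <= Cmod (f z0) ^ 2 + eta * Cmod z0 ^ 2.
Proof.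
  intros Heta HD Hop Hf Hz1 Hbd.
  set (Phi := fun z => Cmod (f z) ^ 2 + eta * Cmod z ^ 2).
  apply NNPP. intros Hno.
  assert (Hup : forall z0, G z0 -> exists w, G w /\ Phi z0 < Phi w).
  { intros z0 Hz0. apply NNPP. intros Hn. apply Hno. exists z0. split; [exact Hz0|].
    intros z Hz. apply Rnot_lt_le. intros Hlt. apply Hn. exists z. now split. }
  assert (Hmax : forall w1 w2, G w1 -> G w2 -> exists w, G w /\ Phi w1 <= Phi w /\ Phi w2 <= Phi w).
  { intros w1 w2 H1 H2. destruct (Rle_or_lt (Phi w1) (Phi w2)).
    - exists w2. repeat split; [assumption|lra|lra].
    - exists w1. repeat split; [assumption|lra|lra]. }
  assert (HP : exists w, G w /\ forall z, -1 <= Re z <= -1 + 2 * 1 -> -1 <= Im z <= -1 + 2 * 1 -> G z -> Phi z < Phi w).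
  { apply (bisection_induction 2 2 (fun x y t =>
      exists w, G w /\ forall z, x <= Re z <= x + 2 * t -> y <= Im z <= y + 2 * t -> G z -> Phi z < Phi w));
      [lra|lra| | |lra].
    - intros x y t Ht [w1 [G1 H1]] [w2 [G2 H2]] [w3 [G3 H3]] [w4 [G4 H4]].
      destruct (Hmax w1 w2 G1 G2) as [v1 [V1 [L1 L2]]]. destruct (Hmax w3 w4 G3 G4) as [v2 [V2 [L3 L4]]].
      destruct (Hmax v1 v2 V1 V2) as [w [W [L5 L6]]]. exists w. split; [exact W|].
      intros z Hx Hy Hz.
      destruct (Rle_or_lt (Re z) (x + 2 * (t / 2))); destruct (Rle_or_lt (Im z) (y + 2 * (t / 2))).
      + apply Rlt_le_trans with (Phi w1); [apply H1; [lra|lra|assumption]|lra].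
      + apply Rlt_le_trans with (Phi w3); [apply H3; [lra|lra|assumption]|lra].
      + apply Rlt_le_trans with (Phi w2); [apply H2; [lra|lra|assumption]|lra].
      + apply Rlt_le_trans with (Phi w4); [apply H4; [lra|lra|assumption]|lra].
    - intros x0 y0.
      assert (exists w d, G w /\ 0 < d /\ forall z, G z -> Cmod (z - (x0, y0)) < d -> Phi z < Phi w) as (w & d & Hw & Hd & Hwd).
      { destruct (classic (G (x0, y0))) as [Hin|Hout].
        - destruct (Hup _ Hin) as [w [Hw Hlt]]. exists w. set (zz := (x0, y0) : C) in *.
          set (gap := Phi w - Phi zz). assert (Hgap : 0 < gap) by (unfold gap; lra).
          pose proof (Cmod_ge_0 (f zz)) as F0. pose proof (Cmod_ge_0 zz) as Z0.
          (* If [f] and [z] each move by less than [e <= 1], then [Phi] grows by at most [e * K],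
             here half of [gap]. *)
          set (K := 2 * Cmod (f zz) + 1 + eta * (2 * Cmod zz + 1)).
          assert (HK : 0 < K).
          { unfold K. assert (0 <= eta * (2 * Cmod zz + 1)) by (apply Rmult_le_pos; lra). lra. }
          set (e := Rmin 1 (gap / (2 * K))).
          assert (He : 0 < e) by (apply Rmin_glb_lt; [lra|apply Rdiv_lt_0_compat; lra]).
          destruct (holo_continuous f zz (Hf _ Hin) e He) as [d [Hd Hfd]].
          exists (Rmin d e). split; [exact Hw|]. split; [now apply Rmin_glb_lt|].
          intros z Hz Hzd. pose proof (Rmin_l d e). pose proof (Rmin_r d e).
          pose proof (Rmin_l 1 (gap / (2 * K))) as M1. pose proof (Rmin_r 1 (gap / (2 * K))) as M2. fold e in M1, M2.
          assert (A1 := Hfd z ltac:(lra)). pose proof (Cmod_sub_le (f z) (f zz)) as A2. pose proof (Cmod_sub_le z zz) as A3.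
          pose proof (Cmod_ge_0 (f z)) as F1. pose proof (Cmod_ge_0 z) as Z1.
          assert (eK : e * K <= gap / 2).
          { apply Rle_trans with (gap / (2 * K) * K); [apply Rmult_le_compat_r; lra|right; field; lra]. }
          assert (S1 : Cmod (f z) ^ 2 <= (Cmod (f zz) + e) ^ 2) by (apply pow_incr; lra).
          assert (S2 : eta * Cmod z ^ 2 <= eta * (Cmod zz + e) ^ 2) by (apply Rmult_le_compat_l; [lra|apply pow_incr; lra]).
          assert (S3 : e * e <= e) by nra.
          assert (S4 : eta * (e * e) <= eta * e) by (apply Rmult_le_compat_l; lra).
          unfold gap, Phi, K in *. nra.
        - destruct (Hbd _ Hout) as [d [Hd Hz]]. exists z1, d. repeat split; assumption. }
      exists (d / 4). split; [lra|]. intros x y t Ht Hx Hy. exists w. split; [exact Hw|].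
      intros z Hzx Hzy Hz. apply Hwd; [exact Hz|].
      eapply Rle_lt_trans; [apply Cmod_le_abs|]. unfold Re, Im in *. simpl.
      assert (Rabs (fst z + - x0) <= 2 * t) by (apply Rabs_le; lra).
      assert (Rabs (snd z + - y0) <= 2 * t) by (apply Rabs_le; lra). lra. }
  destruct HP as [w [Hw HPw]].
  assert (Hwd := HD w Hw). pose proof (re_le_Cmod w) as R1. pose proof (im_le_Cmod w) as R2.
  apply Rabs_le_between in R1. apply Rabs_le_between in R2.
  specialize (HPw w ltac:(lra) ltac:(lra) Hw). lra.
Qed.

(** The term [eta * |z|^2] makes the function strictly subharmonic, so an interior maximum
    contradicts the mean inequality on one small circle. This spares any propagation of equality
    through [G], which may be disconnected. *)
Lemma max_modulus (G : C -> Prop) (f : C -> C) (M : R) : 0 <= M ->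
  (forall z, G z -> Cmod z < 1) -> openC G -> (forall z, G z -> holo_at f z) ->
  (forall xi, ~ G xi -> forall eps, 0 < eps -> exists d, 0 < d /\
     forall z, G z -> Cmod (z - xi) < d -> Cmod (f z) <= M + eps) ->
  forall z, G z -> Cmod (f z) <= M.
Proof.
  intros HM HD Hop Hf Hbd z1 Hz1. apply Rnot_lt_le. intros Hlt.
  set (v := Cmod (f z1)) in *. set (eps := (v - M) / 2).
  set (eta := (v ^ 2 - (M + eps) ^ 2) / 2).
  assert (Heps : 0 < eps) by (unfold eps; lra).
  assert (Hm : M + eps < v) by (unfold eps; lra).
  assert (Heta : 0 < eta) by (unfold eta; nra).
  destruct (max_exists G f eta z1 Heta HD Hop Hf Hz1) as [z0 [Hz0 Hmx]].
  { intros xi Hxi. destruct (Hbd xi Hxi eps Heps) as [d [Hd Hz]]. exists d. split; [exact Hd|].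
    intros z Gz Hzd. specialize (Hz z Gz Hzd). fold v.
    pose proof (HD z Gz). pose proof (Cmod_ge_0 z). pose proof (Cmod_ge_0 (f z)). pose proof (pow2_ge_0 (Cmod z1)).
    assert (Cmod (f z) ^ 2 <= (M + eps) ^ 2) by (apply pow_incr; lra).
    assert (Cmod z ^ 2 <= 1) by nra.
    assert (eta * Cmod z ^ 2 <= eta * 1) by (apply Rmult_le_compat_l; lra).
    assert (0 <= eta * Cmod z1 ^ 2) by (apply Rmult_le_pos; lra).
    unfold eta in *. lra. }
  destruct (Hop z0 Hz0) as [rho [Hrho Hball]].
  set (r := rho / 2).
  (* Linearisation at the maximum: [|f z|^2 >= 2 Re (Cconj (f z0) * f z) - |f z0|^2], and [|z|^2]
     exceeds its linear part by exactly [r^2] on the circle. So [Re h] loses [eta * r ^ 2] there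
     against its value at the centre. *)
  set (h := fun z => (2 * Cconj (f z0) * f z + 2 * eta * Cconj z0 * (z - z0))%C).
  assert (Hh : Re (h z0) <= 2 * Cmod (f z0) ^ 2 - eta * r ^ 2).
  { apply (circle_mean_re h z0 rho r).
    - unfold r; lra.
    - intros z Hz. unfold h. apply holo_plus; apply holo_mult; try apply holo_const.
      + now apply Hf, Hball.
      + apply holo_minus; [apply holo_id|apply holo_const].
    - intros z Hz. assert (Gz : G z) by (apply Hball; rewrite Hz; unfold r; lra).
      specialize (Hmx z Gz).
      assert (E1 : Cmod z ^ 2 = Cmod z0 ^ 2 + 2 * Re (Cconj z0 * (z - z0))%C + r ^ 2).
      { rewrite <- Hz, !Cmod2_alt. unfold Re, Im; simpl. ring. }
      assert (E2 : 2 * Re (Cconj (f z0) * f z)%C - Cmod (f z0) ^ 2 <= Cmod (f z) ^ 2).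
      { rewrite !Cmod2_alt. unfold Re, Im; simpl.
        pose proof (pow2_ge_0 (fst (f z) - fst (f z0))). pose proof (pow2_ge_0 (snd (f z) - snd (f z0))). nra. }
      replace (Re (h z)) with (2 * Re (Cconj (f z0) * f z)%C + eta * (2 * Re (Cconj z0 * (z - z0))%C)).
      2:{ unfold h, Re; simpl. ring. }
      nra. }
  assert (E0 : Re (h z0) = 2 * Cmod (f z0) ^ 2).
  { rewrite Cmod2_alt. unfold h, Re, Im; simpl. ring. }
  assert (0 < eta * r ^ 2) by (apply Rmult_lt_0_compat; [lra|apply pow_lt; unfold r; lra]).
  lra.
Qed.

Lemma le_1_of_pow_bound (x B : R) : 0 <= x -> (forall n, x ^ n <= B) -> x <= 1.
Proof.
  intros Hx Hn. apply Rnot_lt_le. intros Hlt.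
  destruct (Pow_x_infinity x) with (b := B + 1) as [N HN].
  - rewrite Rabs_pos_eq; lra.
  - specialize (HN N (Nat.le_refl N)). rewrite Rabs_pos_eq in HN by now apply pow_le.
    specialize (Hn N). lra.
Qed.

(* A singularity at [p] near which [f] is bounded does not matter: apply the maximum principle
   to [f ^ n * (z - p)], which vanishes at [p], and let [n] tend to infinity. *)
Lemma max_modulus_puncture (G : C -> Prop) (f : C -> C) (p : C) :
  (forall z, G z -> Cmod z < 1) -> openC G -> (forall z, G z -> holo_at f z) ->
  ~ G p -> Cmod p < 1 ->
  (exists B d, 0 < d /\ forall z, G z -> Cmod (z - p) < d -> Cmod (f z) <= B) ->
  (forall xi, ~ G xi -> xi <> p -> forall eps, 0 < eps -> exists d, 0 < d /\
     forall z, G z -> Cmod (z - xi) < d -> Cmod (f z) <= 1 + eps) ->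
  forall z, G z -> Cmod (f z) <= 1.
Proof.
  intros HD Hop Hf Hp Hp1 [B [d0 [Hd0 HB]]] Hbd z Hz.
  assert (Hpos : 0 < Cmod (z - p)).
  { apply Cmod_gt_0. intros E. apply Hp. replace p with z; [exact Hz|].
    replace z with (z - p + p)%C by ring. rewrite E. ring. }
  assert (Hn : forall n, Cmod (f z ^ n * (z - p))%C <= 2).
  { intros n. apply (max_modulus G (fun w => f w ^ n * (w - p))%C 2); try assumption; [lra| |].
    - intros w Hw. apply holo_mult; [apply holo_pow; now apply Hf|].
      apply holo_minus; [apply holo_id|apply holo_const].
    - intros xi Hxi eps He. destruct (classic (xi = p)) as [->|Hne].
      + set (B1 := Rabs B + 1). assert (HB1 : 0 < B1 ^ n) by (apply pow_lt; unfold B1; pose proof (Rabs_pos B); lra).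
        exists (Rmin d0 (2 / B1 ^ n)). split; [apply Rmin_glb_lt; [lra|apply Rdiv_lt_0_compat; lra]|].
        intros w Hw Hwd. pose proof (Rmin_l d0 (2 / B1 ^ n)). pose proof (Rmin_r d0 (2 / B1 ^ n)).
        assert (H1 := HB w Hw ltac:(lra)). rewrite Cmod_mult, Cmod_pow.
        assert (Cmod (f w) ^ n <= B1 ^ n).
        { apply pow_incr. split; [apply Cmod_ge_0|]. unfold B1. pose proof (Rle_abs B). lra. }
        apply Rle_trans with (B1 ^ n * (2 / B1 ^ n)); [|assert (B1 ^ n * (2 / B1 ^ n) = 2) by (field; lra); lra].
        apply Rmult_le_compat; [apply pow_le, Cmod_ge_0|apply Cmod_ge_0|assumption|lra].
      (* An [n]-th root of [1 + eps / 2]; the factor [|w - p| <= 2] then turns this into the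
         required [2 + eps]. *)
      + assert (exists e, 0 < e /\ (1 + e) ^ n <= 1 + eps / 2) as [e [He0 Hen]].
        { destruct (Nat.eq_dec n 0) as [->|Hn0].
          - exists 1. simpl. lra.
          - set (g := Rpower (1 + eps / 2) (/ INR n)).
            assert (Hn0' : 0 < INR n) by (apply lt_0_INR; lia).
            exists (g - 1). split.
            + unfold g. rewrite <- (Rpower_O (1 + eps / 2)) at 2 by lra.
              assert (Rpower (1 + eps / 2) 0 < Rpower (1 + eps / 2) (/ INR n)); [|lra].
              apply Rpower_lt; [lra|now apply Rinv_0_lt_compat].
            + replace (1 + (g - 1)) with g by ring. unfold g.
              rewrite <- Rpower_pow by (apply exp_pos). rewrite Rpower_mult.
              replace (/ INR n * INR n) with 1 by (field; lra). rewrite Rpower_1; lra. }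
        destruct (Hbd xi Hxi Hne e He0) as [d [Hd Hw]]. exists d. split; [exact Hd|].
        intros w Gw Hwd. specialize (Hw w Gw Hwd). rewrite Cmod_mult, Cmod_pow.
        assert (Cmod (f w) ^ n <= (1 + e) ^ n) by (apply pow_incr; split; [apply Cmod_ge_0|assumption]).
        assert (Cmod (w - p) <= 2).
        { pose proof (Cmod_triangle w (- p)) as HT. rewrite Cmod_opp in HT.
          specialize (HD w Gw). unfold Cminus. lra. }
        pose proof (Cmod_ge_0 (w - p)). pose proof (pow_le (Cmod (f w)) n (Cmod_ge_0 _)). nra. }
  apply (le_1_of_pow_bound _ (2 / Cmod (z - p))); [apply Cmod_ge_0|].
  intros n. specialize (Hn n). rewrite Cmod_mult, Cmod_pow in Hn.
  apply Rmult_le_reg_r with (Cmod (z - p)); [exact Hpos|].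
  replace (2 / Cmod (z - p) * Cmod (z - p)) with 2 by (field; lra). exact Hn.
Qed.

Lemma pick_identity (v w : C) :
  Cmod (1 - Cconj v * w) ^ 2 - Cmod (w - v) ^ 2 = (1 - Cmod v ^ 2) * (1 - Cmod w ^ 2).
Proof. rewrite !Cmod2_alt. unfold Re, Im; simpl. ring. Qed.

Lemma Cmod_1_conj_ge (v w : C) : Cmod v <= 1 -> Cmod w <= 1 -> Cmod (w - v) <= Cmod (1 - Cconj v * w).
Proof.
  intros Hv Hw. pose proof (pick_identity v w). pose proof (Cmod_ge_0 v). pose proof (Cmod_ge_0 w).
  apply Rsqr_incr_0_var; [|apply Cmod_ge_0]. rewrite !Rsqr_pow2.
  assert (0 <= (1 - Cmod v ^ 2) * (1 - Cmod w ^ 2)) by (apply Rmult_le_pos; nra). lra.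
Qed.

Lemma Cmod_1_conj_lower (v w : C) : Cmod w <= 1 -> 1 - Cmod v <= Cmod (1 - Cconj v * w).
Proof.
  intros Hw. pose proof (Cmod_sub_le 1 (Cconj v * w)) as H. rewrite Cmod_1, Cmod_mult, Cmod_conj in H.
  pose proof (Cmod_ge_0 v). nra.
Qed.

(** The disc is rescaled by [phi], and the maximum principle is applied to the Moebius image of [f]
    divided by [zeta]. Differentiability at [p] bounds this quotient near the puncture 0;
    [Cmod (f p) < 1] keeps the Moebius denominator away from 0. *)
Lemma schwarz_pick_strict (f : C -> C) (p : C) (R0 : R) : 0 < R0 ->
  (forall z, Cmod (z - p) < R0 -> holo_at f z) ->
  (forall z, Cmod (z - p) < R0 -> Cmod (f z) <= 1) -> Cmod (f p) < 1 ->
  forall z, Cmod (z - p) < R0 -> R0 * Cmod (f z - f p) <= Cmod (z - p) * Cmod (1 - Cconj (f p) * f z).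
Proof.
  intros HR Hf H1 Hp z Hz.
  set (phi := fun zeta : C => (p + R0 * zeta)%C).
  assert (Hphi : forall zeta, Cmod zeta < 1 -> Cmod (phi zeta - p) < R0).
  { intros zeta H. unfold phi. replace (p + R0 * zeta - p)%C with (R0 * zeta)%C by ring.
    rewrite Cmod_mult, Cmod_R, Rabs_pos_eq by lra. nra. }
  assert (Hphid : forall zeta, holo_at phi zeta).
  { intros zeta. apply holo_plus; [apply holo_const|]. apply holo_mult; [apply holo_const|apply holo_id]. }
  assert (Hden : forall zeta, Cmod zeta < 1 -> 1 - Cmod (f p) <= Cmod (1 - Cconj (f p) * f (phi zeta))).
  { intros zeta H. apply Cmod_1_conj_lower. now apply H1, Hphi. }
  set (g := fun zeta => ((f (phi zeta) - f p) / ((1 - Cconj (f p) * f (phi zeta)) * zeta))%C).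
  destruct (Req_dec (Cmod (z - p)) 0) as [E0|Hne].
  { apply Cmod_eq_0 in E0. replace z with (z - p + p)%C by ring. rewrite E0.
    replace (0 + p)%C with p by ring. rewrite !Cmod_self. lra. }
  set (zeta := ((z - p) / R0)%C).
  assert (HR0 : RtoC R0 <> 0) by (intros E; apply (RtoC_inj R0 0) in E; lra).
  assert (Ezeta : Cmod zeta = Cmod (z - p) / R0).
  { unfold zeta. rewrite Cmod_div by exact HR0. rewrite Cmod_R, Rabs_pos_eq; lra. }
  assert (Hz0 : 0 < Cmod (z - p)) by (pose proof (Cmod_ge_0 (z - p)); lra).
  assert (Hzeta : Cmod zeta < 1).
  { rewrite Ezeta. apply Rmult_lt_reg_r with R0; [lra|]. unfold Rdiv. rewrite Rmult_assoc, Rinv_l; lra. }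
  assert (Hzeta0 : 0 < Cmod zeta) by (rewrite Ezeta; apply Rdiv_lt_0_compat; lra).
  assert (Hg : Cmod (g zeta) <= 1).
  { apply (max_modulus_puncture (fun w => Cmod w < 1 /\ w <> 0) g 0).
    - now intros w [Hw _].
    - intros w [Hw Hw0]. apply Cmod_gt_0 in Hw0. exists (Rmin (1 - Cmod w) (Cmod w)).
      split; [apply Rmin_glb_lt; lra|]. intros u Hu.
      pose proof (Rmin_l (1 - Cmod w) (Cmod w)). pose proof (Rmin_r (1 - Cmod w) (Cmod w)).
      pose proof (Cmod_sub_le u w). pose proof (Cmod_sub_le w u) as H3. rewrite Cmod_minus_sym in H3.
      split; [lra|]. apply Cmod_gt_0. lra.
    - intros w [Hw Hw0]. unfold g.
      assert (Hfw : holo_at (fun zeta => f (phi zeta)) w) by (apply holo_comp; [apply Hphid|now apply Hf, Hphi]).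
      apply holo_div.
      + apply Cmult_neq_0; [|exact Hw0]. apply Cmod_gt_0. specialize (Hden w Hw). lra.
      + apply holo_minus; [exact Hfw|apply holo_const].
      + apply holo_mult; [|apply holo_id]. apply holo_minus; [apply holo_const|].
        apply holo_mult; [apply holo_const|exact Hfw].
    - intros [_ H]. now apply H.
    - rewrite Cmod_0. lra.
    - assert (Hp0 : Cmod (p - p) < R0) by (rewrite Cmod_self; lra).
      destruct (Hf p Hp0) as [l Hl]. destruct (Hl 1 Rlt_0_1) as [d [Hd Hld]].
      exists (R0 * (1 + Cmod l) / (1 - Cmod (f p))), (d / R0). split; [apply Rdiv_lt_0_compat; lra|].
      intros w [Hw Hw0] Hwd. replace (w - 0)%C with w in Hwd by ring.
      assert (Ew : Cmod (phi w - p) = R0 * Cmod w).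
      { unfold phi. replace (p + R0 * w - p)%C with (R0 * w)%C by ring.
        rewrite Cmod_mult, Cmod_R, Rabs_pos_eq; lra. }
      assert (Hwd' : Cmod (phi w - p) < d).
      { rewrite Ew. apply Rlt_le_trans with (R0 * (d / R0)); [apply Rmult_lt_compat_l; lra|right; field; lra]. }
      specialize (Hld _ Hwd'). specialize (Hden w Hw). apply Cmod_gt_0 in Hw0.
      unfold g. rewrite Cmod_div, Cmod_mult.
      2:{ apply Cmult_neq_0; apply Cmod_gt_0; lra. }
      assert (Hnum : Cmod (f (phi w) - f p) <= (1 + Cmod l) * (R0 * Cmod w)).
      { replace (f (phi w) - f p)%C with ((f (phi w) - f p - l * (phi w - p)) + l * (phi w - p))%C by ring.
        eapply Rle_trans; [apply Cmod_triangle|]. rewrite Cmod_mult. rewrite Ew in *. lra. }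
      apply Rle_trans with ((1 + Cmod l) * (R0 * Cmod w) / ((1 - Cmod (f p)) * Cmod w)).
      + apply Rmult_le_compat; [apply Cmod_ge_0| |exact Hnum|].
        * left. apply Rinv_0_lt_compat. apply Rmult_lt_0_compat; lra.
        * apply Rinv_le_contravar; [apply Rmult_lt_0_compat; lra|]. apply Rmult_le_compat_r; lra.
      + right. field. lra.
    - intros xi Hxi Hne0 eps He.
      assert (Hxi1 : 1 <= Cmod xi) by (apply Rnot_lt_le; intros H; apply Hxi; now split).
      set (dd := Rmin (1 / 2) (eps / 2) / 2).
      assert (Hm : 0 < Rmin (1 / 2) (eps / 2)) by (apply Rmin_glb_lt; lra).
      pose proof (Rmin_l (1 / 2) (eps / 2)). pose proof (Rmin_r (1 / 2) (eps / 2)).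
      exists dd. split; [unfold dd; lra|]. intros w [Hw Hw0] Hwd.
      assert (Hwl : 1 - dd < Cmod w).
      { pose proof (Cmod_sub_le xi w) as H3. rewrite Cmod_minus_sym in H3. lra. }
      apply Cmod_gt_0 in Hw0. specialize (Hden w Hw).
      unfold g. rewrite Cmod_div, Cmod_mult.
      2:{ apply Cmult_neq_0; apply Cmod_gt_0; lra. }
      assert (Hle := Cmod_1_conj_ge (f p) (f (phi w)) ltac:(lra) (H1 _ (Hphi w Hw))).
      set (D := Cmod (1 - Cconj (f p) * f (phi w))) in *.
      assert (HD0 : 0 < D) by lra.
      apply Rle_trans with (D / (D * Cmod w)).
      + apply Rmult_le_compat_r; [|exact Hle]. left. apply Rinv_0_lt_compat, Rmult_lt_0_compat; lra.
      + replace (D / (D * Cmod w)) with (/ Cmod w) by (field; lra).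
        apply Rmult_le_reg_r with (Cmod w); [lra|]. rewrite Rinv_l by lra. unfold dd in *. nra.
    - split; [exact Hzeta|]. now apply Cmod_gt_0. }
  assert (Ephi : phi zeta = z) by (unfold phi, zeta; field; exact HR0).
  unfold g in Hg. rewrite Ephi in Hg.
  assert (Hd := Hden zeta Hzeta). rewrite Ephi in Hd.
  rewrite Cmod_div, Cmod_mult in Hg by (apply Cmult_neq_0; apply Cmod_gt_0; lra).
  set (D := Cmod (1 - Cconj (f p) * f z)) in *.
  assert (HD0 : 0 < D) by lra.
  apply Rmult_le_compat_r with (r := D * Cmod zeta) in Hg; [|apply Rmult_le_pos; lra].
  replace (Cmod (f z - f p) / (D * Cmod zeta) * (D * Cmod zeta)) with (Cmod (f z - f p)) in Hg by (field; lra).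
  rewrite Ezeta in Hg.
  apply Rmult_le_compat_l with (r := R0) in Hg; [|lra].
  replace (R0 * (1 * (D * (Cmod (z - p) / R0)))) with (Cmod (z - p) * D) in Hg by (field; lra).
  exact Hg.
Qed.

(** When [Cmod (f p) = 1] the Moebius denominator can vanish; the strict case is applied to [t * f]
    with [t < 1] close to 1. The inequality is stated without division so that it survives this
    limit. *)
Lemma schwarz_pick (f : C -> C) (p : C) (R0 : R) : 0 < R0 ->
  (forall z, Cmod (z - p) < R0 -> holo_at f z) ->
  (forall z, Cmod (z - p) < R0 -> Cmod (f z) <= 1) ->
  forall z, Cmod (z - p) < R0 -> R0 * Cmod (f z - f p) <= Cmod (z - p) * Cmod (1 - Cconj (f p) * f z).
Proof.
  intros HR Hf H1 z Hz. apply Rnot_lt_le. intros Hlt.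
  assert (Hp0 : Cmod (p - p) < R0) by (rewrite Cmod_self; lra).
  destruct (Rle_lt_or_eq_dec _ _ (H1 p Hp0)) as [Hs|He].
  { pose proof (schwarz_pick_strict f p R0 HR Hf H1 Hs z Hz). lra. }
  set (x := R0 * Cmod (f z - f p)) in *. set (d := Cmod (z - p)) in *.
  set (y := Cmod (1 - Cconj (f p) * f z)) in *.
  assert (Hd : 0 <= d) by apply Cmod_ge_0.
  (* The strict case for [t = 1 - e] gives [(1 - e) * x <= d * (y + 2 * e)], i.e.
     [x - d * y <= e * (x + 2 * d)], which this [e] contradicts. *)
  set (e := Rmin (1 / 2) ((x - d * y) / (4 * (x + 2 * d + 1)))).
  assert (Hy : 0 <= y) by apply Cmod_ge_0.
  assert (Hx : 0 <= d * y) by (apply Rmult_le_pos; lra).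
  assert (He0 : 0 < e).
  { apply Rmin_glb_lt; [lra|]. apply Rdiv_lt_0_compat; lra. }
  assert (He1 : e <= 1 / 2) by apply Rmin_l.
  assert (He2 : e * (4 * (x + 2 * d + 1)) <= x - d * y).
  { apply Rle_trans with ((x - d * y) / (4 * (x + 2 * d + 1)) * (4 * (x + 2 * d + 1))).
    - apply Rmult_le_compat_r; [lra|apply Rmin_r].
    - right. field. lra. }
  set (t := 1 - e).
  assert (HS := schwarz_pick_strict (fun w => t * f w)%C p R0 HR).
  assert (Ht : Cmod t = t) by (rewrite Cmod_R; apply Rabs_pos_eq; unfold t; lra).
  assert (Q : forall w, Cmod (t * f w)%C = t * Cmod (f w)) by (intros w; rewrite Cmod_mult, Ht; reflexivity).
  assert (HS1 := HS ltac:(intros w Hw; apply holo_mult; [apply holo_const|now apply Hf])).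
  assert (HS2 := HS1 ltac:(intros w Hw; cbv beta; rewrite Q; specialize (H1 w Hw); pose proof (Cmod_ge_0 (f w)); unfold t; nra)).
  assert (HS3 := HS2 ltac:(cbv beta; rewrite Q, He; unfold t; lra) z Hz). clear HS HS1 HS2. simpl in HS3.
  fold d in HS3.
  replace (t * f z - t * f p)%C with (t * (f z - f p))%C in HS3 by ring.
  rewrite Cmod_mult, Ht in HS3.
  assert (Hy2 : Cmod (1 - Cconj (t * f p) * (t * f z)) <= y + 2 * e).
  { replace (1 - Cconj (t * f p) * (t * f z))%C with
      ((1 - Cconj (f p) * f z) + RtoC (1 - t * t) * (Cconj (f p) * f z))%C.
    2:{ rewrite Cmult_conj, RtoC_minus, RtoC_mult.
        replace (Cconj t) with (RtoC t) by (unfold Cconj, RtoC; simpl; f_equal; ring). ring. }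
    eapply Rle_trans; [apply Cmod_triangle|]. apply Rplus_le_compat_l.
    rewrite !Cmod_mult, Cmod_conj, He, Cmod_R, Rabs_pos_eq by (unfold t; nra).
    specialize (H1 z Hz). pose proof (Cmod_ge_0 (f z)). unfold t. nra. }
  assert (HS4 : d * Cmod (1 - Cconj (t * f p) * (t * f z)) <= d * (y + 2 * e)) by (apply Rmult_le_compat_l; lra).
  replace (R0 * (t * Cmod (f z - f p))) with (t * x) in HS3 by (unfold x; ring).
  unfold t in HS3. assert (0 <= e * (x + 2 * d)) by (apply Rmult_le_pos; lra). fold t in HS3.
  assert (t * x <= d * (y + 2 * e)) by lra. unfold t in *. lra.
Qed.

(** * Self-maps of the disc *)

Lemma locally_Cmod (z : C) (P : C -> Prop) :
  locally z P <-> exists d, 0 < d /\ forall w, Cmod (w - z) < d -> P w.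
Proof.
  rewrite locally_C. split.
  - intros [d Hd]. exists d. split; [apply cond_pos|]. intros w Hw. apply Hd. exact Hw.
  - intros [d [Hd Hw]]. exists (mkposreal d Hd). intros w Hwd. apply Hw. exact Hwd.
Qed.

Lemma open_Cmod_lt (a : C) (r : R) : open (fun z : C => Cmod (z - a) < r).
Proof.
  intros z Hz. apply locally_Cmod. exists (r - Cmod (z - a)). split; [lra|].
  intros w Hw. replace (w - a)%C with ((w - z) + (z - a))%C by ring.
  eapply Rle_lt_trans; [apply Cmod_triangle|]. lra.
Qed.

Lemma open_Cmod_gt (a : C) (r : R) : open (fun z : C => r < Cmod (z - a)).
Proof.
  intros z Hz. apply locally_Cmod. exists (Cmod (z - a) - r). split; [lra|].
  intros w Hw. pose proof (Cmod_triangle (z - w) (w - a)) as HT.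
  replace (z - w + (w - a))%C with (z - a)%C in HT by ring. rewrite (Cmod_minus_sym z w) in HT. lra.
Qed.

(** The bound is not strict because unimodular constants satisfy [Hinf_norm1]; they are split off
    through [self_map_const]. *)
Definition self_map (b : C -> C) : Prop :=
  (forall z, Cmod z < 1 -> holo_at b z) /\ (forall z, Cmod z < 1 -> Cmod (b z) <= 1).

Lemma Hinf_self_map (b : C -> C) : Hinf_norm1 b -> self_map b.
Proof.
  intros [Hh Hs]. split.
  - intros z Hz. destruct (Hh z Hz) as [l Hl]. exists l. now apply cder_is_derive.
  - intros z Hz. pose proof (Lub_Rbar_correct (fun r => exists z, in_disc z /\ r = Cmod (b z))) as [H _].
    fold (sup_disc b) in H. rewrite Hs in H. apply (H (Cmod (b z))). exists z. now split.
Qed.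

Lemma not_spec_near_1 (b : C -> C) (xi : C) : Cmod xi = 1 -> ~ spec b xi ->
  forall eps, 0 < eps -> exists d, 0 < d /\ forall z, Cmod z < 1 -> Cmod (z - xi) < d -> 1 - eps < Cmod (b z).
Proof.
  intros Hxi Hns eps He.
  (* Capping [e] at 1/2 keeps [1 - e] nonnegative: [real] sends an infinite infimum to 0, and that
     default must also lie below [1 - e]. *)
  set (e := Rmin eps (1 / 2)). assert (He0 : 0 < e) by (apply Rmin_glb_lt; lra).
  pose proof (Rmin_l eps (1 / 2)) as E1. pose proof (Rmin_r eps (1 / 2)) as E2. fold e in E1, E2.
  assert (Hle : Rbar_le 1 (liminf_disc b xi)).
  { apply Rbar_not_lt_le. intros H. apply Hns. now split. }
  apply NNPP. intros Hn.
  unfold liminf_disc in Hle.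
  match type of Hle with Rbar_le _ (Lub_Rbar ?E) => pose proof (Lub_Rbar_correct E) as [_ Hlub] end.
  assert (Hub : Rbar_le (liminf_disc b xi) (Finite (1 - e))).
  { apply Hlub. intros l [d [Hd ->]].
    set (Y := fun y => exists z, in_disc z /\ 0 < Cmod (z - xi) < d /\ y = Cmod (b z)).
    pose proof (Glb_Rbar_correct Y) as [Hlb _].
    destruct (Glb_Rbar Y) as [g| |] eqn:Eg; simpl; [|lra|lra].
    apply Rnot_lt_le. intros Hlt. apply Hn. exists d. split; [exact Hd|].
    intros z Hz Hzd.
    assert (Hpos : 0 < Cmod (z - xi)).
    { pose proof (Cmod_sub_le xi z) as H. rewrite Cmod_minus_sym in H. lra. }
    assert (Hy : Rbar_le g (Cmod (b z))) by (apply Hlb; exists z; repeat split; assumption).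
    simpl in Hy. lra. }
  apply (Rbar_le_trans _ _ _ Hle) in Hub. simpl in Hub. lra.
Qed.

Lemma closure_near (A : C -> Prop) (x : C) : closure_C A x ->
  forall d, 0 < d -> exists z, A z /\ Cmod (z - x) < d.
Proof.
  intros H d Hd. apply (H (fun z => Cmod (z - x) < d)). apply locally_Cmod. exists d. now split.
Qed.

(** A quantitative strong maximum principle: with [D] the Moebius denominator, [(1 - s^2) * D^2] is
    at most the right side of [pick_identity], and [D >= 1 - |f p|]. It is applied to [b] on the
    disc, to [b] near points of the level set, and to [c / b]. *)
Lemma schwarz_pick_lower (f : C -> C) (p : C) (R0 : R) : 0 < R0 ->
  (forall z, Cmod (z - p) < R0 -> holo_at f z) ->
  (forall z, Cmod (z - p) < R0 -> Cmod (f z) <= 1) ->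
  forall z s, Cmod (z - p) < R0 -> Cmod (z - p) <= s * R0 -> s <= 1 ->
    (1 - s ^ 2) * (1 - Cmod (f p)) ^ 2 <= 1 - Cmod (f z) ^ 2.
Proof.
  intros HR Hf H1 z s Hz Hs Hs1.
  assert (HS := schwarz_pick f p R0 HR Hf H1 z Hz).
  assert (Hp : Cmod (f p) <= 1) by (apply H1; rewrite Cmod_self; lra).
  assert (Hfz := H1 z Hz).
  assert (HL := Cmod_1_conj_lower (f p) (f z) Hfz).
  assert (HI := pick_identity (f p) (f z)).
  pose proof (Cmod_ge_0 (f p)). pose proof (Cmod_ge_0 (f z)). pose proof (Cmod_ge_0 (f z - f p)).
  pose proof (Cmod_ge_0 (z - p)).
  set (D := Cmod (1 - Cconj (f p) * f z)) in *. set (x := Cmod (f z - f p)) in *.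
  assert (0 <= s) by nra. assert (0 <= D) by apply Cmod_ge_0.
  assert (Hx : x <= s * D).
  { apply Rmult_le_reg_l with R0; [lra|]. eapply Rle_trans; [exact HS|].
    replace (R0 * (s * D)) with (s * R0 * D) by ring. apply Rmult_le_compat_r; lra. }
  assert (x ^ 2 <= (s * D) ^ 2) by (apply pow_incr; lra).
  assert ((1 - Cmod (f p)) ^ 2 <= D ^ 2) by (apply pow_incr; lra).
  assert (0 <= 1 - s ^ 2) by nra.
  assert ((1 - s ^ 2) * (1 - Cmod (f p)) ^ 2 <= (1 - s ^ 2) * D ^ 2) by (apply Rmult_le_compat_l; lra).
  assert (0 <= Cmod (f p) ^ 2 <= 1) by (split; [apply pow2_ge_0|nra]).
  assert (0 <= 1 - Cmod (f z) ^ 2) by nra.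
  assert ((1 - Cmod (f p) ^ 2) * (1 - Cmod (f z) ^ 2) <= 1 * (1 - Cmod (f z) ^ 2)) by (apply Rmult_le_compat_r; lra).
  nra.
Qed.

Lemma schwarz_pick_deriv (f : C -> C) (p l : C) (R0 : R) : 0 < R0 ->
  (forall z, Cmod (z - p) < R0 -> holo_at f z) ->
  (forall z, Cmod (z - p) < R0 -> Cmod (f z) <= 1) ->
  cder f p l -> Cmod l * R0 <= 1 - Cmod (f p) ^ 2.
Proof.
  intros HR Hf H1 Hl. apply Rnot_lt_le. intros Hlt.
  set (gap := Cmod l * R0 - (1 - Cmod (f p) ^ 2)) in *.
  assert (Hgap : 0 < gap) by (unfold gap; lra).
  destruct (Hl (gap / (4 * R0))) as [d1 [Hd1 Hw1]]; [apply Rdiv_lt_0_compat; lra|].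
  destruct (cder_small f p l Hl (gap / 4)) as [d2 [Hd2 Hw2]]; [lra|].
  set (t := Rmin (R0 / 2) (Rmin (d1 / 2) (d2 / 2))).
  assert (Ht : 0 < t) by (repeat apply Rmin_glb_lt; lra).
  assert (t < R0 /\ t < d1 /\ t < d2) as [T0 [T1 T2]].
  { pose proof (Rmin_l (R0 / 2) (Rmin (d1 / 2) (d2 / 2))). pose proof (Rmin_r (R0 / 2) (Rmin (d1 / 2) (d2 / 2))).
    pose proof (Rmin_l (d1 / 2) (d2 / 2)). pose proof (Rmin_r (d1 / 2) (d2 / 2)). fold t in H, H0. lra. }
  set (z := (p + t)%C).
  assert (Ez : Cmod (z - p) = t).
  { unfold z. replace (p + t - p)%C with (RtoC t) by ring. rewrite Cmod_R. apply Rabs_pos_eq; lra. }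
  specialize (Hw1 z ltac:(lra)). specialize (Hw2 z ltac:(lra)).
  assert (HS := schwarz_pick f p R0 HR Hf H1 z ltac:(lra)). rewrite Ez in *.
  assert (Hp : Cmod (f p) <= 1) by (apply H1; rewrite Cmod_self; lra).
  assert (HD : Cmod (1 - Cconj (f p) * f z) <= 1 - Cmod (f p) ^ 2 + gap / 4).
  { replace (1 - Cconj (f p) * f z)%C with (RtoC (1 - Cmod (f p) ^ 2) - Cconj (f p) * (f z - f p))%C.
    2:{ rewrite RtoC_minus, Cmod2_conj. ring. }
    unfold Cminus at 1. eapply Rle_trans; [apply Cmod_triangle|]. rewrite Cmod_opp, Cmod_mult, Cmod_conj, Cmod_R.
    pose proof (Cmod_ge_0 (f p)). rewrite Rabs_pos_eq by nra.
    pose proof (Cmod_ge_0 (f z - f p)). nra. }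
  assert (Hl2 : Cmod l * t <= Cmod (f z - f p) + gap / (4 * R0) * t).
  { pose proof (Cmod_triangle (f z - f p) (- (f z - f p - l * (z - p)))) as HT.
    replace (f z - f p + - (f z - f p - l * (z - p)))%C with (l * (z - p))%C in HT by ring.
    rewrite Cmod_opp, Cmod_mult, Ez in HT. lra. }
  apply Rmult_le_compat_l with (r := R0) in Hl2; [|lra].
  replace (R0 * (Cmod (f z - f p) + gap / (4 * R0) * t)) with (R0 * Cmod (f z - f p) + gap / 4 * t) in Hl2 by (field; lra).
  apply Rmult_le_compat_l with (r := t) in HD; [|lra].
  assert (t * (Cmod l * R0 - (1 - Cmod (f p) ^ 2) - gap / 2) <= 0) by lra.
  fold gap in H. nra.
Qed.

(** For [|b 0| = 1] the Moebius denominator has modulus [|b z - b 0|], so Schwarz-Pick reads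
    [|b z - b 0| <= |z| * |b z - b 0|]. *)
Lemma self_map_const (b : C -> C) : self_map b -> Cmod (b 0) = 1 ->
  forall z, Cmod z < 1 -> b z = b 0.
Proof.
  intros [Hh H1] H0 z Hz.
  assert (E0 : forall w : C, (w - 0 = w)%C) by (intros; ring).
  assert (HS := schwarz_pick b 0 1 Rlt_0_1).
  assert (HS1 := HS ltac:(intros w; rewrite E0; apply Hh) ltac:(intros w; rewrite E0; apply H1) z).
  rewrite E0 in HS1. specialize (HS1 Hz).
  assert (E : Cmod (1 - Cconj (b 0) * b z) = Cmod (b z - b 0)).
  { replace (1 - Cconj (b 0) * b z)%C with (- (Cconj (b 0) * (b z - b 0)))%C.
    - rewrite Cmod_opp, Cmod_mult, Cmod_conj, H0. ring.
    - replace (- (Cconj (b 0) * (b z - b 0)))%C with (b 0 * Cconj (b 0) - Cconj (b 0) * b z)%C by ring.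
      rewrite <- Cmod2_conj, H0. simpl. rewrite !Rmult_1_r. reflexivity. }
  rewrite E in HS1. pose proof (Cmod_ge_0 (b z - b 0)).
  assert (H2 : Cmod (b z - b 0) = 0) by nra. apply Cmod_eq_0 in H2.
  replace (b z) with (b z - b 0 + b 0)%C by ring. rewrite H2. ring.
Qed.

(** A Hopf-type bound: [1 - |b|^2] cannot decay faster than the distance to the circle. In (b) it
    lets [Re P] absorb [Im P]; in (a) it bounds the right side of the kernel estimate below. *)
Lemma self_map_lower (b : C -> C) : self_map b ->
  forall z, Cmod z < 1 -> (1 - Cmod (b 0)) ^ 2 * (1 - Cmod z ^ 2) <= 1 - Cmod (b z) ^ 2.
Proof.
  intros [Hh H1] z Hz. assert (E0 : forall w : C, (w - 0 = w)%C) by (intros; ring).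
  rewrite Rmult_comm. apply (schwarz_pick_lower b 0 1 Rlt_0_1).
  - intros w; rewrite E0; apply Hh.
  - intros w; rewrite E0; apply H1.
  - now rewrite E0.
  - rewrite E0. lra.
  - lra.
Qed.

Lemma kernel_sup_le (b : C -> C) (a : C) (k : R) :
  (forall z, Cmod z < 1 -> Cmod ((1 - Cconj (b a) * b z) / (1 - Cconj a * z)) <= k) ->
  Rbar_le (kernel_sup b a) k.
Proof.
  intros H. unfold kernel_sup.
  match goal with |- Rbar_le (Lub_Rbar ?E) _ => pose proof (Lub_Rbar_correct E) as [_ Hl] end.
  apply Hl. intros x [z [Hz ->]]. apply H. exact Hz.
Qed.

Lemma kernel_sup_ge (b : C -> C) (a z : C) (k : R) : Rbar_le (kernel_sup b a) k -> Cmod z < 1 ->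
  Cmod ((1 - Cconj (b a) * b z) / (1 - Cconj a * z)) <= k.
Proof.
  intros H Hz. unfold kernel_sup in H.
  match type of H with Rbar_le (Lub_Rbar ?E) _ => pose proof (Lub_Rbar_correct E) as [Hu _] end.
  assert (Hx := Hu (Cmod ((1 - Cconj (b a) * b z) / (1 - Cconj a * z)))).
  assert (Hy := Hx ltac:(exists z; split; [exact Hz|reflexivity])).
  exact (Rbar_le_trans (Finite _) _ (Finite _) Hy H).
Qed.

(** * Radial monotonicity near the level 1 *)

Lemma Cmod_gt_0' (z : C) : 0 < Cmod z -> z <> 0.
Proof. apply Cmod_gt_0. Qed.

Lemma exp_le_compat (x y : R) : x <= y -> exp x <= exp y.
Proof. intros [H| ->]; [left; now apply exp_increasing|right; reflexivity]. Qed.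

Lemma cayley_re (w : C) : (1 + w)%C <> 0 ->
  Re ((1 - w) / (1 + w))%C = (1 - Cmod w ^ 2) / Cmod (1 + w) ^ 2.
Proof.
  intros Hw. assert (H := proj1 (Cmod_gt_0 _) Hw).
  assert (H2 : 0 < Cmod (1 + w) ^ 2) by now apply pow_lt.
  rewrite Cmod2_alt in *. rewrite Cmod2_alt. destruct w as [x y]. unfold Re, Im in *; simpl in *. field. lra.
Qed.

Lemma cayley_im (w : C) : (1 + w)%C <> 0 ->
  Im ((1 - w) / (1 + w))%C = - 2 * Im w / Cmod (1 + w) ^ 2.
Proof.
  intros Hw. assert (H := proj1 (Cmod_gt_0 _) Hw).
  assert (H2 : 0 < Cmod (1 + w) ^ 2) by now apply pow_lt.
  rewrite Cmod2_alt in *. destruct w as [x y]. unfold Re, Im in *; simpl in *. field. lra.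
Qed.

Lemma cayley_im_abs (w : C) : (1 + w)%C <> 0 -> Rabs (Im ((1 - w) / (1 + w))%C) <= 2 / Cmod (1 + w).
Proof.
  intros Hw. assert (H := proj1 (Cmod_gt_0 _) Hw). rewrite cayley_im by exact Hw.
  set (n := Cmod (1 + w)) in *.
  assert (Hi : Rabs (Im w) <= n).
  { pose proof (im_le_Cmod (1 + w)) as Hi. unfold Im in *; simpl in Hi. rewrite Rplus_0_l in Hi. exact Hi. }
  unfold Rdiv. rewrite !Rabs_mult, Rabs_inv, (Rabs_pos_eq (n ^ 2)) by (apply pow_le; lra).
  replace (Rabs (- 2)) with 2 by (rewrite Rabs_left; lra).
  apply Rle_trans with (2 * n * / n ^ 2).
  - apply Rmult_le_compat_r; [left; apply Rinv_0_lt_compat, pow_lt; lra|]. lra.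
  - right. field. lra.
Qed.

(* The real part of [T * conj q] for [T = (z^2 - 2 g z + 1) P - sg (1 - z^2)] and
   [q = (a - z) (1 - a z)]: on the unit circle both [(z^2 - 2 g z + 1) / q] and
   [i (1 - z^2) / q] are real, so all but the first term are [O(1 - |z|^2)]. *)
Lemma pick_multiplier_re (a g sg x y u v : R) :
  let d := 1 - (x ^ 2 + y ^ 2) in
  let A := 2 * (x - g) in
  let B := 2 * a * x - (1 + a ^ 2) in
  Re (((x, y) * (x, y) - 2 * g * (x, y) + 1) * (u, v) - sg * (1 - (x, y) * (x, y)))%C *
    Re ((a - (x, y)) * (1 - a * (x, y)))%C +
  Im (((x, y) * (x, y) - 2 * g * (x, y) + 1) * (u, v) - sg * (1 - (x, y) * (x, y)))%C *
    Im ((a - (x, y)) * (1 - a * (x, y)))%C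
  = ((x ^ 2 + y ^ 2) * (A * B) + d * (a * A * x + x * B) + a * d ^ 2) * u
    - d * (y * (a * A - B)) * v - sg * (d * (2 * a * y ^ 2 + x * B + a * d)).
Proof. intros d A B. unfold d, A, B, Re, Im; simpl. ring. Qed.

Lemma Re_div (w q : C) : q <> 0 -> Re (w / q)%C = (Re w * Re q + Im w * Im q) / Cmod q ^ 2.
Proof.
  intros Hw. assert (H := proj1 (Cmod_gt_0 _) Hw).
  assert (H2 : 0 < Cmod q ^ 2) by now apply pow_lt.
  rewrite Cmod2_alt in *. destruct w as [x y]. destruct q as [u v]. unfold Re, Im in *; simpl in *. field. lra.
Qed.

(** With [n = |1 + b|], which may tend to 0, [2 / n] bounds [|Im P|] and [k * d / n^2] is a lower
    bound of [Re P]. So [d * |Im P|] costs a small multiple of [Re P] plus a term [O(d)]. *)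
Lemma am_gm_quad (k l n d : R) : 0 < k -> 0 < l -> 0 < n -> 0 <= d ->
  d * (2 / n) <= l * (k * d / n ^ 2) + d / (k * l).
Proof.
  intros Hk Hl Hn Hd.
  assert (E : l * (k * d / n ^ 2) + d / (k * l) - d * (2 / n) = d * (l * k / n - 1) ^ 2 / (k * l)) by (field; lra).
  assert (0 <= d * (l * k / n - 1) ^ 2 / (k * l)).
  { apply Rmult_le_pos; [apply Rmult_le_pos; [lra|apply pow2_ge_0]|]. left. apply Rinv_0_lt_compat. nra. }
  lra.
Qed.

Lemma self_map_lt_1 (b : C -> C) : self_map b -> Cmod (b 0) < 1 ->
  forall z, Cmod z < 1 -> Cmod (b z) < 1.
Proof.
  intros Hb H0 z Hz. pose proof (self_map_lower b Hb z Hz) as H.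
  pose proof (Cmod_ge_0 z). pose proof (Cmod_ge_0 (b z)).
  assert (0 < (1 - Cmod (b 0)) ^ 2 * (1 - Cmod z ^ 2)) by (apply Rmult_lt_0_compat; [apply pow_lt; lra|nra]).
  nra.
Qed.

Section PickMultiplier.
Variables (b : C -> C) (a g sg : R).
Hypothesis Hb : self_map b.
Hypothesis Hb0 : Cmod (b 0) < 1.
Hypothesis Ha : 0 < a < 1.
Hypothesis Hg : -1 <= g <= 1.
Hypothesis Hsg : 0 <= sg.

Let P (z : C) : C := ((1 - b z) / (1 + b z))%C.
Let T (z : C) : C := ((z * z - 2 * g * z + 1) * P z - sg * (1 - z * z))%C.
Let q (z : C) : C := ((a - z) * (1 - a * z))%C.

Lemma one_plus_neq (z : C) : Cmod z < 1 -> (1 + b z)%C <> 0.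
Proof.
  intros Hz. pose proof (self_map_lt_1 b Hb Hb0 z Hz). apply Cmod_gt_0'.
  pose proof (Cmod_sub_le 1 (- b z)) as H1. rewrite Cmod_1, Cmod_opp in H1.
  replace (1 - - b z)%C with (1 + b z)%C in H1 by ring. lra.
Qed.

Lemma q_lower (z : C) : Cmod z < 1 -> Cmod (z - a) * (1 - a) <= Cmod (q z).
Proof.
  intros Hz. unfold q. rewrite Cmod_mult, Cmod_minus_sym. apply Rmult_le_compat_l; [apply Cmod_ge_0|].
  pose proof (Cmod_sub_le 1 (a * z)) as H. rewrite Cmod_1, Cmod_mult, Cmod_R, Rabs_pos_eq in H by lra.
  pose proof (Cmod_ge_0 z). nra.
Qed.

Lemma multiplier_lower (z : C) : Cmod z < 1 -> z <> a ->
  let d := 1 - Cmod z ^ 2 in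
  (2 * (Re z - g) * (2 * a * Re z - (1 + a ^ 2)) - 24 * d) * Re (P z) - 8 * d * Rabs (Im (P z)) - 8 * sg * d
    <= Re (T z / q z)%C * Cmod (q z) ^ 2.
Proof.
  intros Hz Hza d.
  assert (Hza0 : 0 < Cmod (z - a)).
  { apply Cmod_gt_0. intros E. apply Hza. replace z with (z - a + a)%C by ring. rewrite E. ring. }
  assert (Hq : 0 < Cmod (q z)).
  { pose proof (q_lower z Hz). assert (0 < Cmod (z - a) * (1 - a)) by (apply Rmult_lt_0_compat; lra). lra. }
  rewrite Re_div by now apply Cmod_gt_0'.
  match goal with |- _ <= ?X / ?Q * ?Q => replace (X / Q * Q) with X by (field; lra) end.
  assert (HPr : 0 <= Re (P z)).
  { unfold P. rewrite cayley_re by now apply one_plus_neq. apply Rdiv_le_0_compat.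
    - pose proof (proj2 Hb z Hz). pose proof (Cmod_ge_0 (b z)). nra.
    - apply pow_lt. apply Cmod_gt_0. now apply one_plus_neq. }
  unfold T, q. destruct (P z) as [u v]. destruct z as [x y].
  rewrite pick_multiplier_re. unfold d. rewrite Cmod2_alt. unfold Re, Im in *; simpl fst in *; simpl snd in *.
  set (D := 1 - (x ^ 2 + y ^ 2)).
  assert (HD : 0 < D <= 1).
  { pose proof (Cmod2_alt (x, y)) as E. unfold Re, Im in E; simpl fst in E; simpl snd in E.
    pose proof (Cmod_ge_0 (x, y)). unfold D. rewrite <- E. split; [nra|].
    pose proof (pow2_ge_0 (Cmod (x, y))). lra. }
  assert (Hx : -1 <= x <= 1) by (unfold D in HD; split; nra).
  assert (Hy : -1 <= y <= 1) by (unfold D in HD; split; nra).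
  set (A := 2 * (x - g)). set (B := 2 * a * x - (1 + a ^ 2)).
  assert (HA : -4 <= A <= 4) by (unfold A; lra).
  assert (HB : -4 <= B <= 0) by (unfold B; split; nra).
  assert (HAB : -16 <= A * B <= 16) by (split; nra).
  assert (Q1 : -8 <= a * A * x + x * B).
  { assert (-4 <= a * A <= 4) by (split; nra). assert (-4 <= a * A * x) by nra. assert (-4 <= x * B) by nra. lra. }
  assert (Q2 : Rabs (y * (a * A - B)) <= 8).
  { assert (-4 <= a * A <= 4) by (split; nra). rewrite Rabs_mult.
    assert (Rabs y <= 1) by (apply Rabs_le; lra). assert (Rabs (a * A - B) <= 8) by (apply Rabs_le; lra).
    pose proof (Rabs_pos y). pose proof (Rabs_pos (a * A - B)). nra. }
  assert (Q3 : 2 * a * y ^ 2 + x * B + a * D <= 8).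
  { assert (0 <= y ^ 2 <= 1) by (split; nra). assert (a * y ^ 2 <= 1) by nra. assert (x * B <= 4) by nra.
    assert (a * D <= 1) by nra. lra. }
  (* 24 is 16 from replacing [|z|^2 = 1 - D] by 1 in front of [A * B], plus 8 from [Q1]. *)
  assert (M1 : (A * B - 24 * D) * u <= ((x ^ 2 + y ^ 2) * (A * B) + D * (a * A * x + x * B) + a * D ^ 2) * u).
  { apply Rmult_le_compat_r; [exact HPr|]. replace (x ^ 2 + y ^ 2) with (1 - D) by (unfold D; ring).
    assert (0 <= a * D ^ 2) by (apply Rmult_le_pos; [lra|apply pow2_ge_0]). nra. }
  assert (M2 : D * (y * (a * A - B)) * v <= 8 * D * Rabs v).
  { eapply Rle_trans; [apply Rle_abs|]. rewrite !Rabs_mult, (Rabs_pos_eq D) by lra.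
    rewrite Rabs_mult in Q2. pose proof (Rabs_pos v).
    replace (8 * D * Rabs v) with (D * 8 * Rabs v) by ring. apply Rmult_le_compat_r; [lra|].
    apply Rmult_le_compat_l; lra. }
  assert (M3 : sg * (D * (2 * a * y ^ 2 + x * B + a * D)) <= 8 * sg * D).
  { replace (8 * sg * D) with (sg * (D * 8)) by ring. apply Rmult_le_compat_l; [lra|]. apply Rmult_le_compat_l; lra. }
  lra.
Qed.

(** The clause on [1 + b] keeps [P] bounded near the arc, so that [|b|] tending to 1 makes [Re P]
    tend to 0. *)
Hypothesis Hfree : forall xi, Cmod xi = 1 -> g <= Re xi ->
  forall eps, 0 < eps -> exists d, 0 < d /\ forall z, Cmod z < 1 -> Cmod (z - xi) < d ->
    1 - eps < Cmod (b z) /\ 1 <= Cmod (1 + b z).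

(** Off the arc, where [Re xi < g], the coefficient of [Re P] in [multiplier_lower] is bounded below
    by a positive constant and pays for [Im P], however large [P] is. On the arc that coefficient
    may be negative, but it multiplies [Re P], which tends to 0. *)
Lemma multiplier_boundary (xi : C) : 1 <= Cmod xi -> forall eps, 0 < eps -> exists d, 0 < d /\
  forall z, Cmod z < 1 -> z <> a -> Cmod (z - xi) < d -> - eps <= Re (T z / q z)%C.
Proof.
  intros Hxi eps He.
  destruct (Rle_lt_or_eq_dec _ _ Hxi) as [Hgt|Heq].
  { exists (Cmod xi - 1). split; [lra|]. intros z Hz _ Hzd.
    pose proof (Cmod_sub_le xi z) as H. rewrite Cmod_minus_sym in H. lra. }
  symmetry in Heq.
  set (q0 := ((1 - a) / 2 * (1 - a)) ^ 2).
  assert (Hq0 : 0 < q0) by (apply pow_lt; nra).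
  (* Close to the circle [z] is at distance at least [(1 - a) / 2] from [a], so [|q z|^2 >= q0] and
     the division by it is harmless. *)
  assert (Hlow : forall S dd, 0 < dd ->
    (exists d, 0 < d /\ forall z, Cmod z < 1 -> z <> a -> Cmod (z - xi) < d ->
       - (S * dd) <= Re (T z / q z)%C * Cmod (q z) ^ 2) -> 0 <= S -> S * dd <= eps * q0 ->
    exists d, 0 < d /\ forall z, Cmod z < 1 -> z <> a -> Cmod (z - xi) < d -> - eps <= Re (T z / q z)%C).
  { intros S dd Hdd [d [Hd Hz]] HS0 HS. exists (Rmin d ((1 - a) / 2)). split; [apply Rmin_glb_lt; lra|].
    intros z Hz1 Hza Hzd. pose proof (Rmin_l d ((1 - a) / 2)). pose proof (Rmin_r d ((1 - a) / 2)).
    specialize (Hz z Hz1 Hza ltac:(lra)).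
    assert (Hzl : (1 + a) / 2 < Cmod z).
    { pose proof (Cmod_sub_le xi z) as H3. rewrite Cmod_minus_sym in H3. lra. }
    assert (Hzaa : (1 - a) / 2 <= Cmod (z - a)).
    { pose proof (Cmod_sub_le z a) as H3. rewrite Cmod_R, Rabs_pos_eq in H3 by lra. lra. }
    assert (Hq : q0 <= Cmod (q z) ^ 2).
    { apply pow_incr. split; [nra|]. eapply Rle_trans; [|now apply q_lower].
      apply Rmult_le_compat_r; lra. }
    set (X := Re (T z / q z)%C) in *. set (Q := Cmod (q z) ^ 2) in *.
    apply Rnot_lt_le. intros HX. nra. }
  destruct (Rlt_or_le (Re xi) g) as [Hlt|Hge].
  - set (k := (1 - Cmod (b 0)) ^ 2).
    assert (Hk : 0 < k) by (apply pow_lt; lra).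
    set (k0 := (g - Re xi) * (1 - a) ^ 2).
    assert (Hk0 : 0 < k0) by (apply Rmult_lt_0_compat; [lra|apply pow_lt; lra]).
    (* The coefficient of [Re P] is at least [k0]: half of it absorbs [24 * d], the other half
       absorbs [8 * d * |Im P|] through [am_gm_quad] with [l = k0 / 16]. What remains is [S * d]. *)
    set (S := 8 * (/ (k * (k0 / 16))) + 8 * sg).
    assert (HS : 0 < S).
    { unfold S. assert (0 < / (k * (k0 / 16))) by (apply Rinv_0_lt_compat, Rmult_lt_0_compat; lra). lra. }
    set (dd := Rmin (k0 / 48) (eps * q0 / S)).
    assert (Hdd : 0 < dd).
    { apply Rmin_glb_lt; [lra|]. apply Rdiv_lt_0_compat; [apply Rmult_lt_0_compat; lra|lra]. }
    apply (Hlow S dd Hdd); [|lra|].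
    2:{ apply Rle_trans with (S * (eps * q0 / S)); [apply Rmult_le_compat_l; [lra|apply Rmin_r]|right; field; lra]. }
    exists (Rmin (dd / 2) ((g - Re xi) / 2)). split; [apply Rmin_glb_lt; lra|].
    intros z Hz Hza Hzd. pose proof (Rmin_l (dd / 2) ((g - Re xi) / 2)). pose proof (Rmin_r (dd / 2) ((g - Re xi) / 2)).
    eapply Rle_trans; [|now apply multiplier_lower].
    assert (Hd : 0 <= 1 - Cmod z ^ 2 <= dd).
    { pose proof (Cmod_sub_le xi z) as H3. rewrite Cmod_minus_sym in H3. pose proof (Cmod_ge_0 z). nra. }
    set (d := 1 - Cmod z ^ 2) in *.
    assert (Hdk : 24 * d <= k0 / 2) by (pose proof (Rmin_l (k0 / 48) (eps * q0 / S)); fold dd in H1; lra).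
    assert (Hre : Re z <= (Re xi + g) / 2).
    { pose proof (re_le_Cmod (z - xi)) as H3. unfold Re in *; simpl in H3. apply Rabs_le_between in H3. lra. }
    assert (HAB : k0 <= 2 * (Re z - g) * (2 * a * Re z - (1 + a ^ 2))).
    { pose proof (re_le_Cmod z) as H4. apply Rabs_le_between in H4.
      assert (H5 : (1 - a) ^ 2 <= 1 + a ^ 2 - 2 * a * Re z) by nra.
      replace (2 * (Re z - g) * (2 * a * Re z - (1 + a ^ 2))) with ((2 * (g - Re z)) * (1 + a ^ 2 - 2 * a * Re z)) by ring.
      unfold k0. apply Rmult_le_compat; [lra|apply pow2_ge_0|lra|lra]. }
    assert (Hn := proj1 (Cmod_gt_0 _) (one_plus_neq z Hz)).
    set (n := Cmod (1 + b z)) in *.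
    assert (HPr : k * d / n ^ 2 <= Re (P z)).
    { unfold P. rewrite cayley_re by now apply one_plus_neq. fold n.
      apply Rmult_le_compat_r; [left; apply Rinv_0_lt_compat, pow_lt; lra|]. now apply self_map_lower. }
    assert (HPi : Rabs (Im (P z)) <= 2 / n) by (apply cayley_im_abs; now apply one_plus_neq).
    assert (HAG := am_gm_quad k (k0 / 16) n d Hk ltac:(lra) Hn ltac:(lra)).
    assert (H8 : d * Rabs (Im (P z)) <= k0 / 16 * Re (P z) + d / (k * (k0 / 16))).
    { apply Rle_trans with (d * (2 / n)); [apply Rmult_le_compat_l; lra|].
      eapply Rle_trans; [exact HAG|]. apply Rplus_le_compat_r, Rmult_le_compat_l; lra. }
    assert (HPr0 : 0 <= Re (P z)).
    { eapply Rle_trans; [|exact HPr]. apply Rdiv_le_0_compat; [apply Rmult_le_pos; lra|apply pow_lt; lra]. }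
    assert (H9 : k0 / 2 * Re (P z) <= (2 * (Re z - g) * (2 * a * Re z - (1 + a ^ 2)) - 24 * d) * Re (P z)).
    { apply Rmult_le_compat_r; lra. }
    assert (H10 : S * d <= S * dd) by (apply Rmult_le_compat_l; lra).
    assert (H11 : S * d = 8 * (d / (k * (k0 / 16))) + 8 * sg * d) by (unfold S; field; lra).
    lra.
  - set (S := 98 + 8 * sg).
    set (dd := Rmin 1 (eps * q0 / S)).
    assert (Hdd : 0 < dd).
    { apply Rmin_glb_lt; [lra|]. apply Rdiv_lt_0_compat; [apply Rmult_lt_0_compat; lra|unfold S; lra]. }
    assert (HS : 0 < S) by (unfold S; lra).
    apply (Hlow S dd Hdd); [|lra|].
    2:{ apply Rle_trans with (S * (eps * q0 / S)); [apply Rmult_le_compat_l; [lra|apply Rmin_r]|right; field; lra]. }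
    destruct (Hfree xi Heq Hge (dd / 2) ltac:(lra)) as [d1 [Hd1 H1]].
    exists (Rmin d1 (dd / 2)). split; [apply Rmin_glb_lt; lra|].
    intros z Hz Hza Hzd. pose proof (Rmin_l d1 (dd / 2)). pose proof (Rmin_r d1 (dd / 2)).
    eapply Rle_trans; [|now apply multiplier_lower].
    destruct (H1 z Hz ltac:(lra)) as [Hb1 Hn].
    assert (Hd : 0 <= 1 - Cmod z ^ 2 <= dd).
    { pose proof (Cmod_sub_le xi z) as H3. rewrite Cmod_minus_sym in H3. pose proof (Cmod_ge_0 z). nra. }
    set (d := 1 - Cmod z ^ 2) in *.
    assert (Hdd1 : dd <= 1) by apply Rmin_l.
    set (n := Cmod (1 + b z)) in *.
    assert (Hbz := self_map_lt_1 b Hb Hb0 z Hz). pose proof (Cmod_ge_0 (b z)).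
    assert (Hin : / n ^ 2 <= 1).
    { rewrite <- Rinv_1. apply Rinv_le_contravar; [lra|]. nra. }
    assert (Hin0 : 0 < / n ^ 2) by (apply Rinv_0_lt_compat, pow_lt; lra).
    assert (HPr : 0 <= Re (P z) <= dd).
    { unfold P. rewrite cayley_re by now apply one_plus_neq. fold n.
      assert (0 <= 1 - Cmod (b z) ^ 2 <= dd) by nra. unfold Rdiv. split; [apply Rmult_le_pos; lra|].
      nra. }
    assert (HPi : Rabs (Im (P z)) <= 2).
    { eapply Rle_trans; [apply cayley_im_abs; now apply one_plus_neq|]. fold n.
      apply Rmult_le_reg_r with n; [lra|]. unfold Rdiv. rewrite Rmult_assoc, Rinv_l; lra. }
    pose proof (Rabs_pos (Im (P z))).
    assert (HAB : -16 <= 2 * (Re z - g) * (2 * a * Re z - (1 + a ^ 2))).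
    { pose proof (re_le_Cmod z) as H4. apply Rabs_le_between in H4.
      set (x := Re z) in *. assert (-4 <= 2 * (x - g) <= 4) by lra.
      assert (-4 <= 2 * a * x - (1 + a ^ 2) <= 0) by (split; nra). nra. }
    assert (K1 : -40 * dd <= (2 * (Re z - g) * (2 * a * Re z - (1 + a ^ 2)) - 24 * d) * Re (P z)).
    { set (Y := 2 * (Re z - g) * (2 * a * Re z - (1 + a ^ 2)) - 24 * d) in *.
      assert (-40 <= Y) by (unfold Y; lra). nra. }
    assert (K2 : d * Rabs (Im (P z)) <= 2 * dd) by nra.
    assert (K3 : sg * d <= sg * dd) by (apply Rmult_le_compat_l; lra).
    unfold S. lra.
Qed.

Hypothesis HTa : T a = 0.

(** The maximum principle is applied to [exp (- T / q)]. It is bounded near the puncture [a] because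
    [T a = 0] and [q] has only a simple zero there. *)
Lemma multiplier_nonneg (z : C) : Cmod z < 1 -> z <> a -> 0 <= Re (T z / q z)%C.
Proof.
  intros Hz Hza.
  assert (HP : forall z, Cmod z < 1 -> holo_at P z).
  { intros w Hw. unfold P. apply holo_div; [now apply one_plus_neq| |].
    - apply holo_minus; [apply holo_const|now apply (proj1 Hb)].
    - apply holo_plus; [apply holo_const|now apply (proj1 Hb)]. }
  assert (HT : forall z, Cmod z < 1 -> holo_at T z).
  { intros w Hw. unfold T.
    assert (Hsq : holo_at (fun z => z * z)%C w) by (apply holo_mult; apply holo_id).
    apply holo_minus; apply holo_mult.
    - apply holo_plus; [|apply holo_const]. apply holo_minus; [exact Hsq|].
      apply holo_mult; [apply holo_const|apply holo_id].
    - now apply HP.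
    - apply holo_const.
    - apply holo_minus; [apply holo_const|exact Hsq]. }
  assert (Hq : forall z, holo_at q z).
  { intros w. unfold q. apply holo_mult; apply holo_minus; try apply holo_const; try apply holo_id.
    apply holo_mult; [apply holo_const|apply holo_id]. }
  assert (Hq0 : forall z, Cmod z < 1 -> z <> a -> q z <> 0).
  { intros w Hw Hwa. apply Cmod_gt_0'. pose proof (q_lower w Hw).
    assert (0 < Cmod (w - a)).
    { apply Cmod_gt_0. intros E. apply Hwa. replace w with (w - a + a)%C by ring. rewrite E. ring. }
    assert (0 < Cmod (w - a) * (1 - a)) by (apply Rmult_lt_0_compat; lra). lra. }
  assert (Ha1 : Cmod a < 1) by (rewrite Cmod_R, Rabs_pos_eq; lra).
  assert (HM : Cmod (cexp (- (T z / q z))%C) <= 1).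
  { apply (max_modulus_puncture (fun w => Cmod w < 1 /\ w <> a) (fun w => cexp (- (T w / q w))%C) a).
    - now intros w [Hw _].
    - intros w [Hw Hwa].
      assert (Hwa0 : 0 < Cmod (w - a)).
      { apply Cmod_gt_0. intros E. apply Hwa. replace w with (w - a + a)%C by ring. rewrite E. ring. }
      exists (Rmin (1 - Cmod w) (Cmod (w - a))). split; [apply Rmin_glb_lt; lra|].
      intros u Hu. pose proof (Rmin_l (1 - Cmod w) (Cmod (w - a))). pose proof (Rmin_r (1 - Cmod w) (Cmod (w - a))).
      split; [pose proof (Cmod_sub_le u w); lra|]. intros ->. rewrite Cmod_minus_sym in Hu. lra.
    - intros w [Hw Hwa]. apply (holo_cexp (fun w => - (T w / q w))%C), holo_opp, holo_div; auto.
    - intros [_ H]. now apply H.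
    - exact Ha1.
    - destruct (HT a Ha1) as [l Hl]. destruct (Hl 1 Rlt_0_1) as [d [Hd Hw]].
      exists (exp ((1 + Cmod l) / (1 - a))), d. split; [exact Hd|]. intros w [Hw1 Hwa] Hwd.
      rewrite Cmod_cexp. apply exp_le_compat.
      assert (Hwa0 : 0 < Cmod (w - a)).
      { apply Cmod_gt_0. intros E. apply Hwa. replace w with (w - a + a)%C by ring. rewrite E. ring. }
      eapply Rle_trans; [apply Rle_abs|]. eapply Rle_trans; [apply re_le_Cmod|].
      rewrite Cmod_opp, Cmod_div by auto.
      specialize (Hw w Hwd). rewrite HTa in Hw.
      assert (HTw : Cmod (T w) <= (1 + Cmod l) * Cmod (w - a)).
      { replace (T w) with (T w - 0 - l * (w - a) + l * (w - a))%C by ring.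
        eapply Rle_trans; [apply Cmod_triangle|]. rewrite Cmod_mult. lra. }
      pose proof (q_lower w Hw1) as Hql. pose proof (Cmod_ge_0 l).
      apply Rle_trans with ((1 + Cmod l) * Cmod (w - a) / (Cmod (w - a) * (1 - a))).
      + apply Rmult_le_compat; [apply Cmod_ge_0| |exact HTw|].
        * left. apply Rinv_0_lt_compat. apply Cmod_gt_0. auto.
        * apply Rinv_le_contravar; [apply Rmult_lt_0_compat; lra|exact Hql].
      + right. field. lra.
    - intros xi Hxi Hxia eps He.
      assert (Hx1 : 1 <= Cmod xi) by (apply Rnot_lt_le; intros H; apply Hxi; now split).
      assert (Hl : 0 < ln (1 + eps)) by (rewrite <- ln_1; apply ln_increasing; lra).
      destruct (multiplier_boundary xi Hx1 (ln (1 + eps)) Hl) as [d [Hd Hw]].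
      exists d. split; [exact Hd|]. intros w [Hw1 Hwa] Hwd. specialize (Hw w Hw1 Hwa Hwd).
      rewrite Cmod_cexp. rewrite <- (exp_ln (1 + eps)) by lra. apply exp_le_compat.
      change (- Re (T w / q w)%C <= ln (1 + eps)). lra.
    - now split. }
  rewrite Cmod_cexp in HM. change (Re (- (T z / q z))%C) with (- Re (T z / q z)%C) in HM.
  apply Rnot_lt_le. intros Hn. assert (exp 0 < exp (- Re (T z / q z)%C)) by (apply exp_increasing; lra).
  rewrite exp_0 in H. lra.
Qed.

End PickMultiplier.

(** Just to the right of [a] the denominator [q] is negative, so [multiplier_nonneg] forces the
    derivative [tau] of [T] at [a] to have real part at most 0. In [Re tau] the derivative [l]
    enters with a negative factor and the remaining terms are positive, hence [Re l > 0]. *)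
Lemma radial_increase (b : C -> C) (a beta : R) (l : C) :
  self_map b -> Cmod (b 0) < 1 -> 0 < a < 1 -> 0 <= beta < 1 -> b a = beta -> cder b a l ->
  (forall xi, Cmod xi = 1 -> Cmod (xi - 1) <= 2 * (1 - a) ->
    forall eps, 0 < eps -> exists d, 0 < d /\ forall z, Cmod z < 1 -> Cmod (z - xi) < d ->
      1 - eps < Cmod (b z) /\ 1 <= Cmod (1 + b z)) ->
  0 < Re l.
Proof.
  intros Hb Hb0 Ha Hbeta Hba Hl Hfree.
  (* The factor 3/2 meets two demands: it is below 2, since [Re xi >= g] must imply
     [|xi - 1| <= 2 * (1 - a)], and above [1 / (1 + a^2)], which makes [2 * a - g * (1 + a^2)]
     positive. *)
  set (g := 1 - 3 / 2 * (1 - a) ^ 2).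
  set (f0 := (1 - beta) / (1 + beta)).
  assert (Hf0 : 0 < f0) by (apply Rdiv_lt_0_compat; lra).
  set (N0 := a ^ 2 - 2 * g * a + 1).
  assert (HN0 : 0 < N0).
  { replace N0 with ((1 - a) ^ 2 * (1 + 3 * a)) by (unfold N0, g; field). apply Rmult_lt_0_compat; [apply pow_lt|]; lra. }
  set (sg := N0 * f0 / (1 - a ^ 2)).
  assert (Ha2 : 0 < 1 - a ^ 2) by nra.
  assert (Hsg : 0 < sg) by (apply Rdiv_lt_0_compat; [apply Rmult_lt_0_compat; lra|lra]).
  set (P := fun z => ((1 - b z) / (1 + b z))%C).
  set (T := fun z => ((z * z - 2 * g * z + 1) * P z - sg * (1 - z * z))%C).
  set (q := fun z : C => ((a - z) * (1 - a * z))%C).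
  assert (Ha1 : Cmod a < 1) by (rewrite Cmod_R, Rabs_pos_eq; lra).
  assert (Hbeta1 : (1 + beta)%C <> 0).
  { intros E. rewrite <- RtoC_plus in E. apply (RtoC_inj (1 + beta) 0) in E. lra. }
  assert (HPa : P a = f0).
  { unfold P, f0. rewrite Hba, RtoC_div, RtoC_minus, RtoC_plus by lra. reflexivity. }
  assert (HTa : T a = 0).
  { unfold T. rewrite HPa. unfold sg.
    replace (RtoC (N0 * f0 / (1 - a ^ 2)) * (1 - a * a))%C with (RtoC (N0 * f0)).
    - unfold N0. rewrite <- !RtoC_mult, <- RtoC_minus, <- RtoC_plus, <- RtoC_mult, <- RtoC_minus. f_equal. ring.
    - rewrite <- !RtoC_mult, <- RtoC_minus, <- RtoC_mult. f_equal. field. lra. }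
  assert (Hnn : forall z, Cmod z < 1 -> z <> a -> 0 <= Re (T z / q z)%C).
  { apply (multiplier_nonneg b a g sg Hb Hb0 Ha); [unfold g; nra|lra| |exact HTa].
    intros xi Hxi Hre. apply Hfree; [exact Hxi|].
    apply Rsqr_incr_0_var; [|lra]. rewrite !Rsqr_pow2, Cmod2_alt.
    pose proof (Cmod2_alt xi) as E. rewrite Hxi in E. unfold Re, Im in *; simpl in *. unfold g in Hre. nra. }
  assert (HPd : cder P a (- (2 / (1 + beta) ^ 2) * l)%C).
  { assert (H1 : cder (fun z => 1 - b z)%C a (0 - l)%C) by (apply cder_minus; [apply cder_const|exact Hl]).
    assert (H2 : cder (fun z => 1 + b z)%C a (0 + l)%C) by (apply cder_plus; [apply cder_const|exact Hl]).
    assert (H3 := cder_mult _ _ _ _ _ H1 (cder_inv (fun z => 1 + b z)%C a _ ltac:(cbv beta; rewrite Hba; exact Hbeta1) H2)).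
    cbv beta in H3. rewrite Hba in H3.
    match type of H3 with cder _ _ ?d => replace d with (- (2 / (1 + beta) ^ 2) * l)%C in H3 end; [exact H3|].
    field. exact Hbeta1. }
  set (tau := ((2 * a - 2 * g) * f0 + N0 * (- (2 / (1 + beta) ^ 2) * l) + 2 * sg * a)%C).
  assert (HTd : cder T a tau).
  { assert (Hsq : cder (fun z => z * z)%C a (1 * a + a * 1)%C) by (apply (cder_mult (fun z => z) (fun z => z)); apply cder_id).
    assert (Hlin : cder (fun z => 2 * g * z)%C a (0 * a + 2 * g * 1)%C)
      by (apply (cder_mult (fun _ => 2 * g)%C (fun z => z)); [apply cder_const|apply cder_id]).
    assert (H1 := cder_plus _ _ _ _ _ (cder_minus _ _ _ _ _ Hsq Hlin) (cder_const 1 a)).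
    assert (H2 := cder_mult _ _ _ _ _ H1 HPd).
    assert (H3 := cder_mult _ _ _ _ _ (cder_const sg a) (cder_minus _ _ _ _ _ (cder_const 1 a) Hsq)).
    assert (H4 := cder_minus _ _ _ _ _ H2 H3). cbv beta in H4. rewrite HPa in H4.
    match type of H4 with cder _ _ ?d => replace d with tau in H4 end; [exact H4|].
    unfold tau, N0. rewrite !RtoC_plus, RtoC_minus, !RtoC_mult, RtoC_pow. field. exact Hbeta1. }
  assert (Htau : Re tau <= 0).
  { apply Rnot_lt_le. intros Hpos. destruct (HTd (Re tau / 2)) as [d [Hd Hw]]; [lra|].
    set (h := Rmin (d / 2) ((1 - a) / 2)).
    assert (Hh : 0 < h) by (apply Rmin_glb_lt; lra).
    pose proof (Rmin_l (d / 2) ((1 - a) / 2)) as M1. pose proof (Rmin_r (d / 2) ((1 - a) / 2)) as M2. fold h in M1, M2.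
    set (z := RtoC (a + h)).
    assert (Ezh : (z - a)%C = h) by (unfold z; rewrite RtoC_plus; ring).
    assert (Hzm : Cmod z < 1) by (unfold z; rewrite Cmod_R, Rabs_pos_eq; lra).
    assert (Hza : z <> a).
    { intros E. unfold z in E. apply RtoC_inj in E. lra. }
    specialize (Hw z). rewrite Ezh, HTa, Cmod_R, Rabs_pos_eq in Hw by lra. specialize (Hw ltac:(lra)).
    specialize (Hnn z Hzm Hza).
    assert (Eq : q z = RtoC (- h * (1 - a * (a + h)))).
    { unfold q, z. rewrite !RtoC_mult, RtoC_minus, RtoC_opp, RtoC_mult, RtoC_plus. ring. }
    assert (Hqneg : 0 < h * (1 - a * (a + h))) by (apply Rmult_lt_0_compat; nra).
    assert (Hq0 : q z <> 0).
    { rewrite Eq. intros E. apply (RtoC_inj _ 0) in E. lra. }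
    rewrite Re_div in Hnn by exact Hq0.
    assert (HTz : Re (T z) <= 0).
    { apply Rnot_lt_le. intros Hp. rewrite Eq in Hnn.
      set (Q := - h * (1 - a * (a + h))) in *.
      change (Im (RtoC Q)) with 0 in Hnn. change (Re (RtoC Q)) with Q in Hnn.
      rewrite Rmult_0_r, Rplus_0_r, Cmod_R in Hnn.
      assert (HQ : 0 < Rabs Q ^ 2) by (apply pow_lt, Rabs_pos_lt; unfold Q; lra).
      assert (HTQ : Re (T z) * Q < 0) by (unfold Q; nra).
      assert (Re (T z) * Q / Rabs Q ^ 2 < 0) by (now apply Rdiv_neg_pos). lra. }
    pose proof (re_le_Cmod (T z - 0 - tau * h)) as H3.
    replace (Re (T z - 0 - tau * h)%C) with (Re (T z) - Re tau * h) in H3.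
    2:{ unfold Re; simpl. ring. }
    apply Rabs_le_between in H3. nra. }
  assert (Etau : Re tau = 2 * (a - g) * f0 - N0 * (2 / (1 + beta) ^ 2) * Re l + 2 * sg * a).
  { unfold tau. replace (2 / (1 + beta) ^ 2)%C with (RtoC (2 / (1 + beta) ^ 2)).
    - unfold Re; simpl. ring.
    - rewrite RtoC_div, RtoC_pow, RtoC_plus by (apply pow_nonzero; lra). reflexivity. }
  assert (Hmain : 0 < 2 * (a - g) * f0 + 2 * sg * a).
  { replace (2 * (a - g) * f0 + 2 * sg * a) with (2 * f0 * (2 * a - g * (1 + a ^ 2)) / (1 - a ^ 2)).
    - apply Rdiv_lt_0_compat; [|lra]. apply Rmult_lt_0_compat; [lra|]. unfold g.
      assert (0 < (1 - a) ^ 2) by (apply pow_lt; lra).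
      replace (2 * a - (1 - 3 / 2 * (1 - a) ^ 2) * (1 + a ^ 2)) with ((1 - a) ^ 2 * (1 / 2 + 3 / 2 * a ^ 2)) by field.
      apply Rmult_lt_0_compat; [lra|]. pose proof (pow2_ge_0 a). lra.
    - unfold sg, N0. field. lra. }
  assert (HK : 0 < N0 * (2 / (1 + beta) ^ 2)).
  { apply Rmult_lt_0_compat; [lra|]. apply Rdiv_lt_0_compat; [lra|apply pow_lt; lra]. }
  apply Rnot_le_lt. intros Hn. rewrite Etau in Htau. nra.
Qed.

(** * Star-shaped level sets *)

(** A separation of [S] would separate a segment from 0 to a point of [S]; the supremum [ts] of the
    parameters in the part of 0 can lie in neither open set. *)
Lemma star_connected (S : C -> Prop) : (forall (z : C) (t : R), S z -> 0 <= t <= 1 -> S (t * z)%C) -> connected_C S.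
Proof.
  intros Hstar.
  assert (Key : forall U V : C -> Prop, open U -> open V ->
    (forall z, S z -> U z \/ V z) -> (forall z, S z -> U z -> V z -> False) ->
    U 0 -> forall v, S v -> V v -> False).
  { intros U V HU HV Hcov Hdis H0 v Sv Vv.
    set (E := fun t => 0 <= t <= 1 /\ U (t * v)%C).
    destruct (completeness E) as [ts [Hub Hlub]].
    { exists 1. intros t [Ht _]. lra. }
    { exists 0. split; [lra|]. replace (0 * v)%C with (0 : C) by ring. exact H0. }
    assert (Hts0 : 0 <= ts).
    { apply Hub. split; [lra|]. replace (0 * v)%C with (0 : C) by ring. exact H0. }
    assert (Hts1 : ts <= 1) by (apply Hlub; intros t [Ht _]; lra).
    assert (Sts : S (ts * v)%C) by (apply Hstar; [exact Sv|lra]).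
    pose proof (Cmod_ge_0 v) as Hv.
    assert (Hdist : forall t : R, Cmod (t * v - ts * v) = Rabs (t - ts) * Cmod v).
    { intros t. replace (t * v - ts * v)%C with (RtoC (t - ts) * v)%C by (rewrite RtoC_minus; ring).
      now rewrite Cmod_mult, Cmod_R. }
    assert (Hnear : forall d, 0 < d -> forall t, Rabs (t - ts) < d / (Cmod v + 1) -> Cmod (t * v - ts * v) < d).
    { intros d Hd t Ht. rewrite Hdist. pose proof (Rabs_pos (t - ts)).
      apply Rle_lt_trans with (Rabs (t - ts) * (Cmod v + 1)); [apply Rmult_le_compat_l; lra|].
      apply Rlt_le_trans with (d / (Cmod v + 1) * (Cmod v + 1)); [apply Rmult_lt_compat_r; lra|right; field; lra]. }
    destruct (Hcov _ Sts) as [Uts|Vts].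
    - destruct (Rle_lt_or_eq_dec _ _ Hts1) as [Hlt|Heq].
      + destruct (proj1 (locally_Cmod _ _) (HU _ Uts)) as [d [Hd Hw]].
        assert (Hq : 0 < d / (Cmod v + 1)) by (apply Rdiv_lt_0_compat; lra).
        set (t := ts + Rmin (d / (Cmod v + 1) / 2) (1 - ts)).
        assert (0 < Rmin (d / (Cmod v + 1) / 2) (1 - ts)) by (apply Rmin_glb_lt; lra).
        pose proof (Rmin_l (d / (Cmod v + 1) / 2) (1 - ts)). pose proof (Rmin_r (d / (Cmod v + 1) / 2) (1 - ts)).
        assert (Et : E t).
        { split; [unfold t; lra|]. apply Hw, Hnear; [exact Hd|]. rewrite Rabs_pos_eq; unfold t; lra. }
        apply Hub in Et. unfold t in Et. lra.
      + apply (Hdis v); [exact Sv| |exact Vv]. rewrite Heq in Uts. now replace v with (1 * v)%C by ring.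
    - destruct (proj1 (locally_Cmod _ _) (HV _ Vts)) as [d [Hd Hw]].
      assert (Hq : 0 < d / (Cmod v + 1)) by (apply Rdiv_lt_0_compat; lra).
      assert (exists t, E t /\ ts - d / (Cmod v + 1) < t) as [t [[Ht1 Ht2] Ht3]].
      { apply NNPP. intros Hn. assert (ts <= ts - d / (Cmod v + 1)); [|lra].
        apply Hlub. intros t Et. apply Rnot_lt_le. intros Hlt. apply Hn. now exists t. }
      assert (Hle : t <= ts) by (apply Hub; now split).
      apply (Hdis (t * v)%C); [now apply Hstar|exact Ht2|]. apply Hw, Hnear; [exact Hd|].
      rewrite Rabs_minus_sym, Rabs_pos_eq; lra. }
  intros U V HU HV Hcov Hdis [u [Su Uu]] [v [Sv Vv]].
  assert (S0 : S 0).
  { replace (0 : C) with (0 * u)%C by ring. apply Hstar; [exact Su|lra]. }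
  destruct (Hcov _ S0) as [U0|V0].
  - exact (Key U V HU HV Hcov Hdis U0 v Sv Vv).
  - apply (Key V U HV HU) with u; auto.
    + intros z Sz. destruct (Hcov z Sz); auto.
    + intros z Sz H1 H2. exact (Hdis z Sz H2 H1).
Qed.

(** Rotations [om] and [et] of the two discs make [a] and [b a] positive. The kernel hypothesis
    enters as [Re bt >= 0] near the arc, which gives [|1 + bt| >= 1]. *)
Lemma radial_increase_at (b : C -> C) (a : C) : self_map b -> Cmod (b 0) < 1 ->
  0 < Cmod a < 1 -> b a <> 0 ->
  (forall z, Cmod z < 1 -> Cmod (z - a) < 4 * (1 - Cmod a) -> Cmod (1 - Cconj (b a) * b z) < 1 / 2) ->
  (forall xi, Cmod xi = 1 -> Cmod (xi - a) <= 3 * (1 - Cmod a) -> ~ spec b xi) ->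
  exists s0, 0 < s0 /\ forall s, 0 < s < s0 -> Cmod (b a) < Cmod (b (a + s * (a / Cmod a))%C).
Proof.
  intros Hb Hb0 Ha Hba Hker Hns.
  set (rr := Cmod a) in *. set (beta := Cmod (b a)).
  assert (Hbeta : 0 < beta) by now apply Cmod_gt_0.
  assert (Hbeta1 : beta < 1) by (apply self_map_lt_1; [exact Hb|exact Hb0|apply Ha]).
  assert (Hrr0 : RtoC rr <> 0) by (intros E; apply (RtoC_inj _ 0) in E; lra).
  assert (Hbt0 : RtoC beta <> 0) by (intros E; apply (RtoC_inj _ 0) in E; lra).
  set (om := (a / rr)%C). set (et := (b a / beta)%C).
  assert (Hom : Cmod om = 1).
  { unfold om. rewrite Cmod_div, Cmod_R, Rabs_pos_eq by (assumption || lra). fold rr. field. lra. }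
  assert (Het : Cmod et = 1).
  { unfold et. rewrite Cmod_div, Cmod_R, Rabs_pos_eq by (assumption || lra). fold beta. field. lra. }
  assert (Ea : (om * rr)%C = a) by (unfold om; field; exact Hrr0).
  assert (Eb : (et * beta)%C = b a) by (unfold et; field; exact Hbt0).
  assert (Eet : (Cconj et * et)%C = 1) by (rewrite Cmult_comm, <- Cmod2_conj, Het; f_equal; ring).
  set (bt := fun z => (Cconj et * b (om * z))%C).
  assert (Hbtm : forall z, Cmod (bt z) = Cmod (b (om * z)%C)).
  { intros z. unfold bt. rewrite Cmod_mult, Cmod_conj, Het. ring. }
  assert (Homm : forall z, Cmod (om * z)%C = Cmod z) by (intros z; rewrite Cmod_mult, Hom; ring).
  destruct (proj1 Hb a) as [L HL]; [apply Ha|].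
  assert (Hpos : 0 < Re (Cconj et * (L * om))%C).
  { apply (radial_increase bt rr beta).
    - split; intros z Hz.
      + unfold bt. apply holo_mult; [apply holo_const|]. apply (holo_comp b (fun z => om * z)%C).
        * apply holo_mult; [apply holo_const|apply holo_id].
        * apply (proj1 Hb). now rewrite Homm.
      + rewrite Hbtm. apply (proj2 Hb). now rewrite Homm.
    - rewrite Hbtm. replace (om * 0)%C with (0 : C) by ring. exact Hb0.
    - lra.
    - lra.
    - unfold bt. rewrite Ea, <- Eb, Cmult_assoc, Eet. ring.
    - replace (Cconj et * (L * om))%C with (0 * b (om * rr) + Cconj et * (L * (0 * rr + om * 1)))%C by ring.
      apply (cder_mult (fun _ => Cconj et) (fun z => b (om * z)%C)); [apply cder_const|].
      apply (cder_comp b (fun z => om * z)%C).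
      + apply (cder_mult (fun _ => om) (fun z => z)); [apply cder_const|apply cder_id].
      + now rewrite Ea.
    - intros xi Hxi Hxi1 eps He.
      assert (Hoxi : Cmod (om * xi) = 1) by (rewrite Homm; exact Hxi).
      (* The arc has radius [2 * (1 - rr)] about the projection of [a], which is [1 - rr] from [a];
         a further [1 - rr] for nearby [z] explains the 4 in the kernel hypothesis. *)
      assert (Hdist : Cmod (om * xi - a) <= 3 * (1 - rr)).
      { replace (om * xi - a)%C with (om * (xi - 1) + om * (1 - rr))%C by (rewrite <- Ea; ring).
        eapply Rle_trans; [apply Cmod_triangle|]. rewrite !Homm, <- RtoC_minus, Cmod_R, Rabs_pos_eq; lra. }
      destruct (not_spec_near_1 b (om * xi)%C Hoxi (Hns _ Hoxi Hdist) eps He) as [d [Hd Hw]].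
      exists (Rmin d (1 - rr)). split; [apply Rmin_glb_lt; lra|]. intros z Hz Hzd.
      pose proof (Rmin_l d (1 - rr)). pose proof (Rmin_r d (1 - rr)).
      assert (Ed : Cmod (om * z - om * xi) = Cmod (z - xi)).
      { replace (om * z - om * xi)%C with (om * (z - xi))%C by ring. apply Homm. }
      rewrite Hbtm. split.
      + apply Hw; [now rewrite Homm|]. rewrite Ed. lra.
      + assert (Hk := Hker (om * z)%C). rewrite Homm in Hk. specialize (Hk Hz).
        assert (Hza : Cmod (om * z - a) < 4 * (1 - rr)).
        { replace (om * z - a)%C with ((om * z - om * xi) + (om * xi - a))%C by ring.
          eapply Rle_lt_trans; [apply Cmod_triangle|]. rewrite Ed. lra. }
        specialize (Hk Hza).
        assert (Ebt : (Cconj (b a) * b (om * z))%C = (beta * bt z)%C).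
        { rewrite <- Eb, Cmult_conj. unfold bt.
          replace (Cconj beta) with (RtoC beta) by (unfold Cconj, RtoC; simpl; f_equal; ring). ring. }
        rewrite Ebt in Hk. pose proof (re_le_Cmod (1 - beta * bt z)) as Hre.
        pose proof (re_le_Cmod (1 + bt z)) as Hre2.
        replace (Re (1 - beta * bt z)%C) with (1 - beta * Re (bt z)) in Hre by (unfold Re; simpl; ring).
        replace (Re (1 + bt z)%C) with (1 + Re (bt z)) in Hre2 by (unfold Re; simpl; ring).
        apply Rabs_le_between in Hre. pose proof (Rle_abs (1 + Re (bt z))).
        assert (0 <= Re (bt z)) by (apply Rnot_lt_le; intros Hneg; nra). lra. }
  set (D := Re (Cconj et * (L * om))%C) in *.
  destruct (HL (D / 2)) as [d [Hd Hw]]; [lra|].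
  exists d. split; [exact Hd|]. intros s Hs.
  set (z := (a + s * om)%C).
  assert (Ez : (z - a)%C = (s * om)%C) by (unfold z; ring).
  specialize (Hw z). rewrite Ez in Hw.
  assert (Eso : Cmod (s * om) = s) by (rewrite Cmod_mult, Hom, Cmod_R, Rabs_pos_eq; lra).
  rewrite Eso in Hw. specialize (Hw ltac:(lra)).
  pose proof (re_le_Cmod (Cconj et * (b z - b a - L * (s * om)))) as Hre.
  rewrite Cmod_mult, Cmod_conj, Het, Rmult_1_l in Hre.
  pose proof (re_le_Cmod (Cconj et * b z)) as Hre2.
  rewrite Cmod_mult, Cmod_conj, Het, Rmult_1_l in Hre2.
  replace (Cconj et * (b z - b a - L * (s * om)))%C with
    (Cconj et * b z - Cconj et * et * beta - RtoC s * (Cconj et * (L * om)))%C in Hre by (rewrite <- Eb; ring).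
  rewrite Eet in Hre.
  replace (Re (Cconj et * b z - 1 * beta - RtoC s * (Cconj et * (L * om)))%C) with
    (Re (Cconj et * b z)%C - beta - s * D) in Hre by (unfold D, Re; simpl; ring).
  apply Rabs_le_between in Hre. pose proof (Rle_abs (Re (Cconj et * b z)%C)). fold z. nra.
Qed.

Lemma continuous_radius (b : C -> C) (z : C) : self_map b -> Cmod z < 1 ->
  forall t, 0 <= t <= 1 -> continuity_pt (fun t => Cmod (b (t * z)%C)) t.
Proof.
  intros Hb Hz t Ht eps He.
  assert (Htz : Cmod (t * z) < 1).
  { rewrite Cmod_mult, Cmod_R, Rabs_pos_eq by lra. pose proof (Cmod_ge_0 z). nra. }
  destruct (holo_continuous b _ (proj1 Hb _ Htz) eps He) as [d [Hd Hw]].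
  exists d. split; [exact Hd|]. intros x [_ Hx]. simpl in *. unfold R_dist in *.
  assert (Hx2 : Cmod (x * z - t * z) < d).
  { replace (x * z - t * z)%C with (RtoC (x - t) * z)%C by (rewrite RtoC_minus; ring).
    rewrite Cmod_mult, Cmod_R. pose proof (Rabs_pos (x - t)). pose proof (Cmod_ge_0 z). nra. }
  specialize (Hw _ Hx2).
  pose proof (Cmod_sub_le (b (x * z)%C) (b (t * z)%C)). pose proof (Cmod_sub_le (b (t * z)%C) (b (x * z)%C)) as H2.
  rewrite Cmod_minus_sym in H2. apply Rabs_def1; lra.
Qed.

Lemma Cmod_1_conj_upper (a z : C) : Cmod a <= 1 -> Cmod (1 - Cconj a * z) <= (1 - Cmod a ^ 2) + Cmod (z - a).
Proof.
  intros Ha.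
  replace (1 - Cconj a * z)%C with (RtoC (1 - Cmod a ^ 2) - Cconj a * (z - a))%C.
  2:{ rewrite RtoC_minus, Cmod2_conj. ring. }
  unfold Cminus at 1. eapply Rle_trans; [apply Cmod_triangle|]. rewrite Cmod_opp, Cmod_mult, Cmod_conj, Cmod_R.
  pose proof (Cmod_ge_0 a). rewrite Rabs_pos_eq by nra. pose proof (Cmod_ge_0 (z - a)). nra.
Qed.

Lemma one_component_of_kernel (b : C -> C) : Hinf_norm1 b ->
  (exists c : R, 0 < c < 1 /\ forall xi, spec b xi ->
     closure_C (fun z => in_disc z /\ Cmod (b z) <= c) xi) ->
  (forall eps : R, 0 < eps -> exists delta : R, 0 < delta /\
     forall a : C, in_disc a -> Cmod (b a) > 1 - delta ->
       Rbar_le (kernel_sup b a) (Finite (eps / (1 - Cmod a ^ 2)))) ->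
  one_component b.
Proof.
  intros Hn [c [Hc Hcl]] Hker. assert (Hb := Hinf_self_map b Hn). split; [exact Hn|].
  assert (H01 : Cmod 0 < 1) by (rewrite Cmod_0; lra).
  destruct (Rle_lt_or_eq_dec _ _ (proj2 Hb 0 H01)) as [Hb0|Hb0].
  (* A unimodular constant: the level set is empty, hence connected. *)
  2:{ exists c. split; [exact Hc|]. split; [exact Hcl|].
      intros U V _ _ _ _ [z [[Hz Hzc] _]] _. rewrite (self_map_const b Hb Hb0 z Hz), Hb0 in Hzc. lra. }
  (* Within [5 * (1 - |a|)] of [a] the denominator is at most [6 * (1 - |a|^2)], and
     [6 / 20 < 1 / 2]. *)
  destruct (Hker ((1 - c) / 20)) as [delta [Hdel Hk]]; [lra|].
  set (m := Rmax c (Rmax (Cmod (b 0)) (1 - delta))).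
  assert (Hm1 : m < 1) by (unfold m; repeat apply Rmax_lub_lt; lra).
  assert (Hmc : c <= m) by apply Rmax_l.
  assert (Hm0 : Cmod (b 0) <= m) by (eapply Rle_trans; [apply Rmax_l|apply Rmax_r]).
  assert (Hmd : 1 - delta <= m) by (eapply Rle_trans; [apply Rmax_r|apply Rmax_r]).
  (* Strictly above [c], [|b 0|] and [1 - delta]: the closure condition is inherited, the maximum on
     a radius cannot sit at 0, and the kernel bound applies wherever [|b| >= c']. *)
  set (c' := (1 + m) / 2).
  exists c'. split; [unfold c'; lra|]. split.
  { intros xi Hxi P HP. destruct (Hcl xi Hxi P HP) as [z [[Hz1 Hz2] Hz3]]. exists z.
    repeat split; [exact Hz1|unfold c'; lra|exact Hz3]. }
  assert (Hfar : forall a, Cmod a < 1 -> c' <= Cmod (b a) -> forall z, Cmod z < 1 ->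
    Cmod (z - a) < 5 * (1 - Cmod a) -> Cmod (1 - Cconj (b a) * b z) < (1 - c) / 2).
  { intros a Ha Hba z Hz Hza.
    assert (HK := kernel_sup_ge b a z _ (Hk a Ha ltac:(unfold c' in Hba; lra)) Hz).
    pose proof (Cmod_ge_0 a).
    assert (Hd : 0 < 1 - Cmod a ^ 2) by nra.
    assert (Hden : 0 < Cmod (1 - Cconj a * z)).
    { pose proof (Cmod_1_conj_lower a z ltac:(lra)). lra. }
    rewrite Cmod_div in HK by now apply Cmod_gt_0.
    assert (Hup := Cmod_1_conj_upper a z ltac:(lra)).
    assert (Hup2 : Cmod (1 - Cconj a * z) <= 6 * (1 - Cmod a ^ 2)) by nra.
    set (X := Cmod (1 - Cconj (b a) * b z)) in *. set (Y := Cmod (1 - Cconj a * z)) in *.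
    assert (HX : X <= (1 - c) / 20 / (1 - Cmod a ^ 2) * Y).
    { replace X with (X / Y * Y) by (field; lra). apply Rmult_le_compat_r; lra. }
    assert ((1 - c) / 20 / (1 - Cmod a ^ 2) * Y <= (1 - c) / 20 / (1 - Cmod a ^ 2) * (6 * (1 - Cmod a ^ 2))).
    { apply Rmult_le_compat_l; [|lra]. apply Rdiv_le_0_compat; lra. }
    assert ((1 - c) / 20 / (1 - Cmod a ^ 2) * (6 * (1 - Cmod a ^ 2)) = 6 * ((1 - c) / 20)) by (field; lra).
    lra. }
  apply star_connected. intros z t [Hz Hzc] Ht. unfold in_disc in *.
  assert (Hin : forall s, 0 <= s <= 1 -> Cmod (s * z) < 1).
  { intros s Hs. rewrite Cmod_mult, Cmod_R, Rabs_pos_eq by lra. pose proof (Cmod_ge_0 z). nra. }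
  split; [now apply Hin|].
  (* If the maximum over the segment reached [c'], it would be at an interior [t0], beyond which
     [|b|] still increases. *)
  destruct (continuity_ab_maj (fun t => Cmod (b (t * z)%C)) 0 1 Rle_0_1 (continuous_radius b z Hb Hz)) as [t0 [Hmx Ht0]].
  specialize (Hmx t Ht) as Hmt. apply Rle_lt_trans with (1 := Hmt).
  apply Rnot_le_lt. intros Hge. set (a := (t0 * z)%C) in *.
  assert (Ht00 : t0 <> 0).
  { intros E. unfold a in Hge. rewrite E in Hge. replace (0 * z)%C with (0 : C) in Hge by ring. unfold c' in Hge; lra. }
  assert (Ht01 : t0 <> 1).
  { intros E. unfold a in Hge. rewrite E in Hge. replace (1 * z)%C with z in Hge by ring. lra. }
  assert (Hz0 : 0 < Cmod z).
  { apply Cmod_gt_0. intros E. unfold a in Hge. rewrite E in Hge.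
    replace (t0 * 0)%C with (0 : C) in Hge by ring. unfold c' in Hge; lra. }
  assert (Hat : Cmod a = t0 * Cmod z) by (unfold a; rewrite Cmod_mult, Cmod_R, Rabs_pos_eq; lra).
  assert (Ha : 0 < Cmod a < 1).
  { split; [rewrite Hat; apply Rmult_lt_0_compat; lra|now apply Hin]. }
  assert (Hba0 : b a <> 0) by (apply Cmod_gt_0'; unfold c' in Hge; lra).
  destruct (radial_increase_at b a Hb Hb0 Ha Hba0) as [s0 [Hs0 Hs]].
  { intros w Hw Hwa. pose proof (Hfar a (proj2 Ha) Hge w Hw ltac:(lra)). lra. }
  (* A spectral point this close would bring a [w] with [|b w| <= c] into the range of [Hfar], where
     [|1 - Cconj (b a) * b w|] is below [(1 - c) / 2]; yet it is at least [1 - c]. *)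
  { intros xi Hxi Hxa Hsp. destruct (closure_near _ _ (Hcl xi Hsp) (1 - Cmod a) ltac:(lra)) as [w [[Hw1 Hw2] Hw3]].
    unfold in_disc in Hw1.
    assert (Hwa : Cmod (w - a) < 5 * (1 - Cmod a)).
    { replace (w - a)%C with ((w - xi) + (xi - a))%C by ring. eapply Rle_lt_trans; [apply Cmod_triangle|]. lra. }
    pose proof (Hfar a (proj2 Ha) Hge w Hw1 Hwa) as HX.
    pose proof (Cmod_sub_le 1 (Cconj (b a) * b w)) as HY. rewrite Cmod_1, Cmod_mult, Cmod_conj in HY.
    pose proof (proj2 Hb a (proj2 Ha)). pose proof (Cmod_ge_0 (b a)). pose proof (Cmod_ge_0 (b w)). nra. }
  set (s := Rmin (s0 / 2) ((1 - t0) * Cmod z)).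
  assert (Hs1 : 0 < s) by (apply Rmin_glb_lt; [lra|apply Rmult_lt_0_compat; lra]).
  pose proof (Rmin_l (s0 / 2) ((1 - t0) * Cmod z)) as M1. pose proof (Rmin_r (s0 / 2) ((1 - t0) * Cmod z)) as M2. fold s in M1, M2.
  specialize (Hs s ltac:(lra)).
  assert (Hz0' : RtoC (Cmod z) <> 0) by (intros E; apply (RtoC_inj _ 0) in E; lra).
  assert (Ht0' : RtoC t0 <> 0) by (intros E; apply (RtoC_inj _ 0) in E; lra).
  replace (a + s * (a / Cmod a))%C with (RtoC (t0 + s / Cmod z) * z)%C in Hs.
  2:{ rewrite Hat, RtoC_plus, RtoC_div, RtoC_mult by lra. unfold a. field. now split. }
  assert (Hsz : 0 < s / Cmod z <= 1 - t0).
  { split; [apply Rdiv_lt_0_compat; lra|]. apply Rmult_le_reg_r with (Cmod z); [lra|].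
    replace (s / Cmod z * Cmod z) with s by (field; lra). lra. }
  specialize (Hmx (t0 + s / Cmod z) ltac:(lra)). fold a in Hmx. lra.
Qed.

(** * Lower bound for harmonic measure *)

(** One minus the squared pseudo-hyperbolic distance; a stand-in for the Green potential
    [- ln |blaschke zeta z|^2] that stays bounded at [zeta]. *)
Definition phX (z zeta : C) : R :=
  (1 - Cmod z ^ 2) * (1 - Cmod zeta ^ 2) / Cmod (1 - Cconj zeta * z) ^ 2.

Definition blaschke (zeta z : C) : C := ((z - zeta) / (1 - Cconj zeta * z))%C.

Lemma blaschke_den (zeta z : C) : Cmod zeta < 1 -> Cmod z <= 1 -> 0 < Cmod (1 - Cconj zeta * z).
Proof. intros H1 H2. pose proof (Cmod_1_conj_lower zeta z H2). lra. Qed.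

Lemma blaschke_mod2 (zeta z : C) : Cmod zeta < 1 -> Cmod z <= 1 ->
  Cmod (blaschke zeta z) ^ 2 = 1 - phX z zeta.
Proof.
  intros H1 H2. assert (H := blaschke_den zeta z H1 H2). unfold blaschke, phX.
  rewrite Cmod_div by now apply Cmod_gt_0'.
  pose proof (pick_identity zeta z) as E. rewrite (Rmult_comm (1 - Cmod z ^ 2)), <- E. field. lra.
Qed.

Lemma phX_bounds (z zeta : C) : Cmod z < 1 -> Cmod zeta < 1 -> 0 <= phX z zeta <= 1.
Proof.
  intros H1 H2. split.
  - apply Rdiv_le_0_compat.
    + pose proof (Cmod_ge_0 z). pose proof (Cmod_ge_0 zeta). apply Rmult_le_pos; nra.
    + apply pow_lt, blaschke_den; lra.
  - pose proof (blaschke_mod2 zeta z H2 ltac:(lra)). pose proof (pow2_ge_0 (Cmod (blaschke zeta z))). lra.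
Qed.

Definition sumf (f : C -> R) (l : list C) : R := fold_right (fun zeta s => f zeta + s) 0 l.

Lemma sumf_app f l1 l2 : sumf f (l1 ++ l2) = sumf f l1 + sumf f l2.
Proof. induction l1 as [|x l1 IH]; simpl; [ring|]. rewrite IH. ring. Qed.

Lemma sumf_le f g l : (forall x, In x l -> f x <= g x) -> sumf f l <= sumf g l.
Proof.
  induction l as [|x l IH]; intros H; simpl; [lra|].
  assert (f x <= g x) by (apply H; now left). assert (sumf f l <= sumf g l) by (apply IH; intros; apply H; now right). lra.
Qed.

Lemma sumf_scal f k l : sumf (fun x => k * f x) l = k * sumf f l.
Proof. induction l as [|x l IH]; simpl; [ring|]. rewrite IH. ring. Qed.

(* A point whose depth [1 - |zeta|] is comparable to the length of the interval of radii
   containing [|zeta - a|] contributes to the potential at most the Poisson mass of that interval. *)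
Lemma phX_le_atan (a z zeta : C) (al be : R) : Cmod z < 1 -> Cmod zeta < 1 ->
  al <= Cmod (zeta - a) <= be -> al < be -> (be - al) / 2 <= 1 - Cmod zeta <= be - al ->
  phX z zeta <= 40 * (atan ((be - Cmod (z - a)) / (1 - Cmod z)) - atan ((al - Cmod (z - a)) / (1 - Cmod z))).
Proof.
  intros Hz Hze Htau Hab Hy. set (x := Cmod (z - a)). set (y := 1 - Cmod z).
  assert (Hy0 : 0 < y) by (unfold y; lra).
  set (l := be - al) in *. set (m := Cmod (1 - Cconj zeta * z)).
  pose proof (Cmod_ge_0 z) as Z0. pose proof (Cmod_ge_0 zeta) as Z1.
  assert (M1 : y <= m).
  { unfold m, y. pose proof (Cmod_sub_le 1 (Cconj zeta * z)) as H. rewrite Cmod_1, Cmod_mult, Cmod_conj in H. nra. }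
  assert (M2 : 1 - Cmod zeta <= m) by (apply Cmod_1_conj_lower; lra).
  assert (M3 : Rabs (x - Cmod (zeta - a)) <= m).
  { apply Rle_trans with (Cmod (z - zeta)); [|apply Cmod_1_conj_ge; lra].
    pose proof (Cmod_sub_le (z - a) (zeta - a)) as H. pose proof (Cmod_sub_le (zeta - a) (z - a)) as H'.
    replace (z - a - (zeta - a))%C with (z - zeta)%C in H by ring.
    replace (zeta - a - (z - a))%C with (zeta - z)%C in H' by ring. rewrite (Cmod_minus_sym zeta z) in H'.
    apply Rabs_le. fold x in H, H'. lra. }
  assert (Hpos : forall t, 0 < y ^ 2 + (t - x) ^ 2) by (intros t; pose proof (pow2_ge_0 (t - x)); nra).
  assert (Hder : forall t, is_derive (fun t => atan ((t - x) / y)) t (/ (1 + ((t - x) / y) ^ 2) * / y)).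
  { intros t. auto_derive; [lra|]. specialize (Hpos t). field. repeat split; nra. }
  destruct (MVT_gen (fun t => atan ((t - x) / y)) al be (fun t => / (1 + ((t - x) / y) ^ 2) * / y)) as [t [Ht E]].
  - intros t _. apply Hder.
  - intros t _. apply derivable_continuous_pt. exists (/ (1 + ((t - x) / y) ^ 2) * / y). apply is_derive_Reals.
    apply Hder.
  - rewrite Rmin_left, Rmax_right in Ht by lra. rewrite E. fold l.
    assert (Hm : 0 < m) by lra.
    apply Rabs_le_between in M3.
    assert (Hxt : (t - x) ^ 2 <= 9 * m ^ 2).
    (* [|t - x| <= l + m], and [l <= 2 * (1 - |zeta|) <= 2 * m]. *)
    { assert (- (3 * m) <= t - x <= 3 * m) by (unfold l in *; lra). nra. }
    assert (Hy2 : y ^ 2 <= m ^ 2) by (apply pow_incr; lra).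
    replace (/ (1 + ((t - x) / y) ^ 2) * / y * l) with (y * l / (y ^ 2 + (t - x) ^ 2)).
    2:{ specialize (Hpos t). field. repeat split; nra. }
    assert (Hs := Hpos t).
    assert (Hlow : y * l / (10 * m ^ 2) <= y * l / (y ^ 2 + (t - x) ^ 2)).
    { apply Rmult_le_compat_l; [apply Rmult_le_pos; unfold l; lra|]. apply Rinv_le_contravar; lra. }
    (* 40 is 4 from the numerator bound [(2 * y) * (2 * l)] times 10 from
       [y^2 + (t - x)^2 <= 10 * m^2]. *)
    apply Rle_trans with (40 * (y * l / (10 * m ^ 2))); [|lra].
    replace (40 * (y * l / (10 * m ^ 2))) with (4 * (y * l) / m ^ 2) by (field; lra).
    unfold phX. fold m. apply Rmult_le_compat_r; [left; apply Rinv_0_lt_compat, pow_lt; lra|].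
    replace (4 * (y * l)) with ((2 * y) * (2 * l)) by ring.
    apply Rmult_le_compat; unfold y; nra.
Qed.

(** A stopping-time selection: an interval of radii is halved until it contains the radius of a
    point whose depth [1 - |zeta|] is at least half its length. One point is kept per final
    interval, so depths add up to a fixed share of [r], while the arctangent bounds telescope to at
    most [40 * PI], however many points there are. *)
Lemma covering (Om : C -> Prop) (a : C) (r : R) : 0 < r -> (forall z, Om z -> Cmod z < 1) ->
  (forall rho, r <= rho <= 2 * r -> exists zeta, Om zeta /\ Cmod (zeta - a) = rho) ->
  exists l, (forall zeta, In zeta l -> Om zeta /\ r <= Cmod (zeta - a) <= 2 * r) /\
    (forall z, Cmod z < 1 -> sumf (phX z) l <= 40 * PI) /\
    r / 2 <= sumf (fun zeta => 1 - Cmod zeta) l.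
Proof.
  intros Hr Hdisc Hmeet.
  set (low := fun al be => forall zeta, Om zeta -> al <= Cmod (zeta - a) <= be -> 1 - Cmod zeta <= be - al).
  set (good := fun al be l => (forall zeta, In zeta l -> Om zeta /\ r <= Cmod (zeta - a) <= 2 * r) /\
    (forall z, Cmod z < 1 -> sumf (phX z) l <=
       40 * (atan ((be - Cmod (z - a)) / (1 - Cmod z)) - atan ((al - Cmod (z - a)) / (1 - Cmod z)))) /\
    (be - al) / 2 <= sumf (fun zeta => 1 - Cmod zeta) l).
  assert (Hone : forall al be zeta, r <= al -> be <= 2 * r -> al < be -> low al be -> Om zeta ->
    al <= Cmod (zeta - a) <= be -> (be - al) / 2 <= 1 - Cmod zeta -> exists l, good al be l).
  { intros al be zeta H1 H2 H3 H4 H5 H6 H7. exists (zeta :: nil). split; [|split].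
    - intros w [<-|[]]. split; [exact H5|lra].
    - intros z Hz. simpl. rewrite Rplus_0_r. apply phX_le_atan; auto.
    - simpl. lra. }
  (* A point deeper than the whole interval suffices alone, since [phX <= 1]. Otherwise [low] holds
     at the start and is passed to the halves whenever no point stops the interval. *)
  destruct (classic (exists zeta, Om zeta /\ r <= Cmod (zeta - a) <= 2 * r /\ r < 1 - Cmod zeta)) as [[zeta [H1 [H2 H3]]]|Hno].
  { exists (zeta :: nil). split; [|split].
    - intros w [<-|[]]. now split.
    - intros z Hz. simpl. pose proof (phX_bounds z zeta Hz (Hdisc _ H1)). pose proof PI_RGT_0. pose proof PI2_1. lra.
    - simpl. lra. }
  assert (HQ : r <= r -> r + r * 1 <= 2 * r -> low r (r + r * 1) -> exists l, good r (r + r * 1) l).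
  { refine (bisection_induction r 0 (fun x _ t => r <= x -> x + r * t <= 2 * r ->
      low x (x + r * t) -> exists l, good x (x + r * t) l) _ _ _ _ r 0 1 _); [lra|lra| | |lra].
    - intros x y t Ht Q1 Q2 _ _ Hx1 Hx2 Hlow.
      assert (Hrt : 0 < r * t) by (apply Rmult_lt_0_compat; lra).
      destruct (classic (exists zeta, Om zeta /\ x <= Cmod (zeta - a) <= x + r * t /\ (r * t) / 2 <= 1 - Cmod zeta)) as [[zeta [A1 [A2 A3]]]|Hn].
      { apply (Hone x (x + r * t) zeta); try assumption; lra. }
      assert (Hn' : forall zeta, Om zeta -> x <= Cmod (zeta - a) <= x + r * t -> 1 - Cmod zeta <= r * t / 2).
      { intros zeta B1 B2. apply Rnot_lt_le. intros B3. apply Hn. exists zeta. repeat split; try assumption; lra. }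
      replace (x + r * (t / 2) + r * (t / 2)) with (x + r * t) in Q2 by field.
      destruct Q1 as [l1 [G1 [G2 G3]]]; [lra|lra| |].
      { intros zeta B1 B2. specialize (Hn' zeta B1 ltac:(lra)). lra. }
      destruct Q2 as [l2 [K1 [K2 K3]]]; [lra|lra| |].
      { intros zeta B1 B2. specialize (Hn' zeta B1 ltac:(lra)). lra. }
      exists (l1 ++ l2). split; [|split].
      + intros zeta Hin. apply in_app_or in Hin as [Hin|Hin]; auto.
      + intros z Hz. rewrite sumf_app. specialize (G2 z Hz). specialize (K2 z Hz). lra.
      + rewrite sumf_app. lra.
    (* Halving ends because each circle carries a point of positive depth: any shorter interval
       around its radius meets the stopping condition. *)
    - intros x0 y0. destruct (classic (r <= x0 <= 2 * r)) as [Hx0|Hx0].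
      + destruct (Hmeet x0 Hx0) as [zeta [A1 A2]]. assert (A3 := Hdisc _ A1).
        exists ((1 - Cmod zeta) / r). split; [apply Rdiv_lt_0_compat; lra|].
        intros x y t Ht Hx _ B1 B2 Hlow.
        assert (r * t < 1 - Cmod zeta).
        { apply Rlt_le_trans with (r * ((1 - Cmod zeta) / r)); [apply Rmult_lt_compat_l; lra|right; field; lra]. }
        assert (Hrt : 0 < r * t) by (apply Rmult_lt_0_compat; lra).
        apply (Hone x (x + r * t) zeta); try assumption; lra.
      + exists 1. split; [lra|]. intros x y t Ht Hx _ B1 B2 _. exfalso. apply Hx0. lra. }
  destruct HQ as [l [G1 [G2 G3]]]; [lra|lra| |].
  { intros zeta H1 H2. apply Rnot_lt_le. intros H3. apply Hno. exists zeta. repeat split; try assumption; lra. }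
  exists l. split; [exact G1|]. split.
  - intros z Hz. eapply Rle_trans; [now apply G2|].
    pose proof (atan_bound ((r + r * 1 - Cmod (z - a)) / (1 - Cmod z))).
    pose proof (atan_bound ((r - Cmod (z - a)) / (1 - Cmod z))). lra.
  - lra.
Qed.

(** * Finite Blaschke products and the comparison with a power of [b] *)

Definition bprod (l : list C) (z : C) : C := fold_right (fun zeta p => (blaschke zeta z * p)%C) (RtoC 1) l.

Lemma holo_bprod l z : (forall zeta, In zeta l -> Cmod zeta < 1) -> Cmod z <= 1 -> holo_at (bprod l) z.
Proof.
  intros Hl Hz. induction l as [|x l IH].
  - exact (holo_const 1 z).
  - apply (holo_mult (blaschke x) (bprod l)).
    + unfold blaschke. apply holo_div.
      * apply Cmod_gt_0', blaschke_den; [apply Hl; now left|exact Hz].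
      * apply holo_minus; [apply holo_id|apply holo_const].
      * apply holo_minus; [apply holo_const|]. apply holo_mult; [apply holo_const|apply holo_id].
    + apply IH. intros; apply Hl; now right.
Qed.

Lemma bprod_circle l z : (forall zeta, In zeta l -> Cmod zeta < 1) -> Cmod z = 1 -> Cmod (bprod l z) = 1.
Proof.
  intros Hl Hz. induction l as [|x l IH].
  - apply Cmod_1.
  - simpl. rewrite Cmod_mult, IH by (intros; apply Hl; now right).
    assert (Hx : Cmod x < 1) by (apply Hl; now left).
    pose proof (blaschke_mod2 x z Hx ltac:(lra)) as E. unfold phX in E. rewrite Hz in E.
    replace (1 - (1 - 1 ^ 2) * (1 - Cmod x ^ 2) / Cmod (1 - Cconj x * z) ^ 2) with 1 in E.
    2:{ pose proof (blaschke_den x z Hx ltac:(lra)). field. lra. }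
    pose proof (Cmod_ge_0 (blaschke x z)). nra.
Qed.

(** Away from the zeros each factor satisfies [1 - X >= 1 / 81], and in that range
    [1 - X >= exp (- 81 * X)]; the bound thus depends on the total potential only, not on the number
    of zeros. *)
Lemma bprod_lower l z : (forall zeta, In zeta l -> Cmod zeta < 1) -> Cmod z < 1 ->
  (forall zeta, In zeta l -> (1 - Cmod zeta) / 4 <= Cmod (z - zeta)) ->
  exp (- (81 * sumf (phX z) l)) <= Cmod (bprod l z) ^ 2.
Proof.
  intros Hl Hz Hd. induction l as [|x l IH].
  - simpl. rewrite Cmod_1, Rmult_0_r, Ropp_0, exp_0. lra.
  - simpl sumf. simpl bprod. rewrite Cmod_mult, Rpow_mult_distr.
    replace (- (81 * (phX z x + sumf (phX z) l))) with (- (81 * phX z x) + - (81 * sumf (phX z) l)) by ring.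
    rewrite exp_plus. apply Rmult_le_compat; try (left; apply exp_pos).
    2:{ apply IH; intros; [apply Hl|apply Hd]; now right. }
    assert (Hx : Cmod x < 1) by (apply Hl; now left).
    assert (Hdx := Hd x ltac:(now left)).
    rewrite blaschke_mod2 by lra.
    assert (HX := phX_bounds z x Hz Hx).
    assert (H81 : 1 / 81 <= 1 - phX z x).
    { rewrite <- blaschke_mod2 by lra. unfold blaschke.
      assert (Hden := blaschke_den x z Hx ltac:(lra)). rewrite Cmod_div by now apply Cmod_gt_0'.
      pose proof (Cmod_1_conj_upper x z ltac:(lra)) as Hup.
      pose proof (Cmod_ge_0 x).
      (* [1 - |x|^2 <= 2 * (1 - |x|) <= 8 * |z - x|], plus [|z - x|] once more. *)
      assert (Hq : Cmod (1 - Cconj x * z) <= 9 * Cmod (z - x)) by nra.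
      replace (1 / 81) with ((1 / 9) ^ 2) by field. apply pow_incr. split; [lra|].
      apply Rmult_le_reg_r with (Cmod (1 - Cconj x * z)); [exact Hden|].
      replace (Cmod (z - x) / Cmod (1 - Cconj x * z) * Cmod (1 - Cconj x * z)) with (Cmod (z - x)) by (field; lra). lra. }
    set (X := phX z x) in *.
    rewrite exp_Ropp. apply Rmult_le_reg_r with (exp (81 * X)); [apply exp_pos|].
    rewrite Rinv_l by (pose proof (exp_pos (81 * X)); lra).
    pose proof (exp_ineq1_le (81 * X)).
    apply Rle_trans with ((1 - X) * (1 + 81 * X)); [nra|]. apply Rmult_le_compat_l; lra.
Qed.

Lemma bprod_upper l z : (forall zeta, In zeta l -> Cmod zeta < 1) -> Cmod z < 1 ->
  Cmod (bprod l z) ^ 2 <= exp (- sumf (phX z) l).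
Proof.
  intros Hl Hz. induction l as [|x l IH].
  - simpl. rewrite Cmod_1, Ropp_0, exp_0. lra.
  - simpl sumf. simpl bprod. rewrite Cmod_mult, Rpow_mult_distr, Ropp_plus_distr, exp_plus.
    apply Rmult_le_compat; try apply pow2_ge_0.
    2:{ apply IH; intros; apply Hl; now right. }
    rewrite blaschke_mod2; [|apply Hl; now left|lra].
    pose proof (exp_ineq1_le (- phX z x)). lra.
Qed.

Lemma bernoulli_le (u : R) (n : nat) : 0 <= u <= 1 -> 1 - INR n * (1 - u) <= u ^ n.
Proof.
  intros Hu. induction n as [|n IH]; [simpl; lra|].
  rewrite S_INR. simpl. assert (0 <= INR n) by apply pos_INR.
  assert (u * (1 - INR n * (1 - u)) <= u * u ^ n) by (apply Rmult_le_compat_l; lra).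
  assert (0 <= INR n * (1 - u) * (1 - u)) by (apply Rmult_le_pos; [apply Rmult_le_pos|]; lra). nra.
Qed.

Lemma openC_avoid (l : list C) :
  openC (fun z => Cmod z < 1 /\ forall zeta, In zeta l -> (1 - Cmod zeta) / 4 < Cmod (z - zeta)).
Proof.
  induction l as [|x l IH]; intros z [Hz Hl].
  - exists (1 - Cmod z). split; [lra|]. intros w Hw. split; [|intros zeta []].
    pose proof (Cmod_sub_le w z). lra.
  - destruct (IH z) as [r [Hr Hw]]; [split; [exact Hz|intros; apply Hl; now right]|].
    assert (Hx := Hl x ltac:(now left)).
    exists (Rmin r (Cmod (z - x) - (1 - Cmod x) / 4)). split; [apply Rmin_glb_lt; lra|].
    intros w Hwz. pose proof (Rmin_l r (Cmod (z - x) - (1 - Cmod x) / 4)). pose proof (Rmin_r r (Cmod (z - x) - (1 - Cmod x) / 4)).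
    destruct (Hw w ltac:(lra)) as [Hw1 Hw2]. split; [exact Hw1|].
    intros zeta [<-|Hin]; [|now apply Hw2].
    pose proof (Cmod_triangle (z - w) (w - x)) as HT. replace (z - w + (w - x))%C with (z - x)%C in HT by ring.
    rewrite (Cmod_minus_sym z w) in HT. lra.
Qed.

(* Circular-projection estimate for harmonic measure (Hall's lemma, up to constants). *)
Lemma harmonic_measure_lower (c : R) : 0 <= c < 1 -> exists kappa, 0 < kappa /\
  forall (b : C -> C) (a : C) (r : R), self_map b -> Cmod a < 1 -> 1 - Cmod a <= r ->
    (forall rho, r <= rho <= 2 * r -> exists zeta, (Cmod zeta < 1 /\ Cmod (b zeta) < c) /\ Cmod (zeta - a) = rho) ->
    kappa * (1 - Cmod a) / r <= 1 - Cmod (b a).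
Proof.
  (* Bound of [|b|^2] on the disc of radius half the depth about a point where [|b| < c], from
     [schwarz_pick_lower] with [s = 1 / 2]. *)
  intros Hc. set (c2 := 1 - 3 / 4 * (1 - c) ^ 2).
  assert (Hc2 : 0 <= c2 < 1) by (unfold c2; nra).
  (* Lower bound of [|bprod|^2] away from the zeros, valid for every selection made by [covering].
     Hence [N], chosen with [c2 ^ N < Q], depends on [c] alone. *)
  set (Q := exp (- (81 * (40 * PI)))).
  assert (HQ : 0 < Q) by apply exp_pos.
  destruct (pow_lt_1_zero c2) with (y := Q) as [N0 HN0]; [rewrite Rabs_pos_eq; lra|exact HQ|].
  set (N := S N0). assert (HN := HN0 N ltac:(unfold N; lia)).
  rewrite Rabs_pos_eq in HN by (apply pow_le; lra).
  assert (HNp : 1 <= INR N) by (unfold N; rewrite S_INR; pose proof (pos_INR N0); lra).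
  exists (/ (128 * INR N)). split; [apply Rinv_0_lt_compat; lra|].
  intros b a r Hb Ha Har Hmeet.
  assert (Hr : 0 < r) by lra.
  destruct (covering (fun z => Cmod z < 1 /\ Cmod (b z) < c) a r Hr ltac:(now intros z [? _]) Hmeet) as [l [Hl [HX HY]]].
  assert (Hl1 : forall zeta, In zeta l -> Cmod zeta < 1) by (intros zeta Hin; now destruct (Hl zeta Hin) as [[? _] _]).
  set (G := fun z => Cmod z < 1 /\ forall zeta, In zeta l -> (1 - Cmod zeta) / 4 < Cmod (z - zeta)).
  assert (HBG : forall z, G z -> Q <= Cmod (bprod l z) ^ 2).
  { intros z [Hz Hzl]. eapply Rle_trans; [|apply bprod_lower; [exact Hl1|exact Hz|intros; left; now apply Hzl]].
    unfold Q. apply exp_le_compat. specialize (HX z Hz). lra. }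
  assert (HBG0 : forall z, G z -> 0 < Cmod (bprod l z)).
  { intros z Gz. specialize (HBG z Gz). pose proof (Cmod_ge_0 (bprod l z)).
    destruct (Rle_lt_or_eq_dec _ _ H) as [|E]; [assumption|]. rewrite <- E in HBG. simpl in HBG. lra. }
  (* [1 - |zeta| <= (1 - |a|) + |zeta - a| <= 2 * |zeta - a|], because
     [1 - |a| <= r <= |zeta - a|]. *)
  assert (HGa : G a).
  { split; [exact Ha|]. intros zeta Hin. destruct (Hl zeta Hin) as [_ Hd]. rewrite Cmod_minus_sym.
    pose proof (Cmod_sub_le a zeta) as H. rewrite Cmod_minus_sym in H. lra. }
  assert (HM : Cmod (b a ^ N / bprod l a)%C <= 1).
  { apply (max_modulus G (fun z => b z ^ N / bprod l z)%C 1); [lra|now intros z [? _]|apply openC_avoid| | |exact HGa].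
    - intros z Gz. apply holo_div.
      + now apply Cmod_gt_0', HBG0.
      + apply holo_pow. apply (proj1 Hb), (proj1 Gz).
      + apply holo_bprod; [exact Hl1|]. left; apply (proj1 Gz).
    - intros xi Hxi eps He. destruct (Rlt_or_le (Cmod xi) 1) as [Hlt|Hge].
      + assert (exists zeta, In zeta l /\ Cmod (xi - zeta) <= (1 - Cmod zeta) / 4) as [zeta [Hin Hd]].
        { apply NNPP. intros Hn. apply Hxi. split; [exact Hlt|]. intros zeta Hin. apply Rnot_le_lt. intros Hle. apply Hn. now exists zeta. }
        assert (Hz1 := Hl1 zeta Hin). exists ((1 - Cmod zeta) / 4). split; [lra|]. intros z Gz Hzd.
        assert (Hzz : Cmod (z - zeta) < 1 / 2 * (1 - Cmod zeta)).
        { replace (z - zeta)%C with ((z - xi) + (xi - zeta))%C by ring. eapply Rle_lt_trans; [apply Cmod_triangle|]. lra. }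
        assert (Hball : forall w, Cmod (w - zeta) < 1 - Cmod zeta -> Cmod w < 1).
        { intros w Hw. pose proof (Cmod_sub_le w zeta). lra. }
        assert (HS := schwarz_pick_lower b zeta (1 - Cmod zeta) ltac:(lra)
          ltac:(intros w Hw; apply (proj1 Hb); auto) ltac:(intros w Hw; apply (proj2 Hb); auto) z (1 / 2) ltac:(lra) ltac:(lra) ltac:(lra)).
        destruct (Hl zeta Hin) as [[_ Hbz] _].
        assert (Hb2 : Cmod (b z) ^ 2 <= c2).
        { assert ((1 - c) ^ 2 <= (1 - Cmod (b zeta)) ^ 2) by (apply pow_incr; lra). unfold c2. lra. }
        specialize (HBG z Gz). specialize (HBG0 z Gz).
        rewrite Cmod_div by now apply Cmod_gt_0'. rewrite Cmod_pow.
        assert (Hle : Cmod (b z) ^ N <= Cmod (bprod l z)).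
        { apply Rsqr_incr_0_var; [|lra]. rewrite !Rsqr_pow2, <- pow_mult, Nat.mul_comm, pow_mult.
          apply Rle_trans with (c2 ^ N); [|lra]. apply pow_incr. split; [apply pow2_ge_0|exact Hb2]. }
        apply Rle_trans with 1; [|lra]. apply Rmult_le_reg_r with (Cmod (bprod l z)); [exact HBG0|].
        unfold Rdiv. rewrite Rmult_assoc, Rinv_l; lra.
      + destruct (Rle_lt_or_eq_dec _ _ Hge) as [Hgt|Heq].
        { exists (Cmod xi - 1). split; [lra|]. intros z [Hz _] Hzd. pose proof (Cmod_sub_le xi z) as H.
          rewrite Cmod_minus_sym in H. lra. }
        symmetry in Heq. set (e := Rmin (1 / 2) (eps / 2)).
        assert (He0 : 0 < e) by (apply Rmin_glb_lt; lra).
        pose proof (Rmin_l (1 / 2) (eps / 2)) as E1. pose proof (Rmin_r (1 / 2) (eps / 2)) as E2. fold e in E1, E2.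
        destruct (holo_continuous (bprod l) xi (holo_bprod l xi Hl1 ltac:(lra)) e He0) as [d [Hd Hw]].
        exists d. split; [exact Hd|]. intros z Gz Hzd. specialize (Hw z Hzd).
        pose proof (Cmod_sub_le (bprod l xi) (bprod l z)) as H3. rewrite Cmod_minus_sym, bprod_circle in H3 by assumption.
        rewrite Cmod_div by now apply Cmod_gt_0', HBG0. rewrite Cmod_pow.
        assert (Cmod (b z) ^ N <= 1).
        { rewrite <- (pow1 N). apply pow_incr. split; [apply Cmod_ge_0|]. apply (proj2 Hb), (proj1 Gz). }
        specialize (HBG0 z Gz). apply Rmult_le_reg_r with (Cmod (bprod l z)); [exact HBG0|].
        unfold Rdiv. rewrite Rmult_assoc, Rinv_l, Rmult_1_r by lra.
        apply Rle_trans with 1; [assumption|]. nra. }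
  rewrite Cmod_div, Cmod_pow in HM by now apply Cmod_gt_0', HBG0.
  assert (Hle : Cmod (b a) ^ N <= Cmod (bprod l a)).
  { specialize (HBG0 a HGa). replace (Cmod (b a) ^ N) with (Cmod (b a) ^ N / Cmod (bprod l a) * Cmod (bprod l a)) by (field; lra). nra. }
  pose proof (Cmod_ge_0 (b a)) as Hba0. assert (Hba1 := proj2 Hb a Ha).
  assert (Hle2 : Cmod (b a) ^ (N * 2) <= exp (- sumf (phX a) l)).
  { rewrite pow_mult. eapply Rle_trans; [|now apply bprod_upper]. apply pow_incr. split; [apply pow_le; lra|exact Hle]. }
  set (dl := 1 - Cmod a) in *. assert (Hdl : 0 < dl) by (unfold dl; lra).
  (* Seen from [a], every denominator is at most [4 * r], so each term is at least
     [dl * (1 - |zeta|) / (16 * r^2)]; the depths add up to at least [r / 2]. *)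
  assert (Hsum : dl / (32 * r) <= sumf (phX a) l).
  { apply Rle_trans with (sumf (fun zeta => dl / (16 * r ^ 2) * (1 - Cmod zeta)) l).
    - rewrite sumf_scal. apply Rle_trans with (dl / (16 * r ^ 2) * (r / 2)); [right; field; lra|].
      apply Rmult_le_compat_l; [|exact HY]. apply Rdiv_le_0_compat; [lra|]. assert (0 < r ^ 2) by (apply pow_lt; lra). lra.
    - apply sumf_le. intros zeta Hin. assert (Hz1 := Hl1 zeta Hin). destruct (Hl zeta Hin) as [_ Hd].
      assert (Hden := blaschke_den zeta a Hz1 ltac:(lra)).
      assert (Hm : Cmod (1 - Cconj zeta * a) <= 4 * r).
      { pose proof (Cmod_1_conj_upper a zeta ltac:(lra)) as Hup.
        replace (Cmod (1 - Cconj zeta * a)) with (Cmod (1 - Cconj a * zeta)).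
        - pose proof (Cmod_ge_0 a). unfold dl in *. nra.
        - rewrite <- Cmod_conj. f_equal. rewrite Cminus_conj, Cmult_conj, Cconj_conj.
          replace (Cconj 1) with (RtoC 1) by (unfold Cconj, RtoC; simpl; f_equal; ring). ring. }
      unfold phX. set (m := Cmod (1 - Cconj zeta * a)) in *.
      pose proof (Cmod_ge_0 a). pose proof (Cmod_ge_0 zeta).
      replace (dl / (16 * r ^ 2) * (1 - Cmod zeta)) with (dl * (1 - Cmod zeta) * / (4 * r) ^ 2) by (field; lra).
      apply Rmult_le_compat.
      + apply Rmult_le_pos; lra.
      + left. apply Rinv_0_lt_compat, pow_lt. lra.
      + apply Rmult_le_compat; [lra|lra|unfold dl; nra|nra].
      + apply Rinv_le_contravar; [now apply pow_lt|]. apply pow_incr. lra. }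
  set (x := dl / (32 * r)) in *.
  assert (Hx : 0 < x <= 1).
  { split; [apply Rdiv_lt_0_compat; lra|]. apply Rmult_le_reg_r with (32 * r); [lra|].
    unfold x. replace (dl / (32 * r) * (32 * r)) with dl by (field; lra). lra. }
  assert (Hexp : exp (- sumf (phX a) l) <= 1 - x / 2).
  { apply Rle_trans with (exp (- x)); [apply exp_le_compat; lra|]. rewrite exp_Ropp.
    pose proof (exp_ineq1_le x). apply Rle_trans with (/ (1 + x)); [apply Rinv_le_contravar; lra|].
    apply Rmult_le_reg_r with (1 + x); [lra|]. rewrite Rinv_l by lra. nra. }
  (* [1 - 2 N (1 - |b a|) <= |b a|^(2 N) <= 1 - x / 2] gives [1 - |b a| >= x / (4 N)]; with
     [x = dl / (32 * r)] this is where 128 comes from. *)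
  assert (Hbern := bernoulli_le (Cmod (b a)) (N * 2) ltac:(lra)).
  rewrite mult_INR in Hbern. simpl (INR 2) in Hbern.
  replace (/ (128 * INR N) * dl / r) with (x / (4 * INR N)) by (unfold x; field; lra).
  apply Rmult_le_reg_r with (4 * INR N); [lra|].
  replace (x / (4 * INR N) * (4 * INR N)) with x by (field; lra). lra.
Qed.

(** * Lipschitz bound away from the level set *)

Lemma connected_avoids_ball (S : C -> Prop) (a : C) (r rho : R) : connected_C S -> r <= rho ->
  (forall z, S z -> Cmod (z - a) <> rho) -> (exists z, S z /\ rho < Cmod (z - a)) ->
  forall z, S z -> r <= Cmod (z - a).
Proof.
  intros Hcon Hr Hrho Hout z Sz. apply Rnot_lt_le. intros Hlt.
  apply (Hcon (fun z => Cmod (z - a) < rho) (fun z => rho < Cmod (z - a))).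
  - apply open_Cmod_lt.
  - apply open_Cmod_gt.
  - intros w Sw. specialize (Hrho w Sw). destruct (Rlt_or_le (Cmod (w - a)) rho); [now left|right; lra].
  - intros w _ H1 H2. lra.
  - exists z. split; [exact Sz|lra].
  - exact Hout.
Qed.

(* Strong minimum principle: propagate [|c / b| < 1] from [a] to [w] along the segment by Schwarz-Pick. *)
Lemma strict_lower (b : C -> C) (a : C) (r c : R) : self_map b -> Cmod a < 1 -> 0 < c ->
  (forall z, Cmod z < 1 -> Cmod (z - a) < r -> c <= Cmod (b z)) -> c < Cmod (b a) ->
  forall w, Cmod w < 1 -> Cmod (w - a) < r -> c < Cmod (b w).
Proof.
  intros Hb Ha Hc Hlow Hca w Hw Hwr.
  (* A radius that works at every point of the segment from [a] to [w]: by convexity the ball of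
     radius [s] stays in the unit disc and in the disc about [a]. Steps shorter than [s] then reach
     [w]. *)
  set (s := Rmin (r - Cmod (w - a)) (Rmin (1 - Cmod a) (1 - Cmod w))).
  assert (Hs : 0 < s) by (repeat apply Rmin_glb_lt; lra).
  assert (s <= r - Cmod (w - a) /\ s <= 1 - Cmod a /\ s <= 1 - Cmod w) as [S1 [S2 S3]].
  { split; [apply Rmin_l|]. split; (eapply Rle_trans; [apply Rmin_r|]); [apply Rmin_l|apply Rmin_r]. }
  clearbody s.
  destruct (INR_unbounded (Cmod (w - a) / s)) as [n Hn].
  pose proof (Cmod_ge_0 (w - a)) as Hwa.
  assert (Hn0 : 0 < INR n).
  { apply Rle_lt_trans with (Cmod (w - a) / s); [|exact Hn]. apply Rdiv_le_0_compat; lra. }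
  assert (Hstep : Cmod (w - a) / INR n < s).
  { apply Rmult_lt_reg_r with (INR n); [lra|]. replace (Cmod (w - a) / INR n * INR n) with (Cmod (w - a)) by (field; lra).
    apply Rmult_lt_compat_r with (r := s) in Hn; [|lra].
    replace (Cmod (w - a) / s * s) with (Cmod (w - a)) in Hn by (field; lra). lra. }
  set (p := fun k : nat => (a + RtoC (INR k / INR n) * (w - a))%C).
  assert (Hp : forall k, (k <= n)%nat -> forall z, Cmod (z - p k) < s -> Cmod z < 1 /\ Cmod (z - a) < r).
  { intros k Hk z Hz. set (t := INR k / INR n) in *.
    assert (Ht : 0 <= t <= 1).
    { assert (0 <= INR k) by apply pos_INR. assert (INR k <= INR n) by (apply le_INR; exact Hk). split.
      - apply Rdiv_le_0_compat; lra.
      - apply Rmult_le_reg_r with (INR n); [lra|]. unfold t. replace (INR k / INR n * INR n) with (INR k) by (field; lra). lra. }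
    assert (H1 : Cmod (p k - a) <= Cmod (w - a)).
    { unfold p. fold t. replace (a + t * (w - a) - a)%C with (t * (w - a))%C by ring.
      rewrite Cmod_mult, Cmod_R, Rabs_pos_eq by lra. nra. }
    assert (H2 : Cmod (p k) <= (1 - t) * Cmod a + t * Cmod w).
    { unfold p. fold t. replace (a + t * (w - a))%C with (RtoC (1 - t) * a + t * w)%C by (rewrite RtoC_minus; ring).
      eapply Rle_trans; [apply Cmod_triangle|]. rewrite !Cmod_mult, !Cmod_R, !Rabs_pos_eq; lra. }
    split.
    - pose proof (Cmod_sub_le z (p k)). nra.
    - replace (z - a)%C with ((z - p k) + (p k - a))%C by ring. eapply Rle_lt_trans; [apply Cmod_triangle|]. lra. }
  assert (Hk : forall k, (k <= n)%nat -> c < Cmod (b (p k))).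
  { induction k as [|k IH]; intros Hk.
    - unfold p. simpl. replace (a + RtoC (0 / INR n) * (w - a))%C with a; [exact Hca|].
      replace (0 / INR n) with 0 by (field; lra). ring.
    - specialize (IH ltac:(lia)).
      assert (Hbig : forall z, Cmod (z - p k) < s -> c <= Cmod (b z)).
      { intros z Hz. destruct (Hp k ltac:(lia) z Hz). now apply Hlow. }
      assert (Hmod : forall z, Cmod (z - p k) < s -> Cmod (c / b z) = c / Cmod (b z)).
      { intros z Hz. specialize (Hbig z Hz). rewrite Cmod_div by (apply Cmod_gt_0'; lra).
        rewrite Cmod_R, Rabs_pos_eq; lra. }
      assert (Hdist : Cmod (p (S k) - p k) <= Cmod (w - a) / INR n / s * s).
      { unfold p. rewrite S_INR. replace (_ - _)%C with (RtoC (1 / INR n) * (w - a))%C.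
        - rewrite Cmod_mult, Cmod_R, Rabs_pos_eq by (apply Rdiv_le_0_compat; lra). right. field. lra.
        - replace ((INR k + 1) / INR n) with (INR k / INR n + 1 / INR n) by (field; lra). rewrite RtoC_plus. ring. }
      assert (Hds : Cmod (w - a) / INR n / s < 1).
      { apply Rmult_lt_reg_r with s; [lra|]. replace (Cmod (w - a) / INR n / s * s) with (Cmod (w - a) / INR n) by (field; lra). lra. }
      assert (Hball : Cmod (p (S k) - p k) < s).
      { eapply Rle_lt_trans; [exact Hdist|]. replace (Cmod (w - a) / INR n / s * s) with (Cmod (w - a) / INR n) by (field; lra). lra. }
      assert (Hself : Cmod (p k - p k) < s) by (rewrite Cmod_self; lra).
      assert (HS := schwarz_pick_lower (fun z => c / b z)%C (p k) s Hs).
      assert (HS1 := HS ltac:(intros z Hz; specialize (Hbig z Hz) as Hz'; apply holo_div;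
         [apply Cmod_gt_0'; lra|apply holo_const|apply (proj1 Hb); now apply (Hp k ltac:(lia) z Hz)])).
      assert (HS2 := HS1 ltac:(intros z Hz; specialize (Hbig z Hz) as Hz'; cbv beta; rewrite Hmod by exact Hz;
         apply Rmult_le_reg_r with (Cmod (b z)); [lra|]; unfold Rdiv; rewrite Rmult_assoc, Rinv_l; lra)).
      assert (HS3 := HS2 (p (S k)) _ Hball Hdist ltac:(lra)). clear HS HS1 HS2. cbv beta in HS3.
      rewrite !Hmod in HS3 by assumption.
      set (sg := Cmod (w - a) / INR n / s) in *.
      assert (Hsg0 : 0 <= sg).
      { unfold sg. apply Rdiv_le_0_compat; [apply Rdiv_le_0_compat; lra|lra]. }
      assert (H1 : 0 < 1 - c / Cmod (b (p k))).
      { assert (c / Cmod (b (p k)) < 1); [|lra]. apply Rmult_lt_reg_r with (Cmod (b (p k))); [lra|].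
        replace (c / Cmod (b (p k)) * Cmod (b (p k))) with c by (field; lra). lra. }
      assert (H2 : 0 < (1 - sg ^ 2) * (1 - c / Cmod (b (p k))) ^ 2) by (apply Rmult_lt_0_compat; [nra|now apply pow_lt]).
      assert (H3 := Hbig _ Hball).
      apply Rnot_le_lt. intros H4. assert (E : Cmod (b (p (S k))) = c) by lra. rewrite E in HS3.
      replace (c / c) with 1 in HS3 by (field; lra). lra. }
  specialize (Hk n (Nat.le_refl n)). unfold p in Hk.
  replace (a + RtoC (INR n / INR n) * (w - a))%C with w in Hk; [exact Hk|].
  replace (INR n / INR n) with 1 by (field; lra). ring.
Qed.

(* Barrier [(s / (z - q))^(2 M) / b] with [q] outside the disc, the circle of centre [q] and radius [s]
   being tangent to the unit circle at the radial projection of [z1]. *)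
Lemma barrier (b : C -> C) (a : C) (r c : R) (M : nat) : self_map b -> 0 < r <= 1 -> 0 < c -> (1 / 2) ^ M <= c ->
  (forall z, Cmod z < 1 -> Cmod (z - a) < r -> c < Cmod (b z)) ->
  (forall xi, Cmod xi = 1 -> Cmod (xi - a) < r -> ~ spec b xi) ->
  forall z1, Cmod z1 < 1 -> Cmod (z1 - a) < r / 2 -> 1 - Cmod z1 < r / 8 ->
    1 - Cmod (b z1) <= 8 * INR M * (1 - Cmod z1) / r.
Proof.
  intros Hb Hr Hc HM Hlow Hns z1 Hz1 Hz1a Hh.
  assert (Hm0 : 0 < Cmod z1) by lra.
  assert (Hm0' : RtoC (Cmod z1) <> 0) by (intros E; apply (RtoC_inj _ 0) in E; lra).
  set (zs := (z1 / Cmod z1)%C).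
  assert (Hzs : Cmod zs = 1).
  { unfold zs. rewrite Cmod_div, Cmod_R, Rabs_pos_eq by (assumption || lra). field. lra. }
  assert (Ez1 : z1 = (Cmod z1 * zs)%C) by (unfold zs; field; exact Hm0').
  assert (Hd1 : Cmod (z1 - zs) = 1 - Cmod z1).
  { replace (z1 - zs)%C with (RtoC (Cmod z1 - 1) * zs)%C by (rewrite RtoC_minus; rewrite Ez1 at 2; ring).
    rewrite Cmod_mult, Hzs, Cmod_R, Rabs_left; lra. }
  (* The comparison domain has radius [3 * r / 8] about [zs]: adding [r / 8] and [r / 2] to get to
     [a] gives [r], and leaving [r / 8] near its rim still gives [|z - zs| >= s]. *)
  set (s := r / 4). set (q := (RtoC (1 + s) * zs)%C).
  assert (Hq : Cmod q = 1 + s) by (unfold q; rewrite Cmod_mult, Hzs, Cmod_R, Rabs_pos_eq; unfold s; lra).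
  assert (Hzq : forall z, Cmod z < 1 -> s < Cmod (z - q)).
  { intros z Hz. pose proof (Cmod_sub_le q z) as H. rewrite Cmod_minus_sym in H. lra. }
  (* In the disc the angle at [zs] is obtuse. At distance at least [s] from [zs] the squared ratio
     [s / |z - q|] is at most 1/2, so its [M]-th power is at most [c], hence below [|b|]. *)
  assert (Hzq2 : forall z, Cmod z < 1 -> s ^ 2 + Cmod (z - zs) ^ 2 <= Cmod (z - q) ^ 2).
  { intros z Hz. pose proof (re_le_Cmod (Cconj zs * z)) as H. rewrite Cmod_mult, Cmod_conj, Hzs in H.
    apply Rabs_le_between in H. pose proof (Cmod2_alt zs) as E. rewrite Hzs in E.
    assert (E2 : Cmod (z - q) ^ 2 = s ^ 2 * Cmod zs ^ 2 + Cmod (z - zs) ^ 2 - 2 * s * (Re (Cconj zs * z)%C - Cmod zs ^ 2)).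
    { rewrite !Cmod2_alt. unfold q, Re, Im; simpl. ring. }
    rewrite E2, Hzs. assert (0 < s) by (unfold s; lra). nra. }
  set (g := fun z => ((s / (z - q)) ^ (2 * M) / b z)%C).
  assert (Hin : forall z, Cmod (z - zs) < 3 * r / 8 -> Cmod (z - a) < r).
  { intros z Hz. replace (z - a)%C with ((z - zs) + (- (z1 - zs) + (z1 - a)))%C by ring.
    eapply Rle_lt_trans; [apply Cmod_triangle|].
    assert (Cmod (- (z1 - zs) + (z1 - a)) <= r / 8 + r / 2); [|lra].
    eapply Rle_trans; [apply Cmod_triangle|]. rewrite Cmod_opp, Hd1. lra. }
  assert (Hgmod : forall z, Cmod z < 1 -> Cmod (z - a) < r -> Cmod (g z) = (s / Cmod (z - q)) ^ (2 * M) / Cmod (b z)).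
  { intros z Hz Hza. specialize (Hlow z Hz Hza). specialize (Hzq z Hz). unfold g.
    rewrite Cmod_div by (apply Cmod_gt_0'; lra). rewrite Cmod_pow, Cmod_div by (apply Cmod_gt_0'; unfold s in *; lra).
    rewrite Cmod_R, Rabs_pos_eq by (unfold s; lra). reflexivity. }
  assert (Hratio : forall z, Cmod z < 1 -> 0 <= s / Cmod (z - q) <= 1).
  { intros z Hz. specialize (Hzq z Hz). assert (0 < s) by (unfold s; lra). split; [apply Rdiv_le_0_compat; lra|].
    apply Rmult_le_reg_r with (Cmod (z - q)); [lra|]. replace (s / Cmod (z - q) * Cmod (z - q)) with s by (field; lra). lra. }
  assert (Hg1 : Cmod (g z1) <= 1).
  { apply (max_modulus (fun z => Cmod z < 1 /\ Cmod (z - zs) < 3 * r / 8) g 1); [lra|now intros z [? _]| | | |].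
    - intros z [Hz Hzz]. exists (Rmin (1 - Cmod z) (3 * r / 8 - Cmod (z - zs))). split; [apply Rmin_glb_lt; lra|].
      intros w Hw. pose proof (Rmin_l (1 - Cmod z) (3 * r / 8 - Cmod (z - zs))). pose proof (Rmin_r (1 - Cmod z) (3 * r / 8 - Cmod (z - zs))).
      split; [pose proof (Cmod_sub_le w z); lra|].
      replace (w - zs)%C with ((w - z) + (z - zs))%C by ring. eapply Rle_lt_trans; [apply Cmod_triangle|]. lra.
    - intros z [Hz Hzz]. specialize (Hlow z Hz (Hin z Hzz)). specialize (Hzq z Hz). unfold g. apply holo_div.
      + apply Cmod_gt_0'; lra.
      + apply (holo_pow (fun z => s / (z - q))%C). apply holo_div; [apply Cmod_gt_0'; unfold s in *; lra|apply holo_const|].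
        apply holo_minus; [apply holo_id|apply holo_const].
      + now apply (proj1 Hb).
    - intros xi Hxi eps He. destruct (Rlt_or_le (Cmod (xi - zs)) (3 * r / 8)) as [Hlt|Hge].
      + assert (Hx1 : 1 <= Cmod xi) by (apply Rnot_lt_le; intros H; apply Hxi; now split).
        destruct (Rle_lt_or_eq_dec _ _ Hx1) as [Hgt|Heq].
        { exists (Cmod xi - 1). split; [lra|]. intros z [Hz _] Hzd. pose proof (Cmod_sub_le xi z) as H.
          rewrite Cmod_minus_sym in H. lra. }
        symmetry in Heq. set (e := Rmin (1 / 2) (eps / 2)).
        assert (He0 : 0 < e) by (apply Rmin_glb_lt; lra).
        pose proof (Rmin_l (1 / 2) (eps / 2)) as E1. pose proof (Rmin_r (1 / 2) (eps / 2)) as E2. fold e in E1, E2.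
        destruct (not_spec_near_1 b xi Heq (Hns xi Heq (Hin xi Hlt)) e He0) as [d [Hd Hw]].
        exists d. split; [exact Hd|]. intros z [Hz Hzz] Hzd. specialize (Hw z Hz Hzd).
        rewrite Hgmod by auto. assert (Hp : (s / Cmod (z - q)) ^ (2 * M) <= 1).
        { rewrite <- (pow1 (2 * M)). apply pow_incr. now apply Hratio. }
        apply Rmult_le_reg_r with (Cmod (b z)); [lra|].
        replace ((s / Cmod (z - q)) ^ (2 * M) / Cmod (b z) * Cmod (b z)) with ((s / Cmod (z - q)) ^ (2 * M)).
        2:{ field. lra. }
        apply Rle_trans with 1; [assumption|]. nra.
      + exists (r / 8). split; [lra|]. intros z [Hz Hzz] Hzd.
        assert (Hfar : s <= Cmod (z - zs)).
        { pose proof (Cmod_triangle (xi - z) (z - zs)) as HT. replace (xi - z + (z - zs))%C with (xi - zs)%C in HT by ring.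
          rewrite (Cmod_minus_sym xi z) in HT. unfold s. lra. }
        rewrite Hgmod by auto. specialize (Hlow z Hz (Hin z Hzz)).
        specialize (Hzq2 z Hz). specialize (Hzq z Hz). assert (Hs0 : 0 < s) by (unfold s; lra).
        assert (Hs2 : 0 <= (s / Cmod (z - q)) ^ 2 <= 1 / 2).
        { split; [apply pow2_ge_0|]. unfold Rdiv. rewrite Rpow_mult_distr, pow_inv.
          apply Rmult_le_reg_r with (Cmod (z - q) ^ 2); [apply pow_lt; lra|].
          rewrite Rmult_assoc, Rinv_l by (apply pow_nonzero; lra).
          assert (s ^ 2 <= Cmod (z - zs) ^ 2) by (apply pow_incr; lra). lra. }
        assert (Hp : (s / Cmod (z - q)) ^ (2 * M) <= c).
        { rewrite pow_mult. eapply Rle_trans; [|exact HM]. now apply pow_incr. }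
        apply Rle_trans with 1; [|lra]. apply Rmult_le_reg_r with (Cmod (b z)); [lra|].
        replace ((s / Cmod (z - q)) ^ (2 * M) / Cmod (b z) * Cmod (b z)) with ((s / Cmod (z - q)) ^ (2 * M)).
        2:{ field. lra. }
        lra.
    - split; [exact Hz1|]. rewrite Hd1. lra. }
  rewrite Hgmod in Hg1 by (assumption || lra).
  set (h := 1 - Cmod z1) in *. assert (Hh0 : 0 < h) by (unfold h; lra).
  assert (Ezq : Cmod (z1 - q) = s + h).
  { replace (z1 - q)%C with (RtoC (Cmod z1 - (1 + s)) * zs)%C by (unfold q; rewrite RtoC_minus; rewrite Ez1 at 2; ring).
    rewrite Cmod_mult, Hzs, Cmod_R, Rabs_left; unfold h, s; lra. }
  rewrite Ezq in Hg1. specialize (Hlow z1 Hz1 ltac:(lra)).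
  assert (Hs0 : 0 < s) by (unfold s; lra).
  assert (Hbz : (s / (s + h)) ^ (2 * M) <= Cmod (b z1)).
  { replace ((s / (s + h)) ^ (2 * M)) with ((s / (s + h)) ^ (2 * M) / Cmod (b z1) * Cmod (b z1)) by (field; lra).
    nra. }
  assert (Hu : 0 <= s / (s + h) <= 1).
  { split; [apply Rdiv_le_0_compat; lra|]. apply Rmult_le_reg_r with (s + h); [lra|].
    replace (s / (s + h) * (s + h)) with s by (field; lra). lra. }
  assert (HB := bernoulli_le (s / (s + h)) (2 * M) Hu). rewrite mult_INR in HB. simpl (INR 2) in HB.
  assert (H1u : 1 - s / (s + h) <= h / s).
  { replace (1 - s / (s + h)) with (h / (s + h)) by (field; lra). apply Rmult_le_compat_l; [lra|]. apply Rinv_le_contravar; lra. }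
  assert (HMp := pos_INR M).
  replace (8 * INR M * h / r) with (2 * INR M * (h / s)) by (unfold s; field; lra).
  assert (2 * INR M * (1 - s / (s + h)) <= 2 * INR M * (h / s)) by (apply Rmult_le_compat_l; lra).
  lra.
Qed.

Lemma is_derive_re_line (b : C -> C) (w p v l : C) (t : R) : cder b (p + t * v)%C l ->
  is_derive (fun t : R => Re (w * b (p + t * v))%C) t (Re (w * (l * v))%C).
Proof.
  intros H. apply is_derive_Reals. intros eps He.
  pose proof (Cmod_ge_0 w). pose proof (Cmod_ge_0 v).
  set (K := (Cmod w + 1) * (Cmod v + 1)).
  assert (HK : 0 < K) by (unfold K; apply Rmult_lt_0_compat; lra).
  destruct (H (eps / (2 * K))) as [d [Hd Hw]]; [apply Rdiv_lt_0_compat; lra|].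
  assert (Hd2 : 0 < d / (Cmod v + 1)) by (apply Rdiv_lt_0_compat; lra).
  exists (mkposreal _ Hd2). intros h Hh0 Hh. simpl in Hh.
  assert (Eh : (p + RtoC (t + h) * v - (p + t * v))%C = (h * v)%C) by (rewrite RtoC_plus; ring).
  specialize (Hw (p + RtoC (t + h) * v)%C). rewrite Eh, Cmod_mult, Cmod_R in Hw.
  pose proof (Rabs_pos_lt h Hh0) as Hhp.
  assert (Hhv : Rabs h * Cmod v < d).
  { apply Rle_lt_trans with (Rabs h * (Cmod v + 1)); [apply Rmult_le_compat_l; lra|].
    apply Rlt_le_trans with (d / (Cmod v + 1) * (Cmod v + 1)); [apply Rmult_lt_compat_r; lra|right; field; lra]. }
  specialize (Hw Hhv).
  set (X := (b (p + RtoC (t + h) * v) - b (p + t * v) - l * (h * v))%C) in *.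
  assert (EX : Re (w * b (p + RtoC (t + h) * v))%C - Re (w * b (p + t * v))%C = h * Re (w * (l * v))%C + Re (w * X)%C).
  { unfold X, Re; simpl. ring. }
  rewrite EX. replace ((h * Re (w * (l * v))%C + Re (w * X)%C) / h - Re (w * (l * v))%C) with (Re (w * X)%C / h) by (field; exact Hh0).
  unfold Rdiv. rewrite Rabs_mult, Rabs_inv.
  apply Rmult_lt_reg_r with (Rabs h); [lra|]. rewrite Rmult_assoc, Rinv_l, Rmult_1_r by lra.
  eapply Rle_lt_trans; [apply re_le_Cmod|]. rewrite Cmod_mult.
  assert (H2 : Cmod w * Cmod X <= Cmod w * (eps / (2 * K) * (Rabs h * Cmod v))) by (apply Rmult_le_compat_l; lra).
  assert (H3 : Cmod w * (eps / (2 * K) * (Rabs h * Cmod v)) = (eps / (2 * K) * Rabs h) * (Cmod w * Cmod v)) by ring.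
  assert (H4 : Cmod w * Cmod v <= K) by (unfold K; nra).
  assert (Hq : 0 < eps / (2 * K) * Rabs h) by (apply Rmult_lt_0_compat; [apply Rdiv_lt_0_compat; lra|lra]).
  assert (H5 : (eps / (2 * K) * Rabs h) * (Cmod w * Cmod v) <= (eps / (2 * K) * Rabs h) * K) by (apply Rmult_le_compat_l; lra).
  assert (H6 : (eps / (2 * K) * Rabs h) * K = eps / 2 * Rabs h) by (field; lra).
  nra.
Qed.

(** The real mean value theorem is applied after rotation by the unimodular [w] that makes
    [b z - b a] positive. *)
Lemma segment_lipschitz (b : C -> C) (a z : C) (D : R) :
  (forall t : R, 0 <= t <= 1 -> exists l, cder b (a + t * (z - a))%C l /\ Cmod l <= D) ->
  Cmod (b z - b a) <= D * Cmod (z - a).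
Proof.
  intros H. set (v := (z - a)%C) in *. set (m := Cmod (b z - b a)).
  assert (HD : 0 <= D).
  { destruct (H 0 ltac:(lra)) as [l [_ Hl]]. pose proof (Cmod_ge_0 l). lra. }
  destruct (Req_dec m 0) as [E|Hm]; [rewrite E; apply Rmult_le_pos; [exact HD|apply Cmod_ge_0]|].
  assert (Hm0 : 0 < m) by (pose proof (Cmod_ge_0 (b z - b a)); fold m in H0; lra).
  set (w := (Cconj (b z - b a) / m)%C).
  assert (Hmc : RtoC m <> 0) by (intros E; apply (RtoC_inj _ 0) in E; lra).
  assert (Hw : Cmod w = 1).
  { unfold w. rewrite Cmod_div, Cmod_conj, Cmod_R, Rabs_pos_eq by (assumption || lra). fold m. field. lra. }
  set (f := fun t : R => Re (w * b (a + t * v))%C).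
  assert (Hf : forall t, 0 <= t <= 1 -> ex_derive f t /\ Rabs (Derive f t) <= D * Cmod v).
  { intros t Ht. destruct (H t Ht) as [l [Hl HlD]].
    assert (Hd := is_derive_re_line b w a v l t Hl). split; [eexists; exact Hd|].
    rewrite (is_derive_unique f t _ Hd). eapply Rle_trans; [apply re_le_Cmod|].
    rewrite !Cmod_mult, Hw, Rmult_1_l. apply Rmult_le_compat_r; [apply Cmod_ge_0|exact HlD]. }
  destruct (MVT_gen f 0 1 (Derive f)) as [t [Ht E]].
  - intros t Ht. rewrite Rmin_left, Rmax_right in Ht by lra. apply Derive_correct, Hf; lra.
  - intros t Ht. rewrite Rmin_left, Rmax_right in Ht by lra. destruct (Hf t Ht) as [[l Hl] _].
    apply derivable_continuous_pt. exists l. now apply is_derive_Reals.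
  - rewrite Rmin_left, Rmax_right in Ht by lra. destruct (Hf t Ht) as [_ Hb].
    assert (E1 : f 1 - f 0 = m).
    { unfold f. replace (a + 1 * v)%C with z by (unfold v; ring). replace (a + 0 * v)%C with a by ring.
      replace (Re (w * b z)%C - Re (w * b a)%C) with (Re (w * (b z - b a))%C) by (unfold Re; simpl; ring).
      unfold w. replace (Cconj (b z - b a) / m * (b z - b a))%C with (RtoC m).
      - reflexivity.
      - replace (Cconj (b z - b a) / m * (b z - b a))%C with ((b z - b a) * Cconj (b z - b a) / m)%C by (field; exact Hmc).
        rewrite <- Cmod2_conj. fold m. rewrite RtoC_pow. field. exact Hmc. }
    rewrite E1 in E. rewrite E. rewrite Rminus_0_r, Rmult_1_r. eapply Rle_trans; [apply Rle_abs|exact Hb].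
Qed.

(** Beyond [r / 2] the bound [|b z - b a| <= 2] is enough. Closer, the derivative is at most
    [(1 - |b|^2) / (1 - |z1|)]: within [r / 8] of the circle [barrier] controls the numerator,
    deeper inside the denominator does. *)
Lemma lipschitz_of_free (b : C -> C) (a : C) (r c : R) (M : nat) :
  self_map b -> Cmod a < 1 -> 0 < r <= 1 -> 0 < c -> (1 / 2) ^ M <= c ->
  (forall z, Cmod z < 1 -> Cmod (z - a) < r -> c < Cmod (b z)) ->
  (forall xi, Cmod xi = 1 -> Cmod (xi - a) < r -> ~ spec b xi) ->
  forall z, Cmod z < 1 -> Cmod (b z - b a) <= (16 * INR M + 8) / r * Cmod (z - a).
Proof.
  intros Hb Ha Hr Hc HM Hlow Hns z Hz. assert (HMp := pos_INR M).
  pose proof (Cmod_ge_0 (z - a)) as Hza.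
  destruct (Rle_or_lt (r / 2) (Cmod (z - a))) as [Hfar|Hnear].
  - assert (H2 : Cmod (b z - b a) <= 2).
    { unfold Cminus. eapply Rle_trans; [apply Cmod_triangle|]. rewrite Cmod_opp.
      pose proof (proj2 Hb z Hz). pose proof (proj2 Hb a Ha). lra. }
    apply Rle_trans with (8 / r * (r / 2)); [replace (8 / r * (r / 2)) with 4 by (field; lra); lra|].
    apply Rmult_le_compat; [apply Rdiv_le_0_compat; lra|lra| |lra].
    apply Rmult_le_compat_r; [left; apply Rinv_0_lt_compat; lra|lra].
  - apply segment_lipschitz. intros t Ht. set (z1 := (a + t * (z - a))%C).
    assert (Hz1a : Cmod (z1 - a) < r / 2).
    { unfold z1. replace (a + t * (z - a) - a)%C with (t * (z - a))%C by ring.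
      rewrite Cmod_mult, Cmod_R, Rabs_pos_eq by lra. nra. }
    assert (Hz1 : Cmod z1 < 1).
    { unfold z1. replace (a + t * (z - a))%C with (RtoC (1 - t) * a + t * z)%C by (rewrite RtoC_minus; ring).
      eapply Rle_lt_trans; [apply Cmod_triangle|]. rewrite !Cmod_mult, !Cmod_R, !Rabs_pos_eq by lra.
      destruct (Rle_or_lt t (1 / 2)); nra. }
    destruct (proj1 Hb z1 Hz1) as [l Hl]. exists l. split; [exact Hl|].
    assert (Hball : forall w, Cmod (w - z1) < 1 - Cmod z1 -> Cmod w < 1).
    { intros w Hw. pose proof (Cmod_sub_le w z1). lra. }
    assert (HS := schwarz_pick_deriv b z1 l (1 - Cmod z1) ltac:(lra)
      ltac:(intros w Hw; apply (proj1 Hb); auto) ltac:(intros w Hw; apply (proj2 Hb); auto) Hl).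
    set (h := 1 - Cmod z1) in *. assert (Hh : 0 < h) by (unfold h; lra).
    assert (Hbz := proj2 Hb z1 Hz1). pose proof (Cmod_ge_0 (b z1)).
    apply Rmult_le_reg_r with h; [exact Hh|]. eapply Rle_trans; [exact HS|].
    destruct (Rlt_or_le h (r / 8)) as [Hs|Hl8].
    + assert (HB := barrier b a r c M Hb Hr Hc HM Hlow Hns z1 Hz1 Hz1a Hs). fold h in HB.
      apply Rle_trans with (2 * (8 * INR M * h / r)); [nra|].
      replace (2 * (8 * INR M * h / r)) with (16 * INR M / r * h) by (field; lra).
      apply Rmult_le_compat_r; [lra|]. apply Rmult_le_compat_r; [left; apply Rinv_0_lt_compat; lra|lra].
    + apply Rle_trans with (8 / r * (r / 8)).
      * replace (8 / r * (r / 8)) with 1 by (field; lra). nra.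
      * apply Rmult_le_compat; [apply Rdiv_le_0_compat; lra|lra| |lra].
        apply Rmult_le_compat_r; [left; apply Rinv_0_lt_compat; lra|lra].
Qed.

(** The numerator is at most [(1 - |b a|^2) + |b z - b a|], and the denominator dominates both
    [1 - |a|] and [|z - a|]. *)
Lemma kernel_le_of_lipschitz (b : C -> C) (a : C) (L : R) : self_map b -> Cmod a < 1 -> 0 <= L ->
  (forall z, Cmod z < 1 -> Cmod (b z - b a) <= L * Cmod (z - a)) ->
  forall z, Cmod z < 1 -> Cmod ((1 - Cconj (b a) * b z) / (1 - Cconj a * z)) <= (1 - Cmod (b a) ^ 2) / (1 - Cmod a) + L.
Proof.
  intros Hb Ha HL Hlip z Hz.
  assert (Hden := blaschke_den a z Ha ltac:(lra)). rewrite Cmod_div by now apply Cmod_gt_0'.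
  assert (Hba := proj2 Hb a Ha). pose proof (Cmod_ge_0 (b a)).
  assert (Hup := Cmod_1_conj_upper (b a) (b z) Hba).
  assert (D1 : 1 - Cmod a <= Cmod (1 - Cconj a * z)) by (apply Cmod_1_conj_lower; lra).
  assert (D2 : Cmod (z - a) <= Cmod (1 - Cconj a * z)) by (apply Cmod_1_conj_ge; lra).
  set (m := Cmod (1 - Cconj a * z)) in *. specialize (Hlip z Hz).
  apply Rmult_le_reg_r with m; [lra|].
  match goal with |- ?X / m * m <= _ => replace (X / m * m) with X by (field; lra) end.
  eapply Rle_trans; [exact Hup|].
  assert (L * Cmod (z - a) <= L * m) by (apply Rmult_le_compat_l; lra).
  assert (1 - Cmod (b a) ^ 2 <= (1 - Cmod (b a) ^ 2) / (1 - Cmod a) * m).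
  { apply Rle_trans with ((1 - Cmod (b a) ^ 2) / (1 - Cmod a) * (1 - Cmod a)); [right; field; lra|].
    apply Rmult_le_compat_l; [|lra]. apply Rdiv_le_0_compat; [nra|lra]. }
  lra.
Qed.

Lemma kernel_le_trivial (b : C -> C) (a : C) : self_map b -> Cmod a < 1 ->
  forall z, Cmod z < 1 -> Cmod ((1 - Cconj (b a) * b z) / (1 - Cconj a * z)) <= 2 / (1 - Cmod a).
Proof.
  intros Hb Ha z Hz.
  assert (Hden := blaschke_den a z Ha ltac:(lra)). rewrite Cmod_div by now apply Cmod_gt_0'.
  assert (D1 : 1 - Cmod a <= Cmod (1 - Cconj a * z)) by (apply Cmod_1_conj_lower; lra).
  apply Rmult_le_compat; [apply Cmod_ge_0|left; now apply Rinv_0_lt_compat| |apply Rinv_le_contravar; lra].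
  unfold Cminus. eapply Rle_trans; [apply Cmod_triangle|]. rewrite Cmod_opp, Cmod_1, Cmod_mult, Cmod_conj.
  pose proof (proj2 Hb z Hz). pose proof (proj2 Hb a Ha). pose proof (Cmod_ge_0 (b a)). pose proof (Cmod_ge_0 (b z)). nra.
Qed.

Lemma level_set_far (b : C -> C) (c : R) : self_map b -> 0 < c < 1 ->
  (forall xi, spec b xi -> closure_C (fun z => in_disc z /\ Cmod (b z) <= c) xi) ->
  connected_C (fun z => in_disc z /\ Cmod (b z) < c) ->
  exists kappa d0, 0 < kappa < 1 - c /\ 0 < d0 <= 1 /\ forall a r, Cmod a < 1 ->
    1 - Cmod a <= r -> r <= d0 / 4 -> (1 - Cmod (b a)) * r < kappa * (1 - Cmod a) ->
    (forall z, Cmod z < 1 -> Cmod (z - a) < r -> c < Cmod (b z)) /\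
    (forall xi, Cmod xi = 1 -> Cmod (xi - a) < r -> ~ spec b xi).
Proof.
  intros Hb Hc Hcl Hcon.
  destruct (harmonic_measure_lower c ltac:(lra)) as [k0 [Hk0 HHM]].
  (* The second bound yields [|b a| > c]: the smallness hypothesis and [1 - |a| <= r] give
     [1 - |b a| < kappa < 1 - c]. *)
  set (kappa := Rmin k0 ((1 - c) / 2)).
  assert (Hkap : 0 < kappa) by (apply Rmin_glb_lt; lra).
  assert (Hkap1 : kappa <= k0) by apply Rmin_l.
  assert (Hkap2 : kappa <= (1 - c) / 2) by apply Rmin_r.
  set (Om := fun z => in_disc z /\ Cmod (b z) < c) in *.
  (* [d0] is the depth of one fixed point of the level set, if there is any. As
     [|z0 - a| >= d0 - r > 2 * r], that point lies outside every circle considered. *)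
  assert (exists d0, 0 < d0 <= 1 /\ forall w, Om w -> exists z0, Om z0 /\ d0 <= 1 - Cmod z0) as [d0 [Hd0 HOm]].
  { destruct (classic (exists z0, Om z0)) as [[z0 Hz0]|Hn].
    - exists (1 - Cmod z0). split; [|intros; exists z0; split; [exact Hz0|lra]].
      destruct Hz0 as [Hz0 _]. unfold in_disc in Hz0. pose proof (Cmod_ge_0 z0). lra.
    - exists 1. split; [lra|]. intros w Hw. exfalso. apply Hn. now exists w. }
  exists kappa, d0. split; [lra|]. split; [exact Hd0|].
  intros a r Ha Har Hrd Hsmall.
  assert (Hr : 0 < r) by lra.
  assert (Hbig : forall z, Cmod z < 1 -> Cmod (z - a) < r -> c <= Cmod (b z)).
  { intros z Hz Hza. apply Rnot_lt_le. intros Hlt.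
    assert (Oz : Om z) by now split.
    destruct (HOm z Oz) as [z0 [Oz0 Hz0]].
    assert (exists rho, r <= rho <= 2 * r /\ forall w, Om w -> Cmod (w - a) <> rho) as [rho [Hrho Hfree]].
    { apply NNPP. intros Hn.
      assert (HH := HHM b a r Hb Ha Har).
      assert (HH1 : k0 * (1 - Cmod a) / r <= 1 - Cmod (b a)).
      { apply HH. intros rho Hrho. apply NNPP. intros Hn2. apply Hn. exists rho. split; [exact Hrho|].
        intros w [Hw1 Hw2] E. apply Hn2. exists w. repeat split; assumption. }
      apply Rmult_le_compat_r with (r := r) in HH1; [|lra].
      replace (k0 * (1 - Cmod a) / r * r) with (k0 * (1 - Cmod a)) in HH1 by (field; lra). nra. }
    assert (r <= Cmod (z - a)); [|lra].
    apply (connected_avoids_ball Om a r rho Hcon ltac:(lra) Hfree); [|exact Oz].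
    exists z0. split; [exact Oz0|]. pose proof (Cmod_sub_le a z0) as H. rewrite Cmod_minus_sym in H. lra. }
  assert (Hca : c < Cmod (b a)) by nra.
  (* Connectedness concerns [|b| < c], whereas the spectrum lies in the closure of [|b| <= c]; the
     strict bound closes this gap. *)
  assert (Hstrict := strict_lower b a r c Hb Ha (proj1 Hc) Hbig Hca).
  split; [exact Hstrict|].
  intros xi Hxi Hxa Hsp.
  destruct (closure_near _ _ (Hcl xi Hsp) (r - Cmod (xi - a)) ltac:(lra)) as [w [[Hw1 Hw2] Hw3]].
  assert (c < Cmod (b w)); [|lra]. apply Hstrict; [exact Hw1|].
  replace (w - a)%C with ((w - xi) + (xi - a))%C by ring. eapply Rle_lt_trans; [apply Cmod_triangle|]. lra.
Qed.

(** If [|b a|] is not close to 1, or [a] is not close to the circle, the bound [2 / (1 - |a|)] is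
    already of the right order. Otherwise the Lipschitz estimate is used at the scale [r], and the
    summands of [K] pay for the separate cases. *)
Lemma kernel_bound_of_one_component (b : C -> C) : one_component b ->
  exists K : R, 0 < K /\ forall a : C, in_disc a ->
    Rbar_le (kernel_sup b a) (Finite (K * ((1 - Cmod (b a) ^ 2) / (1 - Cmod a ^ 2)))).
Proof.
  intros [Hn [c [Hc [Hcl Hcon]]]]. assert (Hb := Hinf_self_map b Hn).
  assert (H01 : Cmod 0 < 1) by (rewrite Cmod_0; lra).
  destruct (Rle_lt_or_eq_dec _ _ (proj2 Hb 0 H01)) as [Hb0|Hb0].
  2:{ exists 1. split; [lra|]. intros a Ha. apply kernel_sup_le. intros z Hz.
      rewrite (self_map_const b Hb Hb0 z Hz), (self_map_const b Hb Hb0 a Ha).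
      rewrite Cmult_comm, <- Cmod2_conj, Hb0.
      replace ((1 - RtoC (1 ^ 2)) / (1 - Cconj a * z))%C with (0 : C).
      - rewrite Cmod_0. right. unfold Rdiv. ring.
      - replace (1 - RtoC (1 ^ 2))%C with (0 : C) by (rewrite <- RtoC_minus; f_equal; ring). unfold Cdiv. ring. }
  destruct (level_set_far b c Hb Hc Hcl Hcon) as (kappa & d0 & Hk & Hd0 & Hfar).
  destruct (pow_lt_1_zero (1 / 2)) with (y := c) as [M HM]; [rewrite Rabs_pos_eq; lra|lra|].
  specialize (HM M (Nat.le_refl M)). rewrite Rabs_pos_eq in HM by (apply pow_le; lra).
  set (k1 := (1 - Cmod (b 0)) ^ 2). assert (Hk1 : 0 < k1) by (apply pow_lt; lra).
  set (C0 := 16 * INR M + 8). assert (HC0 : 0 < C0) by (unfold C0; pose proof (pos_INR M); lra).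
  assert (Hik : 0 < / kappa) by (apply Rinv_0_lt_compat; lra).
  assert (Hid : 0 < / (d0 * k1)) by (apply Rinv_0_lt_compat, Rmult_lt_0_compat; lra).
  set (K := 2 + 8 * / kappa + 8 * / (d0 * k1) + C0 * (4 * / kappa + 4 * / (d0 * k1))).
  assert (HCk : 0 < C0 * (4 * / kappa + 4 * / (d0 * k1))) by (apply Rmult_lt_0_compat; lra).
  exists K. split; [unfold K; lra|].
  intros a Ha. unfold in_disc in Ha. apply kernel_sup_le. intros z Hz.
  pose proof (Cmod_ge_0 a) as Ha0. pose proof (Cmod_ge_0 (b a)) as Hba0.
  assert (Hba := self_map_lt_1 b Hb Hb0 a Ha).
  set (dl := 1 - Cmod a). assert (Hdl : 0 < dl) by (unfold dl; lra).
  set (E := 1 - Cmod (b a) ^ 2). set (A := 1 - Cmod a ^ 2).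
  assert (HA : 0 < A) by (unfold A; nra). assert (HE : 0 < E) by (unfold E; nra).
  assert (HAd : A <= 2 * dl) by (unfold A, dl; nra).
  assert (HEk : k1 <= E / A).
  { apply Rmult_le_reg_r with A; [lra|]. replace (E / A * A) with E by (field; lra). now apply self_map_lower. }
  set (Q := E / A) in *.
  assert (HQ : 0 < Q) by lra.
  assert (Hid' : / dl <= 2 * / A).
  { replace (2 * / A) with (/ (A / 2)) by (field; lra). apply Rinv_le_contravar; lra. }
  (* Together with [Q >= k1] this is the currency of all cases: [E / dl] and plain constants are
     both bounded by multiples of [Q]. *)
  assert (HdA : E * / dl <= 2 * Q).
  { replace (2 * Q) with (E * (2 * / A)) by (unfold Q; field; lra). apply Rmult_le_compat_l; lra. }
  assert (Hid2 : 1 <= / k1 * Q).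
  { apply Rmult_le_reg_l with k1; [lra|]. rewrite <- Rmult_assoc, Rinv_r; lra. }
  assert (Hd02 : / d0 <= / (d0 * k1) * Q).
  { replace (/ (d0 * k1) * Q) with (/ d0 * (/ k1 * Q)) by (field; lra).
    assert (0 < / d0) by (apply Rinv_0_lt_compat; lra). nra. }
  assert (HP1 : 0 < / kappa * Q) by (apply Rmult_lt_0_compat; lra).
  assert (HP2 : 0 < / (d0 * k1) * Q) by (apply Rmult_lt_0_compat; lra).
  assert (HP3 : 0 < C0 * (4 * / kappa + 4 * / (d0 * k1)) * Q) by (apply Rmult_lt_0_compat; lra).
  assert (HKQ : K * Q = 2 * Q + 8 * (/ kappa * Q) + 8 * (/ (d0 * k1) * Q) + C0 * (4 * / kappa + 4 * / (d0 * k1)) * Q)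
    by (unfold K; ring).
  rewrite HKQ.
  destruct (Rle_or_lt (kappa / 2) (1 - Cmod (b a))) as [HcA|HcA].
  { eapply Rle_trans; [now apply kernel_le_trivial|]. fold dl.
    assert (HkE : kappa / 2 <= E) by (unfold E; nra).
    assert (2 / dl <= 8 * (/ kappa * Q)); [|lra].
    apply Rle_trans with (4 * / kappa * (E * / dl)).
    - replace (4 * / kappa * (E * / dl)) with (2 * / dl * (2 * / kappa * E)) by ring. unfold Rdiv.
      assert (1 <= 2 * / kappa * E).
      { apply Rmult_le_reg_l with kappa; [lra|]. replace (kappa * (2 * / kappa * E)) with (2 * E) by (field; lra). lra. }
      assert (0 < 2 * / dl) by (apply Rmult_lt_0_compat; [lra|now apply Rinv_0_lt_compat]). nra.
    - replace (8 * (/ kappa * Q)) with (4 * / kappa * (2 * Q)) by ring. apply Rmult_le_compat_l; lra. }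
  destruct (Rle_or_lt (d0 / 4) dl) as [HcB|HcB].
  { eapply Rle_trans; [now apply kernel_le_trivial|]. fold dl.
    assert (2 / dl <= 8 * / d0); [|lra].
    replace (8 * / d0) with (2 * / (d0 / 4)) by (field; lra). unfold Rdiv at 1.
    apply Rmult_le_compat_l; [lra|]. apply Rinv_le_contravar; lra. }
  set (y := 1 - Cmod (b a)) in *. assert (Hy : 0 < y) by (unfold y; lra).
  (* The largest scale, up to the factor 2, that [level_set_far] permits; the factor makes its
     hypothesis strict, and [y < kappa / 2] ensures [dl <= r1]. *)
  set (r1 := kappa * dl / (2 * y)). set (r := Rmin r1 (d0 / 4)).
  assert (Hr1 : dl <= r1).
  { unfold r1. apply Rmult_le_reg_r with (2 * y); [lra|].
    replace (kappa * dl / (2 * y) * (2 * y)) with (kappa * dl) by (field; lra). nra. }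
  assert (Hrd : dl <= r) by (apply Rmin_glb; lra).
  assert (Hrr1 : r <= r1) by apply Rmin_l. assert (Hrd0 : r <= d0 / 4) by apply Rmin_r.
  destruct (Hfar a r Ha Hrd Hrd0) as [HF1 HF2].
  { fold y. fold dl. apply Rle_lt_trans with (y * r1); [apply Rmult_le_compat_l; lra|].
    unfold r1. replace (y * (kappa * dl / (2 * y))) with (kappa * dl / 2) by (field; lra).
    assert (0 < kappa * dl) by (apply Rmult_lt_0_compat; lra). lra. }
  assert (HL := lipschitz_of_free b a r c M Hb Ha ltac:(lra) (proj1 Hc) ltac:(lra) HF1 HF2).
  fold C0 in HL.
  eapply Rle_trans; [apply (kernel_le_of_lipschitz b a (C0 / r) Hb Ha ltac:(apply Rdiv_le_0_compat; lra) HL z Hz)|].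
  fold dl. fold E. unfold Rdiv at 1.
  assert (Hir : / r <= / r1 + / (d0 / 4)).
  { assert (0 < / r1) by (apply Rinv_0_lt_compat; lra). assert (0 < / (d0 / 4)) by (apply Rinv_0_lt_compat; lra).
    unfold r, Rmin. destruct (Rle_dec r1 (d0 / 4)); lra. }
  assert (Hir1 : / r1 <= 4 * (/ kappa * Q)).
  { replace (/ r1) with (2 * / kappa * (y * / dl)) by (unfold r1; field; lra).
    replace (4 * (/ kappa * Q)) with (2 * / kappa * (2 * Q)) by ring. apply Rmult_le_compat_l; [lra|].
    eapply Rle_trans; [|exact HdA]. apply Rmult_le_compat_r; [left; now apply Rinv_0_lt_compat|]. unfold y, E. nra. }
  assert (Hir2 : / (d0 / 4) <= 4 * (/ (d0 * k1) * Q)).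
  { replace (/ (d0 / 4)) with (4 * / d0) by (field; lra). lra. }
  assert (C0 / r <= C0 * (4 * / kappa + 4 * / (d0 * k1)) * Q).
  { replace (C0 * (4 * / kappa + 4 * / (d0 * k1)) * Q) with (C0 * (4 * (/ kappa * Q) + 4 * (/ (d0 * k1) * Q))) by ring.
    apply Rmult_le_compat_l; lra. }
  lra.
Qed.

Theorem theorem1p3 :
  (* (a) *)
  (forall b : C -> C, one_component b ->
     exists K : R, 0 < K /\
       forall a : C, in_disc a ->
         Rbar_le (kernel_sup b a)
           (Finite (K * ((1 - Cmod (b a) ^ 2) / (1 - Cmod a ^ 2))))) /\
  (* (b) *)
  (forall b : C -> C, Hinf_norm1 b ->
     (exists c : R, 0 < c < 1 /\
        forall xi, spec b xi ->
          closure_C (fun z => in_disc z /\ Cmod (b z) <= c) xi) ->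
     (forall eps : R, 0 < eps -> exists delta : R, 0 < delta /\
        forall a : C, in_disc a -> Cmod (b a) > 1 - delta ->
          Rbar_le (kernel_sup b a) (Finite (eps / (1 - Cmod a ^ 2)))) ->
     one_component b).
Proof.
  split.
  - exact kernel_bound_of_one_component.
  - exact one_component_of_kernel.
Qed.
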